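(* There is a deterministic algorithm that, given a word $w$ and a proportion $p\in(0,1]$, decides in time $O(|w|^2/p)$ whether there exists a word $w'$ at Hamming distance $2$ from $w$ such that at least a proportion $p$ of the blocks of $\mathrm{LZ77}(w')$ contain three or more starting positions of blocks of $\mathrm{LZ77}(w)$, and, when such a word exists, outputs a corresponding set of $2$ modifications (substitutions) of $w$.
   Context: For a word $w = w_1\cdots w_n$ over a finite alphabet $\Sigma$, write $w[i:j]=w_i\cdots w_j$. The LZ77 factorization $\mathrm{LZ77}(w)$ is the decomposition $w=P_1\cdots P_z$ into blocks computed greedily from left to right: if $w[1:m]$ has been parsed, the next block is the shortest non-empty prefix of $w[m+1:n]$ that does not occur as a contiguous substring of $w[1:m]$; if there is none, the next block is the whole remaining suffix. A block of $\mathrm{LZ77}(w')$ occupying positions $[l,r]$ contains a starting position $s$ of a block of $\mathrm{LZ77}(w)$ if $l\le s\le r$. The Hamming distance between two words of equal length is the number of positions where they differ. *)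

(* Defs.v *)
From HB Require Import structures.
From mathcomp Require Import all_boot all_order all_algebra.
From mathcomp Require Import reals.

Set Implicit Arguments.
Unset Strict Implicit.
Unset Printing Implicit Defensive.

Import Order.TTheory GRing.Theory Num.Theory.

Section LZ77.
Variable T : eqType.
Implicit Types (u v w : seq T) (i j : nat).

(* Length of the block following the parsed prefix u, when v <> [::] remains to
   be parsed.  If every non-empty prefix of v occurs in u then [find] returns
   size v, and the block is the whole of v. *)
Definition lz77_block_size u v : nat :=
  minn (size v) (find (fun l => ~~ infix (take l v) u) (iota 1 (size v))).+1.

(* Blocks are non-empty, so size v is enough fuel to parse v. *)
Fixpoint lz77_rec (fuel : nat) u v : seq (seq T) :=
  match fuel, v with
  | f.+1, _ :: _ =>
      let l := lz77_block_size u v in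
      take l v :: lz77_rec f (u ++ take l v) (drop l v)
  | _, _ => [::]
  end.

Definition lz77 w : seq (seq T) := lz77_rec (size w) [::] w.

(* Positions are 0-based: block i of w occupies the positions s with
   lz77_start w i <= s < lz77_start w i.+1. *)
Definition lz77_start w i : nat := sumn (take i (shape (lz77 w))).

Definition lz77_starts w : seq nat :=
  [seq lz77_start w i | i <- iota 0 (size (lz77 w))].

Definition starts_in_block w w' i : nat :=
  count (fun s => lz77_start w' i <= s < lz77_start w' i.+1) (lz77_starts w).

Definition nb_blocks_3starts w w' : nat :=
  count (fun i => 3 <= starts_in_block w w' i) (iota 0 (size (lz77 w'))).

(* Only meaningful for words of the same length. *)
Definition hamming w w' : nat := count (fun xy => xy.1 != xy.2) (zip w w').

Definition substitute w i (a : T) : seq T := set_nth a w i a.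

Local Open Scope ring_scope.

Definition good_modification (R : realType) (p : R) w w' : Prop :=
  [/\ size w' = size w,
      hamming w w' = 2%N
    & p * (size (lz77 w'))%:R <= (nb_blocks_3starts w w')%:R].

End LZ77.

(* A word RAM with [ws]-bit words: finitely many named registers, a
   random-access memory, arithmetic modulo 2 ^ ws (subtraction is cut off at 0,
   tests return 0 or 1), unit cost per operation.  The real parameter of an
   instance cannot be stored in a word; a program accesses it only through the
   unit-cost test [ERatio e1 e2], which decides p * e1 <= e2. *)

Inductive binop := Add | Sub | Mul | Div | Mod | Lt | Eq.

Inductive expr :=
  | EConst of nat
  | EReg of nat
  | ELoad of expr
  | EBin of binop & expr & expr
  | ERatio of expr & expr.

Inductive cmd :=
  | Skip
  | Assign of nat & expr
  | Store of expr & expr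
  | Seq of cmd & cmd
  | If of expr & cmd & cmd
  | While of expr & cmd.

Record state := State { reg : nat -> nat; mem : nat -> nat }.

Definition upd (f : nat -> nat) (x v : nat) : nat -> nat :=
  fun y => if y == x then v else f y.

Section Semantics.
Variables (ws : nat) (ratio_le : nat -> nat -> bool).

Definition eval_binop (o : binop) (x y : nat) : nat :=
  match o with
  | Add => (x + y) %% 2 ^ ws
  | Sub => x - y
  | Mul => (x * y) %% 2 ^ ws
  | Div => x %/ y
  | Mod => x %% y
  | Lt => x < y
  | Eq => x == y
  end.

Fixpoint eval (s : state) (e : expr) : nat :=
  match e with
  | EConst c => c %% 2 ^ ws
  | EReg x => reg s x
  | ELoad a => mem s (eval s a)
  | EBin o e1 e2 => eval_binop o (eval s e1) (eval s e2)
  | ERatio e1 e2 => ratio_le (eval s e1) (eval s e2)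
  end.

Fixpoint cost (e : expr) : nat :=
  match e with
  | EConst _ | EReg _ => 1
  | ELoad a => (cost a).+1
  | EBin _ e1 e2 | ERatio e1 e2 => (cost e1 + cost e2).+1
  end.

(* exec c s t s': started in s, the program c halts in s' after t time units. *)
Inductive exec : cmd -> state -> nat -> state -> Prop :=
  | ExecSkip s : exec Skip s 1 s
  | ExecAssign x e s :
      exec (Assign x e) s (cost e).+1 (State (upd (reg s) x (eval s e)) (mem s))
  | ExecStore a e s :
      exec (Store a e) s (cost a + cost e).+1
        (State (reg s) (upd (mem s) (eval s a) (eval s e)))
  | ExecSeq c1 c2 s1 t1 s2 t2 s3 :
      exec c1 s1 t1 s2 -> exec c2 s2 t2 s3 -> exec (Seq c1 c2) s1 (t1 + t2) s3
  | ExecIfTrue e c1 c2 s t s' :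
      eval s e != 0 -> exec c1 s t s' -> exec (If e c1 c2) s (cost e + t).+1 s'
  | ExecIfFalse e c1 c2 s t s' :
      eval s e = 0 -> exec c2 s t s' -> exec (If e c1 c2) s (cost e + t).+1 s'
  | ExecWhileTrue e c s1 t1 s2 t2 s3 :
      eval s1 e != 0 -> exec c s1 t1 s2 -> exec (While e c) s2 t2 s3 ->
      exec (While e c) s1 (cost e + t1 + t2).+1 s3
  | ExecWhileFalse e c s :
      eval s e = 0 -> exec (While e c) s (cost e).+1 s.

Lemma exec_deterministic c s t1 s1 t2 s2 :
  exec c s t1 s1 -> exec c s t2 s2 -> t1 = t2 /\ s1 = s2.
Proof.
move=> H; elim: H t2 s2 => {c s t1 s1}.
- by move=> s t2 s2 H; inversion H.
- by move=> x e s t2 s2 H; inversion H.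
- by move=> a e s t2 s2 H; inversion H.
- move=> c1 c2 s1 t1 s2 t2 s3 _ IH1 _ IH2 t s H; inversion H; subst.
  by have [? ?] := IH1 _ _ ltac:(eassumption); subst;
     have [? ?] := IH2 _ _ ltac:(eassumption); subst.
- move=> e c1 c2 s t s' Ht _ IH t2 s2 H; inversion H; subst.
    by have [? ?] := IH _ _ ltac:(eassumption); subst.
  by move: Ht; rewrite (_ : eval s e = 0).
- move=> e c1 c2 s t s' Hf _ IH t2 s2 H; inversion H; subst.
    by move: Hf => /eqP; rewrite (negbTE (_ : eval s e != 0)).
  by have [? ?] := IH _ _ ltac:(eassumption); subst.
- move=> e c s1 t1 s2 t2 s3 Ht _ IH1 _ IH2 t s H; inversion H; subst.
    by have [? ?] := IH1 _ _ ltac:(eassumption); subst;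
       have [? ?] := IH2 _ _ ltac:(eassumption); subst.
  by move: Ht; rewrite (_ : eval s e = 0).
- move=> e c s Hf t s' H; inversion H; subst => //.
  by move: Hf => /eqP; rewrite (negbTE (_ : eval s e != 0)).
Qed.

End Semantics.

Definition encode_letter (Sigma : finType) (a : Sigma) : nat := enum_rank a.

(* The length of w is in register 0 and its letters in memory cells
   0, ..., size w - 1; everything else is 0. *)
Definition input_state (Sigma : finType) (w : seq Sigma) : state :=
  State (upd (fun=> 0) 0 (size w))
        (nth 0 [seq encode_letter a | a <- w]).

Local Open Scope ring_scope.

(* Register 0 holds the answer; for a positive answer, registers 1, 2 and 3, 4
   hold the positions and the new letters of the two substitutions. *)
Definition correct_output (Sigma : finType) (R : realType) (p : R)
    (w : seq Sigma) (s : state) : Prop :=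
  let solvable := exists w', good_modification p w w' in
  [/\ reg s 0 = 0%N \/ reg s 0 = 1%N,
      reg s 0 = 1%N <-> solvable
    & solvable -> exists (i j : nat) (a b : Sigma),
        [/\ (i < size w)%N, (j < size w)%N, i <> j,
            [/\ reg s 1 = i, reg s 2 = encode_letter a,
                reg s 3 = j & reg s 4 = encode_letter b]
          & good_modification p w (substitute (substitute w i a) j b)]].

Definition halts_correctly (Sigma : finType) (R : realType) (ws : nat)
    (prog : cmd) (p : R) (w : seq Sigma) (time : R) : Prop :=
  exists (t : nat) (s : state),
    [/\ exec ws (fun x y => p * x%:R <= y%:R) prog (input_state w) t s,
        t%:R <= time
      & correct_output p w s].

(* Main.v *)
(* If a block [l, r) of LZ77(w') contains three starts u1 < u2 < u3 of blocks of w,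
   then w'[l, r - 1) has a previous occurrence, at some distance d.  The blocks
   [u1, u2) and [u2, u3) of w have none, so each contains a position x with
   w[x] <> w[x - d].  Each edit removes at most one such mismatch; hence there are
   exactly two, and the edits are determined, up to four choices, by d and u2: they
   repair the last mismatch before u2 and the first one from u2 on.  For the same
   reason no block contains four starts, so that z = |LZ77(w)| <= 3 |LZ77(w')|, and
   good edits are proposed by at least p z / 3 of the pairs (d, u2).  There are at
   most n z pairs, hence at most 12 n / p pairs of edits to be verified.

   One verification takes time O(n) after a preprocessing of the word in time
   O(n^2).  The longest previous occurrence of the rest of w' either avoids the
   edits, and is then found letter by letter with a table giving, for a factor of w
   and a letter c, the last earlier occurrence of the factor followed by c; or it
   contains an edit, and is found by trying the possible offsets of the edit, each
   in constant time with a table of the next mismatches. *)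
Require Import Defs.
From HB Require Import structures.
From mathcomp Require Import all_boot all_order all_algebra.
From mathcomp Require Import reals zify lra.
From Stdlib Require Import Classical.
Import Order.TTheory GRing.Theory Num.Theory.

Set Implicit Arguments.
Unset Strict Implicit.
Unset Printing Implicit Defensive.

(** * A structured language with exact arithmetic *)

(** The time bound leaves no room for initializing or scanning a table of all pairs of edits. When a
    counter reaches a threshold [thr], about p z / 3, its pair is verified and the counter is reset,
    so v verifications consume v * [thr] attempts. The program cannot compute [thr]: it tests p z <=
    3 c on a counter c. While no answer is found, only pairs that failed their verification are
    reset; the counter of a good pair therefore records all its attempts. The analysis follows one
    pair of good edits, fixed in advance, along the list of its hits. Machine arithmetic is kept
    apart: programs are written over natural numbers and multidimensional tables, their executions
    certify that all values stay below [vmax], and compilation turns table indices into addresses in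
    base N. Ticks count loop iterations only, straight-line code being of constant cost. *)

Inductive iexpr :=
  | Cst of nat
  | Rg of nat
  | Inp of iexpr
  | Tab of nat & iexpr & iexpr & iexpr & iexpr
  | Plus of iexpr & iexpr
  | Minus of iexpr & iexpr
  | Less of iexpr & iexpr
  | Equal of iexpr & iexpr
  | Sel of iexpr & iexpr & iexpr
  | Ratio of iexpr & iexpr.

Inductive icmd :=
  | ISkip
  | IAsg of nat & iexpr
  | ISto of nat & iexpr & iexpr & iexpr & iexpr & iexpr
  | ISeq of icmd & icmd
  | IIf of iexpr & icmd & icmd
  | IWhile of iexpr & icmd.

Record ist := IState { rg : nat -> nat; tb : nat -> nat -> nat -> nat -> nat -> nat }.

(* Nat.eqb rather than ==, for reads of numbered registers to reduce. *)
Definition iupd (f : nat -> nat) (x v : nat) : nat -> nat :=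
  fun y => if Nat.eqb x y then v else f y.

Definition tupd (f : nat -> nat -> nat -> nat -> nat -> nat) (k a b c d v : nat) :=
  fun k' a' b' c' d' =>
    if Nat.eqb k k' then
      if [&& a == a', b == b', c == c' & d == d'] then v else f k a' b' c' d'
    else f k' a' b' c' d'.

Arguments iupd : simpl never.
Arguments tupd : simpl never.

Lemma eqb_nn x : Nat.eqb x x.
Proof. by elim: x. Qed.

Lemma iupd_neq f x v y : x != y -> iupd f x v y = f y.
Proof.
rewrite /iupd; case E: (Nat.eqb x y) => // /eqP[].
by elim: x y E => [|x IH] [|y] //= /IH ->.
Qed.

Fixpoint modr (c : icmd) (r : nat) : bool :=
  match c with
  | ISkip | ISto _ _ _ _ _ _ => false
  | IAsg x _ => Nat.eqb x r
  | ISeq c1 c2 | IIf _ c1 c2 => modr c1 r || modr c2 r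
  | IWhile _ c => modr c r
  end.

Fixpoint modt (c : icmd) (k : nat) : bool :=
  match c with
  | ISkip | IAsg _ _ => false
  | ISto x _ _ _ _ _ => Nat.eqb x k
  | ISeq c1 c2 | IIf _ c1 c2 => modt c1 k || modt c2 k
  | IWhile _ c => modt c k
  end.

Section Semantics.
Variables (n sg : nat) (W : nat -> nat) (ratio_le : nat -> nat -> bool).

(* Table indices are below ndig, register and table values below vmax. *)
Definition ndig := n + sg + 2.
Definition vmax := 16 * ndig * ndig.

Fixpoint ev (s : ist) (e : iexpr) : nat :=
  match e with
  | Cst c => c
  | Rg x => rg s x
  | Inp e => W (ev s e)
  | Tab k a b c d => tb s k (ev s a) (ev s b) (ev s c) (ev s d)
  | Plus a b => ev s a + ev s b
  | Minus a b => ev s a - ev s b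
  | Less a b => nat_of_bool (ev s a < ev s b)
  | Equal a b => nat_of_bool (ev s a == ev s b)
  | Sel a b c => if ev s a != 0 then ev s b else ev s c
  | Ratio a b => nat_of_bool (ratio_le (ev s a) (ev s b))
  end.

(** [Sel] is compiled to arithmetic that evaluates both branches, so both have to be safe whatever
    the test says. *)
Fixpoint safe (s : ist) (e : iexpr) : Prop :=
  match e with
  | Cst c => c < vmax
  | Rg x => True
  | Inp e => safe s e /\ ev s e < ndig
  | Tab k a b c d =>
      [/\ k < 8, safe s a /\ ev s a < ndig, safe s b /\ ev s b < ndig,
          safe s c /\ ev s c < ndig & safe s d /\ ev s d < ndig]
  | Plus a b => [/\ safe s a, safe s b & ev s a + ev s b < vmax]
  | Minus a b | Less a b | Equal a b | Ratio a b => safe s a /\ safe s b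
  | Sel a b c => [/\ safe s a, safe s b & safe s c]
  end.

(* The third argument counts loop iterations. *)
Inductive iexec : icmd -> ist -> nat -> ist -> Prop :=
  | XSkip s : iexec ISkip s 0 s
  | XAsg x e s : x != 5 -> safe s e ->
      iexec (IAsg x e) s 0 (IState (iupd (rg s) x (ev s e)) (tb s))
  | XSto k a b c d e s : safe s (Tab k a b c d) -> safe s e ->
      iexec (ISto k a b c d e) s 0
        (IState (rg s) (tupd (tb s) k (ev s a) (ev s b) (ev s c) (ev s d) (ev s e)))
  | XSeq c1 c2 s1 k1 s2 k2 s3 :
      iexec c1 s1 k1 s2 -> iexec c2 s2 k2 s3 -> iexec (ISeq c1 c2) s1 (k1 + k2) s3
  | XIfT e c1 c2 s k s' : safe s e -> ev s e != 0 -> iexec c1 s k s' ->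
      iexec (IIf e c1 c2) s k s'
  | XIfF e c1 c2 s k s' : safe s e -> ev s e = 0 -> iexec c2 s k s' ->
      iexec (IIf e c1 c2) s k s'
  | XWhileT e c s1 k1 s2 k2 s3 : safe s1 e -> ev s1 e != 0 -> iexec c s1 k1 s2 ->
      iexec (IWhile e c) s2 k2 s3 -> iexec (IWhile e c) s1 (k1 + k2).+1 s3
  | XWhileF e c s : safe s e -> ev s e = 0 -> iexec (IWhile e c) s 0 s.

Definition wp (c : icmd) (s : ist) (Q : nat -> ist -> Prop) :=
  exists k s', iexec c s k s' /\ Q k s'.

Lemma iexec_frame c s k s' : iexec c s k s' ->
  (forall r, ~~ modr c r -> rg s' r = rg s r) /\
  (forall t, ~~ modt c t -> tb s' t = tb s t).
Proof.
elim=> {c s k s'} //=.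
- by move=> x e s _ _; split=> // r; rewrite /iupd; case: Nat.eqb.
- by move=> k a b c d e s _ _; split=> // r; rewrite /tupd; case: Nat.eqb.
- move=> c1 c2 s1 k1 s2 k2 s3 _ [r1 t1] _ [r2 t2]; split=> x; rewrite negb_or => /andP[h1 h2].
    by rewrite r2 // r1.
  by rewrite t2 // t1.
- move=> e c1 c2 s k s' _ _ _ [r1 t1]; split=> x; rewrite negb_or => /andP[h1 h2].
    exact: r1.
  exact: t1.
- move=> e c1 c2 s k s' _ _ _ [r1 t1]; split=> x; rewrite negb_or => /andP[h1 h2].
    exact: r1.
  exact: t1.
- move=> e c s1 k1 s2 k2 s3 _ _ _ [r1 t1] _ [r2 t2]; split=> x h.
    by rewrite r2 // r1.
  by rewrite t2 // t1.
Qed.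

(** The consequence rule with the frame built in: specifications need not list the registers and
    tables that a program never assigns. *)
Lemma wp_use c s (Q Q' : nat -> ist -> Prop) : wp c s Q ->
  (forall k s', Q k s' -> (forall r, ~~ modr c r -> rg s' r = rg s r) ->
     (forall t, ~~ modt c t -> tb s' t = tb s t) -> Q' k s') -> wp c s Q'.
Proof.
by move=> [k [s' [h q]]] H; exists k, s'; have [? ?] := iexec_frame h; split; last exact: H.
Qed.

Lemma wp_skip s (Q : nat -> ist -> Prop) : Q 0 s -> wp ISkip s Q.
Proof. by move=> q; exists 0, s; split=> //; constructor. Qed.

Lemma wp_asg x e s (Q : nat -> ist -> Prop) : x != 5 -> safe s e ->
  Q 0 (IState (iupd (rg s) x (ev s e)) (tb s)) -> wp (IAsg x e) s Q.
Proof. by move=> hx he q; eexists; eexists; split; [constructor|exact: q]. Qed.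

Lemma wp_sto k a b c d e s (Q : nat -> ist -> Prop) :
  safe s (Tab k a b c d) -> safe s e ->
  Q 0 (IState (rg s) (tupd (tb s) k (ev s a) (ev s b) (ev s c) (ev s d) (ev s e))) ->
  wp (ISto k a b c d e) s Q.
Proof. by move=> hx he q; eexists; eexists; split; [constructor|exact: q]. Qed.

Lemma wp_seq c1 c2 s (Q : nat -> ist -> Prop) :
  wp c1 s (fun k1 s1 => wp c2 s1 (fun k2 s2 => Q (k1 + k2) s2)) ->
  wp (ISeq c1 c2) s Q.
Proof.
move=> [k1 [s1 [h1 [k2 [s2 [h2 q]]]]]]; exists (k1 + k2), s2; split=> //.
exact: XSeq h1 h2.
Qed.

Lemma wp_if e c1 c2 s (Q : nat -> ist -> Prop) : safe s e ->
  (ev s e != 0 -> wp c1 s Q) -> (ev s e = 0 -> wp c2 s Q) -> wp (IIf e c1 c2) s Q.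
Proof.
move=> he h1 h2; have [h|h] := eqVneq (ev s e) 0.
  by have [k [s' [x q]]] := h2 h; exists k, s'; split=> //; apply: XIfF.
by have [k [s' [x q]]] := h1 h; exists k, s'; split=> //; apply: XIfT.
Qed.

(* The bound B on the ticks makes the loop terminate. *)
Lemma wp_while e c s (I Q : nat -> ist -> Prop) (B : nat) :
  I 0 s ->
  (forall k s, I k s -> k <= B /\ safe s e) ->
  (forall k s, I k s -> ev s e != 0 -> wp c s (fun k' s' => I (k + k').+1 s')) ->
  (forall k s, I k s -> ev s e = 0 -> Q k s) ->
  wp (IWhile e c) s Q.
Proof.
move=> h0 hB hc hQ.
suff H : forall b k s, b = B - k -> I k s ->
    exists k' s', iexec (IWhile e c) s k' s' /\ Q (k + k') s' by exact: (H B 0 s (esym (subn0 B)) h0).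
elim/ltn_ind=> b IH k {h0}s hb hI.
have [hk hs] := hB _ _ hI.
have [h|h] := eqVneq (ev s e) 0.
  by exists 0, s; split; [apply: XWhileF|rewrite addn0; apply: hQ].
have [k1 [s1 [x1 I1]]] := hc _ _ hI h.
have [k1B _] := hB _ _ I1.
have lt_b : B - (k + k1).+1 < b by lia.
have [k2 [s2 [x2 q]]] := IH _ lt_b _ _ erefl I1.
exists (k1 + k2).+1, s2; split; first exact: XWhileT x1 x2.
by rewrite (_ : k + _ = (k + k1).+1 + k2) //; lia.
Qed.

Definition IFor x hi c :=
  IWhile (Less (Rg x) hi) (ISeq c (IAsg x (Plus (Rg x) (Cst 1)))).

(** The bound [hi] is evaluated anew in each round, so it has to keep the value [H] under the
    invariant. *)
Lemma wp_for x hi c s (J : nat -> nat -> ist -> Prop) (lo H : nat)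
    (Q : nat -> ist -> Prop) :
  x != 5 -> H.+1 < vmax -> lo <= H -> rg s x = lo ->
  J lo 0 s ->
  (forall i k s, lo <= i <= H -> J i k s -> rg s x = i -> safe s hi /\ ev s hi = H) ->
  (forall i k s, lo <= i < H -> J i k s -> rg s x = i ->
     wp c s (fun k' s' => rg s' x = i /\
        J i.+1 (k + k').+1 (IState (iupd (rg s') x i.+1) (tb s')))) ->
  (forall k s, J H k s -> rg s x = H -> Q k s) ->
  wp (IFor x hi c) s Q.
Proof.
move=> x5 HV loH sx J0 Jhi Jc JQ.
suff H' : forall b i k s, b = H - i -> lo <= i <= H -> J i k s -> rg s x = i ->
    exists k' s', iexec (IFor x hi c) s k' s' /\ Q (k + k') s'.
  by apply: (H' (H - lo) lo 0) => //; rewrite leqnn.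
elim=> [|b IH] i k {sx J0}s hb iH hJ sx.
  have [hs he] := Jhi _ _ _ iH hJ sx.
  have iE : i = H by lia.
  exists 0, s; split; last by rewrite addn0; apply: JQ; rewrite -iE.
  by apply: XWhileF => //=; rewrite sx he iE ltnn.
have [hs he] := Jhi _ _ _ iH hJ sx.
have iH1 : lo <= i < H by lia.
have [k1 [s1 [x1 [s1x J1]]]] := Jc i k s iH1 hJ sx.
have iH2 : lo <= i.+1 <= H by lia.
have hb2 : b = H - i.+1 by lia.
have [|k2 [s2 [x2 q]]] := IH i.+1 _ _ hb2 iH2 J1.
  by rewrite /= /iupd eqb_nn.
exists (k1 + k2).+1, s2; split; last by rewrite (_ : k + _ = (k + k1).+1 + k2) //; lia.
apply: XWhileT x2 => //=; first by rewrite sx he; lia.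
rewrite -[k1]addn0; apply: XSeq x1 _.
rewrite [i.+1](_ : _ = ev s1 (Plus (Rg x) (Cst 1))); last by rewrite /= s1x addn1.
by apply: XAsg => //=; split=> //; rewrite ?s1x; lia.
Qed.

End Semantics.

Ltac read_regs := cbn [rg tb]; repeat match goal with
  | |- context [iupd ?f ?x ?v ?y] =>
      let b := eval compute in (Nat.eqb x y) in
      lazymatch b with
      | true => change (iupd f x v y) with v
      | false => change (iupd f x v y) with (f y)
      end
  end.

(** * Longest previous occurrences in a window without edits *)

Notation "c1 ;; c2" := (ISeq c1 c2) (at level 61, right associativity).

Definition IAnd (a b : iexpr) := Sel a b (Cst 0).

(* Registers 1, 2 and 3, 4 hold the edits (i, a) and (j, b), register 5 the length
   n; an edit at position n changes nothing. *)
Definition IWord (e : iexpr) :=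
  Sel (Equal e (Rg 1)) (Rg 2) (Sel (Equal e (Rg 3)) (Rg 4) (Inp e)).

Arguments IWord : simpl never.

Definition edit (W : nat -> nat) i a j b : nat -> nat :=
  fun x => if x == i then a else if x == j then b else W x.

(* Registers 6: start of the block, 7: best length so far, 8 and 9: bounds of the
   window.  Register 11 is the last start in the window of the prefix of length
   reg 10 of the block; when the next letter does not follow there, table 0 gives
   the last earlier start where it does. *)
Definition walker : icmd :=
  IAsg 10 (Cst 0);; IAsg 11 (Rg 9);; IAsg 12 (Cst 1);;
  IWhile (IAnd (Rg 12) (Less (Plus (Rg 6) (Rg 10)) (Rg 5)))
   (IAsg 13 (IWord (Plus (Rg 6) (Rg 10)));;
    IIf (IAnd (Less (Plus (Rg 11) (Rg 10)) (Rg 9))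
              (Equal (Inp (Plus (Rg 11) (Rg 10))) (Rg 13)))
      (IAsg 10 (Plus (Rg 10) (Cst 1)))
      (IAsg 14 (Tab 0 (Rg 11) (Rg 10) (Rg 13) (Cst 0));;
       IIf (Less (Rg 8) (Rg 14))
         (IAsg 11 (Minus (Rg 14) (Cst 1));; IAsg 10 (Plus (Rg 10) (Cst 1)))
         (IAsg 12 (Cst 0))));;
  IIf (Less (Rg 7) (Rg 10)) (IAsg 7 (Rg 10)) ISkip.

Section Walker.
Variables (n sg : nat) (W : nat -> nat) (ratio_le : nat -> nat -> bool).
Hypothesis W_lt : forall x, x < n -> W x < sg.

Local Notation wp := (wp n sg W ratio_le).
Local Notation ev := (ev W ratio_le).
Local Notation safe := (safe n sg W ratio_le).
Local Notation N := (ndig n sg).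
Local Notation V := (vmax n sg).

Lemma vmax_ge : 16 * (n + sg + 2) <= V.
Proof. by rewrite /vmax /ndig; nia. Qed.

Lemma evE :
  ((forall s c, ev s (Cst c) = c) * (forall s r, ev s (Rg r) = rg s r) *
   (forall s e, ev s (Inp e) = W (ev s e)) *
   (forall s k a b c d, ev s (Tab k a b c d) = tb s k (ev s a) (ev s b) (ev s c) (ev s d)) *
   (forall s a b, ev s (Plus a b) = (ev s a + ev s b)%N) *
   (forall s a b, ev s (Minus a b) = (ev s a - ev s b)%N))%type.
Proof. by []. Qed.

Lemma ev_Less s a b : (ev s (Less a b) != 0) = (ev s a < ev s b).
Proof. by rewrite /= eqb0 negbK. Qed.

Lemma ev_Equal s a b : (ev s (Equal a b) != 0) = (ev s a == ev s b).
Proof. by rewrite /= eqb0 negbK. Qed.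

Lemma ev_IAnd s a b : (ev s (IAnd a b) != 0) = (ev s a != 0) && (ev s b != 0).
Proof. by rewrite /IAnd /=; case: (ev s a == 0). Qed.

Definition testE := (ev_IAnd, ev_Less, ev_Equal).

Lemma ev_false s e : ev s e = 0 -> (ev s e != 0) = false.
Proof. by move->. Qed.

Lemma ev_IWord s e :
  ev s (IWord e) = edit W (rg s 1) (rg s 2) (rg s 3) (rg s 4) (ev s e).
Proof. by rewrite /IWord /edit /=; case: (_ == rg s 1) => //=; case: (_ == rg s 3). Qed.

Lemma safe_IWord s e : safe s e -> ev s e <= n -> safe s (IWord e).
Proof. by move=> h1 h2; rewrite /IWord /= /ndig; repeat split=> //; lia. Qed.

Lemma safe_IAnd s a b : safe s a -> safe s b -> safe s (IAnd a b).
Proof. by split=> //=; have := vmax_ge; lia. Qed.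

Definition eqfac (f g : nat -> nat) s t l := forall x, x < l -> f (s + x) = g (t + x).

Lemma eqfacS f g s t l : eqfac f g s t l.+1 <-> eqfac f g s t l /\ f (s + l) = g (t + l).
Proof.
split=> [h|[h e] x]; first by split=> [x xl|]; apply: h; lia.
by rewrite ltnS leq_eqVlt => /predU1P[->|/h].
Qed.

Lemma eqfac_trans f g h s t u l : eqfac f g s t l -> eqfac g h t u l -> eqfac f h s u l.
Proof. by move=> h1 h2 x xl; rewrite h1 // h2. Qed.

Lemma eqfac_sym f g s t l : eqfac f g s t l -> eqfac g f t s l.
Proof. by move=> h x xl; rewrite h. Qed.

(* v - 1 is the last start s' < s of an occurrence of the factor of length l at
   s that is followed by the letter c; v = 0 if there is none. *)
Definition is_prev_occ s l c v :=
  [/\ v <= s, 0 < v -> eqfac W W v.-1 s l /\ W (v.-1 + l) = c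
    & forall s', v <= s' < s -> ~ (eqfac W W s' s l /\ W (s' + l) = c)].

Definition prev_occ_table (f : nat -> nat -> nat -> nat -> nat) :=
  forall s l c, s + l < n -> c < sg -> is_prev_occ s l c (f s l c 0).

Definition edits_ok (s : ist) :=
  [/\ rg s 1 <= rg s 3, rg s 3 <= n, rg s 1 < n -> rg s 2 < sg &
      rg s 3 < n -> rg s 4 < sg].

Definition edited (s : ist) := edit W (rg s 1) (rg s 2) (rg s 3) (rg s 4).

Lemma editedE s : edited s = edit W (rg s 1) (rg s 2) (rg s 3) (rg s 4).
Proof. by []. Qed.

Lemma edited_lt s x : edits_ok s -> x < n -> edited s x < sg.
Proof.
rewrite /edited /edit => -[h1 h2 h3 h4] hx.
by do 2![case: eqP => [?|_]; first lia]; apply: W_lt.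
Qed.

(** Sources are read in [W], which agrees with the edited word on a window without edits. No source
    is asked for l = 0, so the window may be empty. *)
Definition window_max (U : nat -> nat) m A B l :=
  [/\ m + l <= n, 0 < l -> exists s, [/\ A <= s, s + l <= B & eqfac W U s m l]
    & m + l < n -> forall s, A <= s -> s + l.+1 <= B -> ~ eqfac W U s m l.+1].

(** When the next letter does not follow at the last start p, later starts are excluded by the
    maximality of p, and the table is consulted at p because the factor of [W] there equals the
    prefix of the block. Each round gains a letter or ends the loop. *)
Lemma walker_spec s (m best A B : nat) :
  rg s 5 = n -> edits_ok s -> prev_occ_table (tb s 0) ->
  rg s 6 = m -> rg s 7 = best -> rg s 8 = A -> rg s 9 = B -> m < n -> B <= m ->
  wp walker s (fun k s' => exists l,
    [/\ rg s' 7 = maxn best l, k <= l.+1 & window_max (edited s) m A B l]).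
Proof.
move=> s5 sok pct s6 s7 s8 s9 mn Bm.
have hV := vmax_ge.
set U := edited s.
have hU x : x < n -> U x < sg by exact: edited_lt.
rewrite /walker.
apply: wp_seq; apply: wp_asg => //=; first by lia.
apply: wp_seq; apply: wp_asg => //=.
apply: wp_seq; apply: wp_asg => //=; first by lia.
apply: wp_seq.
(* The flag in register 12 pays for the last round, the only one that gains no letter. *)
pose I k s1 := let l := rg s1 10 in let p := rg s1 11 in
  [/\ (forall r, r <= 9 -> rg s1 r = rg s r) /\ tb s1 = tb s,
      [/\ rg s1 12 <= 1, k + rg s1 12 <= l.+1, p + l <= B & m + l <= n],
      (eqfac W U p m l /\ (0 < l -> A <= p)),
      (forall p', p < p' -> p' + l <= B -> ~ eqfac W U p' m l) &
      (rg s1 12 = 0 -> forall p', A <= p' -> p' + l.+1 <= B -> ~ eqfac W U p' m l.+1)].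
apply: (wp_while (I := I) (B := n.+1)).
- rewrite /I /=; split.
  + by split=> // r hr; rewrite !iupd_neq //; lia.
  + by rewrite /=; read_regs; rewrite s9; repeat split; lia.
  + by split.
  + by move=> p'; rewrite /=; read_regs; rewrite s9; lia.
  + by [].
- move=> k s1 [[fr ft] [h1 h2 h3 h4] _ _ _]; split; first lia.
  by rewrite /= (fr 6) // s6; repeat split; lia.
- move=> k s1 [[fr ft] [h1 h2 h3 h4] [he hA] hmax hend] /=.
  rewrite (fr 6) // (fr 5) // s6 s5.
  case go: (rg s1 12 == 0) => //= hlt.
  have {}hlt : m + rg s1 10 < n by move: hlt; case: (_ < n).
  have go1 : rg s1 12 = 1 by move/eqP: go; lia.
  set l := rg s1 10 in h2 h3 h4 he hA hmax hend hlt *.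
  set p := rg s1 11 in h3 he hA hmax *.
  apply: wp_seq; apply: wp_asg => //.
    by apply: safe_IWord => //=; rewrite ?(fr 6) // s6; repeat split; lia.
  rewrite ev_IWord !fr // [ev _ _]/= (fr 6) // s6 -/(edited s) -/U -/l.
  set c := U (m + l).
  have hc : c < sg by apply: hU.
  apply: wp_if.
    by rewrite /=; read_regs; rewrite -/l -/p; repeat split; rewrite ?/ndig; lia.
  + rewrite /=; read_regs; rewrite -/l -/p (fr 9) // s9.
    rewrite eqb0 negbK; case: ltnP => //= pB; rewrite eqb0 negbK => /eqP hWc.
    apply: wp_asg => //=; first by rewrite /=; read_regs; rewrite -/l; repeat split; lia.
    split=> /=.
    * by split=> // r hr; rewrite -fr // !iupd_neq //; lia.
    * by rewrite /=; read_regs; rewrite -/l -/p; split; lia.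
    * rewrite /=; read_regs; rewrite -/l -/p addn1; split; first by apply/eqfacS; split.
      (* For l = 0 the maximality of p forces p = B, and the comparison inside the window cannot
         have succeeded. *)
      have [l0 _|/hA //] := posnP l.
      have [|E] : p < B \/ p = B by lia.
        by move=> /hmax; case; rewrite ?l0 //; lia.
      by lia.
    * rewrite /=; read_regs; rewrite -/l -/p addn1 => p' h5 h6 /eqfacS[h7 _].
      by apply: (hmax p') => //; lia.
    * by rewrite /=; read_regs; rewrite go1.
  + rewrite /=; read_regs; rewrite -/l -/p (fr 9) // s9 => hne.
    have {}hne : ~ (p + l < B /\ W (p + l) = c).
      by move=> [h5 h6]; move: hne; rewrite h5 h6 eqxx.
    apply: wp_seq; apply: wp_asg => //=.
      by rewrite /=; read_regs; rewrite -/l -/p; repeat split; rewrite /ndig; lia.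
    rewrite /=; read_regs; rewrite -/l -/p ft.
    have [] := @pct p l c; [lia|by []|].
    set v := tb s 0 p l c 0; move=> v1 v2 v3.
    apply: wp_if => //=; read_regs; rewrite (fr 8) // s8.
    * case: ltnP => //= Av _.
      have [|h5 h6] := v2; first lia.
      apply: wp_seq; apply: wp_asg => //=; first by split=> //; lia.
      apply: wp_asg => //=; first by rewrite /=; read_regs; repeat split; lia.
      have vE : v.-1 = v - 1 by lia.
      split=> /=.
      -- by split=> // r hr; rewrite -fr // !iupd_neq //; lia.
      -- by rewrite /=; read_regs; rewrite -/l -/p; split; lia.
      -- rewrite /=; read_regs; rewrite -/l addn1 -vE; split; last lia.
         by apply/eqfacS; split=> //; apply: eqfac_trans he.
      -- rewrite /=; read_regs; rewrite -/l addn1 => p' h7 h8 /eqfacS[h9 h10].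
         have [|p'p] := ltnP p p'; first by move=> /hmax; apply=> //; lia.
         have [E|p'p2] := eqVneq p' p; first by apply: hne; rewrite -E; split=> //; lia.
         apply: (v3 p'); first lia.
         by split=> //; apply: eqfac_trans h9 (eqfac_sym he).
      -- by rewrite /=; read_regs; rewrite go1.
    * case: ltnP => //= vA _.
      apply: wp_asg => //=; first lia.
      split=> /=.
      -- by split=> // r hr; rewrite -fr // !iupd_neq //; lia.
      -- by rewrite /=; read_regs; rewrite -/l -/p; split; lia.
      -- by rewrite /=; read_regs; rewrite -/l -/p.
      -- by rewrite /=; read_regs; rewrite -/l -/p.
      -- rewrite /=; read_regs; rewrite -/l => _ p' h7 h8 /eqfacS[h9 h10].
         have [|p'p] := ltnP p p'; first by move=> /hmax; apply=> //; lia.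
         have [E|p'p2] := eqVneq p' p; first by apply: hne; rewrite -E; split=> //; lia.
         apply: (v3 p'); first lia.
         by split=> //; apply: eqfac_trans h9 (eqfac_sym he).
- move=> k s1 [[fr ft] [h1 h2 h3 h4] [he hA] hmax hend] /=.
  rewrite (fr 6) // (fr 5) // s6 s5 => hg.
  have {}hg : m + rg s1 10 < n -> rg s1 12 = 0.
    by move=> h; move: hg; rewrite h; case: (rg s1 12).
  have wm : window_max U m A B (rg s1 10).
    split=> //; last by move=> /hg /hend.
    by move=> l0; exists (rg s1 11); split=> //; apply: hA.
  apply: wp_if => //=; rewrite (fr 7) // s7; case: ltnP => //= hl _.
    apply: wp_asg => //=; exists (rg s1 10); rewrite /=; read_regs; split=> //; lia.
  apply: wp_skip; exists (rg s1 10); rewrite (fr 7) // s7; split=> //; lia.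
Qed.
End Walker.

(** * Occurrences across an edit *)

Definition IMin (a b : iexpr) := Sel (Less a b) a b.

Definition INext (y : iexpr) := Sel (Less (Rg 1) y) (Sel (Less (Rg 3) y) (Rg 5) (Rg 3)) (Rg 1).

Arguments IMin : simpl never.
Arguments INext : simpl never.

Definition jump (y : iexpr) : icmd :=
  IAsg 12 (IMin (Rg 11) (IMin (Tab 1 (Rg 10) y (Cst 0) (Cst 0))
    (IMin (INext y) (Plus (INext (Minus y (Rg 10))) (Rg 10))))).

(* Compares the edited word at y and at y - reg 10, up to reg 11.  Every letter
   compared one by one is an edit or lies at distance reg 10 from an edit, hence at
   most four iterations. *)
Definition extend : icmd :=
  jump (Rg 6);;
  IWhile (IAnd (Less (Rg 12) (Rg 11)) (Equal (IWord (Rg 12)) (IWord (Minus (Rg 12) (Rg 10)))))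
    (jump (Plus (Rg 12) (Cst 1))).

(* Source positions reg 8 - d are tried for d up to the best length only: the
   letters before the edit are a prefix of the block that has already been found. *)
Definition scan : icmd :=
  IAsg 9 (Cst 0);;
  IWhile (IAnd (IAnd (Less (Rg 9) (Plus (Rg 7) (Cst 1))) (Less (Rg 9) (Plus (Rg 8) (Cst 1))))
               (Less (Rg 8) (Rg 6)))
    (IAsg 10 (Minus (Plus (Rg 6) (Rg 9)) (Rg 8));;
     IAsg 11 (IMin (Rg 5) (Plus (Rg 6) (Rg 10)));;
     extend;;
     IIf (Less (Rg 7) (Minus (Rg 12) (Rg 6))) (IAsg 7 (Minus (Rg 12) (Rg 6))) ISkip;;
     IAsg 9 (Plus (Rg 9) (Cst 1))).

Section Extension.
Variables (n sg : nat) (W : nat -> nat) (ratio_le : nat -> nat -> bool).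
Hypothesis W_lt : forall x, x < n -> W x < sg.

Local Notation wp := (wp n sg W ratio_le).
Local Notation ev := (ev W ratio_le).
Local Notation safe := (safe n sg W ratio_le).
Local Notation N := (ndig n sg).
Local Notation V := (vmax n sg).
Local Notation edited := (edited W).

Definition next_edit i j y := if i < y then if j < y then n else j else i.

Lemma ev_IMin s a b : ev s (IMin a b) = minn (ev s a) (ev s b).
Proof. by rewrite /IMin /= /minn eqb0 negbK. Qed.

Lemma safe_IMin s a b : safe s a -> safe s b -> safe s (IMin a b).
Proof. by []. Qed.

Lemma ev_INext s y : rg s 5 = n -> ev s (INext y) = next_edit (rg s 1) (rg s 3) (ev s y).
Proof. by move=> s5; rewrite /INext /= !eqb0 !negbK s5. Qed.

Lemma safe_INext s y : safe s y -> safe s (INext y).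
Proof. by []. Qed.

Definition is_next_mismatch d x v :=
  [/\ x <= v <= n, forall y, x <= y < v -> W y = W (y - d) & v < n -> W v <> W (v - d)].

Definition mismatch_table (f : nat -> nat -> nat -> nat -> nat) :=
  forall d x, 0 < d -> d <= x <= n -> is_next_mismatch d x (f d x 0 0).

(* The variant of the loop of extend: edits not yet passed by y or y - d. *)
Definition pending i j d y : nat := (y <= i) + (y <= j) + (y <= i + d) + (y <= j + d).

(** Before this position the comparison at distance d meets neither a mismatch of [W] nor an edit on
    either side, so it succeeds without being made. *)
Definition jump_pos (f : nat -> nat -> nat -> nat -> nat) i j d e y :=
  minn e (minn (f d y 0 0) (minn (next_edit i j y) (next_edit i j (y - d) + d))).

(** A stop whose comparison succeeds cannot be a mismatch of [W] away from the edits; so y' or y' -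
    d is an edit, which the next jump leaves behind. *)
Lemma jump_pos_spec f i a j b d e y (U := edit W i a j b) (y' := jump_pos f i j d e y) :
  mismatch_table f -> i <= j <= n -> 0 < d -> d <= y <= e -> e <= n ->
  [/\ y <= y' <= e, forall x, y <= x < y' -> U x = U (x - d)
    & y' < e -> U y' = U (y' - d) -> pending i j d y'.+1 < pending i j d y'].
Proof.
move=> hf ij d0 ye en.
have [|h1 h2 h3] := hf d y d0; first lia.
have h4 : y <= next_edit i j y by rewrite /next_edit; case: ltnP => ?; [case: ltnP => ?|]; lia.
have h5 : y - d <= next_edit i j (y - d).
  by rewrite /next_edit; case: ltnP => ?; [case: ltnP => ?|]; lia.
have next_neq z x : z <= x < next_edit i j z -> (x == i) = false /\ (x == j) = false.
  by rewrite /next_edit; case: (ltnP i z) => ?; [case: (ltnP j z) => ?|]; lia.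
split; first by rewrite /y' /jump_pos; lia.
  move=> x hx; rewrite /U /edit.
  have [|-> ->] := next_neq y x; first by move: hx; rewrite /y' /jump_pos; lia.
  have [|-> ->] := next_neq (y - d) (x - d); first by move: hx; rewrite /y' /jump_pos; lia.
  by apply: h2; move: hx; rewrite /y' /jump_pos; lia.
move=> he hU.
have [E|] := boolP [|| y' == i, y' == j, y' - d == i | y' - d == j].
  have : d <= y' by rewrite /y' /jump_pos; lia.
  by rewrite /pending; lia.
rewrite !negb_or => /and4P[e1 e2 e3 e4].
move: hU; rewrite /U /edit (negbTE e1) (negbTE e2) (negbTE e3) (negbTE e4).
have next_or z : [\/ next_edit i j z = n, next_edit i j z = i | next_edit i j z = j].
  by rewrite /next_edit; case: ltnP => ?; [case: ltnP => ?|]; constructor.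
have yE : y' = f d y 0 0.
  have [//|[E|E]] : y' = f d y 0 0 \/
      y' = next_edit i j y \/ y' = next_edit i j (y - d) + d.
    by move: he; rewrite /y' /jump_pos; lia.
    by case: (next_or y) => F; move: he e1 e2 e3 e4; rewrite E F; lia.
  by case: (next_or (y - d)) => F; move: he e1 e2 e3 e4; rewrite E F; lia.
rewrite yE => hW; have : f d y 0 0 < n by rewrite -yE; lia.
by move=> /h3.
Qed.

Lemma jump_spec s yx (y := ev s yx) :
  rg s 5 = n -> mismatch_table (tb s 1) -> safe s yx ->
  rg s 1 <= rg s 3 <= n -> 0 < rg s 10 -> rg s 10 <= y <= rg s 11 -> rg s 11 <= n ->
  wp (jump yx) s (fun k s' => k = 0 /\
    s' = IState (iupd (rg s) 12
      (jump_pos (tb s 1) (rg s 1) (rg s 3) (rg s 10) (rg s 11) y)) (tb s)).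
Proof.
move=> s5 hf hs ij d0 yd en; have hV := vmax_ge n sg.
apply: wp_asg => //.
  do !apply: safe_IMin => //.
    by rewrite /= -/y; repeat (split=> //); rewrite ?/ndig; lia.
  have ne z : next_edit (rg s 1) (rg s 3) z <= n.
    by rewrite /next_edit; case: ltnP => ?; [case: ltnP => ?|]; lia.
  split; [by apply: safe_INext|by []|].
  by rewrite ev_INext //=; have := ne (y - rg s 10); rewrite /y; lia.
by split=> //; rewrite !(ev_IMin, ev_INext, evE).
Qed.

Lemma extend_spec s (i := rg s 1) (j := rg s 3) (m := rg s 6) (d := rg s 10)
    (e := rg s 11) (U := edited s) :
  rg s 5 = n -> mismatch_table (tb s 1) -> i <= j <= n -> 0 < d <= m -> m <= e <= n ->
  wp extend s (fun k s' => let y := rg s' 12 in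
    [/\ k <= 4, m <= y <= e, forall x, m <= x < y -> U x = U (x - d)
      & y < e -> U y <> U (y - d)]).
Proof.
move=> s5 hf ij dm me; have hV := vmax_ge n sg.
have d0 : 0 < d by lia.
apply: wp_seq.
apply: (wp_use (@jump_spec s (Rg 6) s5 hf _ ij _ _ _)) => //=; try lia.
move=> _ _ [-> ->] _ _; rewrite -/i -/j -/m -/d -/e.
have dme : d <= m <= e by lia.
have en : e <= n by lia.
have [y1 y2 y3] := @jump_pos_spec _ i (rg s 2) j (rg s 4) _ _ m hf ij d0 dme en.
set y0 := jump_pos _ _ _ _ _ _ in y1 y2 y3 *.
pose I k s1 := let y := rg s1 12 in
  [/\ (forall r, r != 12 -> rg s1 r = rg s r) /\ tb s1 = tb s,
      k + pending i j d y <= 4, m <= y <= e, forall x, m <= x < y -> U x = U (x - d)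
    & y < e -> U y = U (y - d) -> pending i j d y.+1 < pending i j d y].
apply: (wp_while (I := I) (B := 4)).
- rewrite /I /=; read_regs; split=> //.
    by split=> // r hr; rewrite iupd_neq // eq_sym.
  by rewrite /pending; lia.
- move=> k s1 [[fr ft] h1 h2 h3 h4]; split; first lia.
  by apply: safe_IAnd => //; split; apply: safe_IWord => //=; lia.
- move=> k s1 [[fr ft] h1 h2 h3 h4].
  rewrite !testE !ev_IWord !evE !(fr 1, fr 2, fr 3, fr 4, fr 10, fr 11) //.
  move=> /andP[ye /eqP yeq].
  have dl := h4 ye yeq.
  have f1 : mismatch_table (tb s1 1) by rewrite ft.
  have ye1 : d <= (rg s1 12).+1 <= e by lia.
  have [g1 g3 g10 g11] : [/\ rg s1 1 = i, rg s1 3 = j, rg s1 10 = d & rg s1 11 = e].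
    by split; apply: fr.
  have sy : safe s1 (Plus (Rg 12) (Cst 1)) by rewrite /=; repeat split; lia.
  have g5 : rg s1 5 = n by rewrite fr.
  apply: (wp_use (@jump_spec s1 _ g5 f1 sy _ _ _ _)); rewrite ?g1 ?g3 ?g10 ?g11 //.
    by rewrite /= addn1.
  move=> _ _ [-> ->] _ _; rewrite !evE.
  rewrite ft addn1 addn0.
  have [z1 z2 z3] := @jump_pos_spec _ i (rg s 2) j (rg s 4) _ _ _ hf ij d0 ye1 en.
  split=> /=; read_regs.
  + by split=> // r hr; rewrite iupd_neq 1?eq_sym // fr.
  + set y' := jump_pos _ _ _ _ _ _ in z1 z2 z3 *.
    have : pending i j d y' <= pending i j d (rg s1 12).+1 by rewrite /pending; lia.
    lia.
  + lia.
  + move=> x hx; have [hx1|hx1] := leqP (rg s1 12).+1 x; first by apply: z2; lia.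
    have [->|hx2] := eqVneq x (rg s1 12); first by [].
    by apply: h3; lia.
  + by [].
- move=> k s1 [[fr ft] h1 h2 h3 h4].
  move=> /ev_false; rewrite !testE !ev_IWord !evE !(fr 1, fr 2, fr 3, fr 4, fr 10, fr 11) //.
  rewrite -/(edited s) -/e -/d -/U => hz.
  split=> //; first lia.
  by move=> ye yeq; move: hz; rewrite ye yeq eqxx.
Qed.

End Extension.

Definition window (a b : iexpr) : icmd := IAsg 8 a;; IAsg 9 b;; walker.

Definition block : icmd :=
  IAsg 7 (Cst 0);;
  window (Cst 0) (IMin (Rg 1) (Rg 6));;
  window (Plus (Rg 1) (Cst 1)) (IMin (Rg 3) (Rg 6));;
  window (Plus (Rg 3) (Cst 1)) (Rg 6);;
  IAsg 8 (Rg 1);; scan;;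
  IAsg 8 (Rg 3);; scan;;
  IAsg 15 (IMin (Minus (Rg 5) (Rg 6)) (Plus (Rg 7) (Cst 1))).

(** The source may not overlap the block: the factorization looks for substrings of the parsed
    prefix. *)
Definition occurs (U : nat -> nat) m l := exists2 s, s + l <= m & eqfac U U s m l.

Definition is_block_size n (U : nat -> nat) m L := exists l,
  [/\ L = minn (n - m) l.+1, m + l <= n, occurs U m l & m + l < n -> ~ occurs U m l.+1].

Section BlockSize.
Variables (n sg : nat) (W : nat -> nat) (ratio_le : nat -> nat -> bool).
Hypothesis W_lt : forall x, x < n -> W x < sg.

Local Notation wp := (wp n sg W ratio_le).
Local Notation ev := (ev W ratio_le).
Local Notation safe := (safe n sg W ratio_le).
Local Notation N := (ndig n sg).
Local Notation V := (vmax n sg).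
Local Notation edited := (edited W).

Lemma eqfac_le f g s t l l' : l' <= l -> eqfac f g s t l -> eqfac f g s t l'.
Proof. by move=> ll h x xl; apply: h; lia. Qed.

(** An offset costs four ticks of [extend] and one for the round. The offsets never exceed the
    current best length, so the scan is paid for by the final length b, however much it grows on the
    way. *)
Lemma scan_spec s (m := rg s 6) (best := rg s 7) (e := rg s 8) (U := edited s) :
  rg s 5 = n -> mismatch_table n W (tb s 1) -> rg s 1 <= rg s 3 <= n -> m < n -> e <= n ->
  occurs U m best -> m + best <= n ->
  wp scan s (fun k s' => let b := rg s' 7 in
    [/\ k <= 5 * b.+1, best <= b <= n - m, occurs U m b
      & e < m -> forall d l, d <= best -> d <= e -> e - d + l <= m -> m + l <= n ->
          eqfac U U (e - d) m l -> l <= b]).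
Proof.
move=> s5 hf ij mn en ob mb; have hV := vmax_ge n sg.
apply: wp_seq; apply: wp_asg => //=; first lia.
pose I k s1 := let b := rg s1 7 in let d := rg s1 9 in
  [/\ (forall r, r <= 8 -> r != 7 -> rg s1 r = rg s r) /\ (forall t, tb s1 t = tb s t),
      k <= 5 * d /\ d <= b.+1, best <= b <= n - m, occurs U m b
    & e < m -> forall d' l, d' < d -> d' <= e -> e - d' + l <= m -> m + l <= n ->
          eqfac U U (e - d') m l -> l <= b].
apply: (wp_while (I := I) (B := 5 * n.+1)).
- split=> //=; read_regs; rewrite -/best; last lia.
  by split=> // r r8 r7; rewrite iupd_neq //; lia.
- move=> k s1 [[fr ft] [h1 h2] h3 h4 h5]; split; first lia.
  have f8 : rg s1 8 = e by rewrite fr.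
  by do 2!apply: safe_IAnd => //; repeat split=> //=; lia.
- move=> k s1 [[fr ft] [h1 h2] h3 h4 h5].
  have f8 : rg s1 8 = e by rewrite fr.
  have f6 : rg s1 6 = m by rewrite fr.
  rewrite !testE !evE f8 f6 => /andP[/andP[c1 c2] c3].
  apply: wp_seq; apply: wp_asg => //; first by rewrite /= f6; repeat split; lia.
  rewrite !evE f6 f8; set d := rg s1 9 in h1 h2 h5 c1 c2 *.
  apply: wp_seq; apply: wp_asg => //.
    by apply: safe_IMin => //=; read_regs; rewrite f6; repeat split; lia.
  rewrite ev_IMin !evE; read_regs; rewrite f6 (fr 5) // s5.
  set s2 := IState _ _.
  have U2 : edited s2 = U.
    by rewrite /U !editedE /s2 /=; read_regs; rewrite !fr.
  apply: wp_seq.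
  have := @extend_spec n sg W ratio_le s2; rewrite U2.
  have -> : rg s2 1 = rg s 1 by rewrite -(fr 1).
  have -> : rg s2 3 = rg s 3 by rewrite -(fr 3).
  have -> : rg s2 6 = m by [].
  have -> : rg s2 5 = n by rewrite -s5 -(fr 5).
  have -> : rg s2 10 = m + d - e by [].
  (* The source starts at e - d and has to end before m, so at most m + d - e letters are copied. *)
  have -> : rg s2 11 = minn n (m + (m + d - e)) by [].
  have -> : tb s2 1 = tb s 1 by rewrite -(ft 1).
  set D := m + d - e => es; have sE : e - d = m - D by lia.
  have {}es := es erefl hf ij.
  apply: (wp_use (es _ _)); [lia|lia|].
  move=> k2 s3 [x1 x2 x3 x4] fr3 ft3.
  set y := rg s3 12 in x2 x3 x4.
  have occ_y : occurs U m (y - m).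
    exists (m - D); first lia.
    move=> x hx; have -> : m - D + x = m + x - D by lia.
    by rewrite -x3 //; lia.
  have max_y l : e - d + l <= m -> m + l <= n -> eqfac U U (e - d) m l -> l <= y - m.
    move=> l1 l2 he; rewrite leqNgt; apply/negP=> ly.
    apply: x4; first lia.
    have := he (y - m) ly.
    have -> : m + (y - m) = y by lia.
    by have -> : e - d + (y - m) = y - D by lia.
  have fr3' r : r <= 8 -> r != 7 -> rg s3 r = rg s r.
    move=> r8 r7; rewrite fr3; last by move: r r8 r7; do 9?case=> //.
    by rewrite /s2 /= !iupd_neq ?fr //; lia.
  have b3 : rg s3 7 = rg s1 7 by rewrite fr3.
  have d3 : rg s3 9 = d by rewrite fr3.
  have ft3' t : tb s3 t = tb s t by rewrite ft3 // -ft.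
  have f63 : rg s3 6 = m by rewrite fr3'.
  set b := rg s1 7 in h2 h3 h4 h5 c1 b3.
  have done s4 : (forall r, r <= 8 -> r != 7 -> rg s4 r = rg s r) ->
      (forall t, tb s4 t = tb s t) -> rg s4 7 = maxn b (y - m) -> rg s4 9 = d.+1 ->
      I (k + (0 + (0 + (k2 + (0 + 0))))).+1 s4.
    move=> r4 t4 e7 e9; split; rewrite ?e7 ?e9 //; try lia.
      by rewrite /maxn; case: ltnP.
    move=> em d' l d'd h6 h7 h8 h9; rewrite leq_max.
    have [E|ne] := eqVneq d' d; first by rewrite -E in max_y; rewrite max_y ?orbT.
    by rewrite (h5 em d') //; lia.
  apply: wp_seq; apply: wp_if => //.
  + rewrite ev_Less !evE f63 b3 -/y => by_.
    apply: wp_asg => //; apply: wp_asg => //=; read_regs; rewrite ?d3; first by repeat split; lia.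
    apply: done => //=; read_regs; rewrite ?d3 ?f63 -/y; try lia.
    by move=> r r8 r7; rewrite !iupd_neq ?fr3' //; lia.
  + move/ev_false; rewrite ev_Less !evE f63 b3 -/y => by_.
    apply: wp_skip; apply: wp_asg => //=; rewrite ?d3; first by repeat split; lia.
    apply: done => //=; read_regs; rewrite ?d3 ?b3; try lia.
    by move=> r r8 r7; rewrite !iupd_neq ?fr3' //; lia.
- move=> k s1 [[fr ft] [h1 h2] h3 h4 h5] /ev_false.
  have f8 : rg s1 8 = e by rewrite fr.
  have f6 : rg s1 6 = m by rewrite fr.
  rewrite !testE !evE f8 f6 => c; split=> //; first lia.
  move=> em d l h6 h7 h8 h9 h10; apply: (h5 em d) => //.
  by move: c; rewrite em; lia.
Qed.

Lemma window_maxP (U : nat -> nat) m A B l s l' : window_max n W U m A B l ->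
  A <= s -> s + l' <= B -> m + l' <= n -> eqfac W U s m l' -> l' <= l.
Proof.
move=> [h1 h2 h3] h4 h5 h6 h7; rewrite leqNgt; apply/negP=> ll.
by apply: (h3 _ s) => //; [lia|lia|apply: eqfac_le h7; lia].
Qed.

Lemma window_occurs (U : nat -> nat) m A B l : window_max n W U m A B l -> B <= m ->
  (forall x, A <= x < B -> U x = W x) -> occurs U m l.
Proof.
move=> [h1 h2 h3] Bm hU; have [->|l0] := posnP l; first by exists 0.
have [s [h4 h5 h6]] := h2 l0; exists s; first lia.
by move=> x xl; rewrite -h6 // hU //; lia.
Qed.

Lemma occurs_maxn (U : nat -> nat) m l l' : occurs U m l -> occurs U m l' -> occurs U m (maxn l l').
Proof. by rewrite /maxn; case: ltnP. Qed.

Lemma window_spec s a b (m := rg s 6) (best := rg s 7) (A := ev s a)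
    (B := ev (IState (iupd (rg s) 8 A) (tb s)) b) (U := edited s) :
  rg s 5 = n -> edits_ok n sg s -> prev_occ_table n sg W (tb s 0) -> m < n ->
  safe s a -> safe (IState (iupd (rg s) 8 A) (tb s)) b -> B <= m ->
  wp (window a b) s (fun k s' => exists l,
    [/\ rg s' 7 = maxn best l, k <= l.+1 & window_max n W U m A B l]).
Proof.
move=> s5 sok pct mn sa sb Bm.
apply: wp_seq; apply: wp_asg => //.
apply: wp_seq; apply: wp_asg => //.
apply: (wp_use (@walker_spec n sg W ratio_le W_lt _ m best A B _ _ _ _ _ _ _ _ _)) => //.
Qed.

(** A source that covers edits is caught at the first one it covers: the letters before that edit
    lie in a window without edits, so they are no more than the length found there, and the offset
    is among those scanned. *)
Lemma block_spec s (m := rg s 6) (U := edited s) :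
  rg s 5 = n -> edits_ok n sg s -> prev_occ_table n sg W (tb s 0) ->
  mismatch_table n W (tb s 1) -> m < n ->
  wp block s (fun k s' => is_block_size n U m (rg s' 15) /\ k <= 26 * rg s' 15).
Proof.
move=> s5 sok pct mmt mn; have hV := vmax_ge n sg.
have [o1 o2 _ _] := sok.
set i := rg s 1 in o1; set j := rg s 3 in o1 o2.
have keep s1 : (forall r, r < 7 -> rg s1 r = rg s r) -> (forall t, tb s1 t = tb s t) ->
    [/\ [/\ rg s1 5 = n, edits_ok n sg s1, prev_occ_table n sg W (tb s1 0) &
       mismatch_table n W (tb s1 1)], edited s1 = U, rg s1 1 = i, rg s1 3 = j & rg s1 6 = m].
  move=> r1 t1; split; rewrite ?t1 ?r1 //; first by split=> //; rewrite /edits_ok !r1.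
  by rewrite /U !editedE !r1.
apply: wp_seq; apply: wp_asg => //=; first lia.
set s1 := IState _ _.
have K1 : (forall r, r < 7 -> rg s1 r = rg s r) /\ (forall t, tb s1 t = tb s t).
  by split=> // r r7; rewrite /s1 /= iupd_neq //; lia.
have [[q1 q2 q3 q4] q5 q6 q7 q8] := keep _ K1.1 K1.2.
have lt7 c s2 s3 : (forall r, r < 7 -> rg s2 r = rg s r) -> (forall t, tb s2 t = tb s t) ->
    (forall r, ~~ modr c r -> rg s3 r = rg s2 r) -> (forall t, ~~ modt c t -> tb s3 t = tb s2 t) ->
    (forall r, r < 7 -> ~~ modr c r) -> (forall t, ~~ modt c t) ->
    (forall r, r < 7 -> rg s3 r = rg s r) /\ (forall t, tb s3 t = tb s t).
  move=> r2 t2 r3 t3 mr mt; split=> [r r7|t]; first by rewrite r3 ?r2 // mr.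
  by rewrite t3 ?t2 // mt.
have mr_window a b r : r < 7 -> ~~ modr (window a b) r by move: r; do 7?case=> //.
have mr_scan r : r < 7 -> ~~ modr scan r by move: r; do 7?case=> //.
apply: wp_seq.
apply: (wp_use (@window_spec s1 (Cst 0) (IMin (Rg 1) (Rg 6)) q1 q2 q3 _ _ _ _)); rewrite ?q8 //.
- by rewrite /=; lia.
- by rewrite ev_IMin !evE; read_regs; lia.
rewrite q5 ev_IMin !evE; read_regs; rewrite q6 q8 (_ : rg s1 7 = 0) //.
move=> k2 s2 [l1 [b2 k2l w1]] fr2 ft2; rewrite max0n in b2.
have K2 := lt7 _ _ _ K1.1 K1.2 fr2 ft2 (mr_window _ _) (fun=> isT).
have [[{}q1 {}q2 {}q3 {}q4] {}q5 {}q6 {}q7 {}q8] := keep _ K2.1 K2.2.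
apply: wp_seq.
apply: (wp_use (@window_spec s2 (Plus (Rg 1) (Cst 1)) (IMin (Rg 3) (Rg 6)) q1 q2 q3 _ _ _ _));
  rewrite ?q8 //.
- by rewrite /= q6; repeat split; lia.
- by rewrite ev_IMin !evE; read_regs; lia.
rewrite q5 ev_IMin !evE; read_regs; rewrite q6 q7 q8 b2 addn1.
move=> k3 s3 [l2 [b3 k3l w2]] fr3 ft3.
have K3 := lt7 _ _ _ K2.1 K2.2 fr3 ft3 (mr_window _ _) (fun=> isT).
have [[{}q1 {}q2 {}q3 {}q4] {}q5 {}q6 {}q7 {}q8] := keep _ K3.1 K3.2.
apply: wp_seq.
apply: (wp_use (@window_spec s3 (Plus (Rg 3) (Cst 1)) (Rg 6) q1 q2 q3 _ _ _ _));
  rewrite ?q8 //.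
- by rewrite /= q7; repeat split; lia.
- by rewrite !evE; read_regs; lia.
rewrite q5 !evE; read_regs; rewrite q7 q8 b3 addn1.
move=> k4 s4 [l3 [b4 k4l w3]] fr4 ft4.
have K4 := lt7 _ _ _ K3.1 K3.2 fr4 ft4 (mr_window _ _) (fun=> isT).
have [[{}q1 {}q2 {}q3 {}q4] {}q5 {}q6 {}q7 {}q8] := keep _ K4.1 K4.2.
set b := maxn (maxn l1 l2) l3 in b4.
have U_eq x : x != i -> x != j -> U x = W x.
  by rewrite /U !editedE /edit => /negbTE-> /negbTE->.
have ob : occurs U m b.
  by do !apply: occurs_maxn; [apply: window_occurs w1 _ _|apply: window_occurs w2 _ _|
    apply: window_occurs w3 _ _] => //; try lia; move=> x hx; apply: U_eq; lia.
have mb : m + b <= n by have [x1 _ _] := w1; have [x2 _ _] := w2; have [x3 _ _] := w3; lia.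
apply: wp_seq; apply: wp_asg => //.
set s5' := IState _ _.
have K5 : (forall r, r < 7 -> rg s5' r = rg s r) /\ (forall t, tb s5' t = tb s t).
  by split=> [r r7|]; [rewrite /s5' /= iupd_neq ?K4.1 //; lia|exact: K4.2].
have [[{}q1 {}q2 {}q3 {}q4] {}q5 q6' q7' q8'] := keep _ K5.1 K5.2.
have q9 : rg s5' 8 = i by rewrite /s5' /=; read_regs; rewrite q6.
have b5 : rg s5' 7 = b by rewrite /s5' /=; read_regs; rewrite b4.
apply: wp_seq.
have := @scan_spec s5' q1 q4; rewrite q6' q7' q8' q9 b5 q5 => sc.
apply: (wp_use (sc _ mn _ ob mb)) => {sc}; first by rewrite o1.
  lia.
move=> k5 s5'' [k5b b5b ob5 max_i] fr5 ft5.
have K6 := lt7 _ _ _ K5.1 K5.2 fr5 ft5 mr_scan (fun=> isT).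
have [[{}q1 {}q2 {}q3 {}q4] {}q5 {}q6 {}q7 {}q8] := keep _ K6.1 K6.2.
set b' := rg s5'' 7 in k5b b5b ob5 max_i.
apply: wp_seq; apply: wp_asg => //.
set s6 := IState _ _.
have K7 : (forall r, r < 7 -> rg s6 r = rg s r) /\ (forall t, tb s6 t = tb s t).
  by split=> [r r7|]; [rewrite /s6 /= iupd_neq ?K6.1 //; lia|exact: K6.2].
have [[{}q1 {}q2 {}q3 {}q4] {}q5 {}q6' {}q7' {}q8'] := keep _ K7.1 K7.2.
have q9' : rg s6 8 = j by rewrite /s6 /=; read_regs; rewrite q7.
have b6 : rg s6 7 = b' by [].
apply: wp_seq.
have := @scan_spec s6 q1 q4; rewrite q6' q7' q8' q9' b6 q5 => sc.
apply: (wp_use (sc _ mn _ ob5 _)) => {sc}; [by rewrite o1|by []|lia|].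
move=> k6 s7 [k6b b7b ob7 max_j] fr7 ft7.
have K8 := lt7 _ _ _ K7.1 K7.2 fr7 ft7 mr_scan (fun=> isT).
have [[{}q1 {}q2 {}q3 {}q4] {}q5 {}q6 {}q7 {}q8] := keep _ K8.1 K8.2.
set b'' := rg s7 7 in k6b b7b ob7 max_j.
apply: wp_asg => //.
  apply: safe_IMin => //=; repeat split; first lia.
  by rewrite -/b''; lia.
(* Three windows and two scans take at most (3 + 2 * 5) (b'' + 1) ticks, and b'' + 1 is at most
   twice the block length, which is b'' instead of b'' + 1 only when the word ends there. *)
rewrite ev_IMin !evE; read_regs; rewrite q1 q8 -/b'' addn1; split; last lia.
exists b''; split=> //; first lia.
move=> mb'' [t t1 t2].
have Weq t' l : (forall x, t' <= x < t' + l -> x != i /\ x != j) -> eqfac U U t' m l ->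
    eqfac W U t' m l.
  by move=> h h' x xl; rewrite -h' // U_eq //; apply h; lia.
have [ti|ti] := leqP (t + b''.+1) i.
  have t3 : eqfac W U t m b''.+1 by apply: Weq t2; lia.
  have : b''.+1 <= l1 by apply: (window_maxP w1 _ _ _ t3); lia.
  by lia.
have [ti'|ti'] := leqP t i.
  have h1 : i - t <= l1.
    apply: (window_maxP (s := t) w1) => //; try lia.
    by apply: Weq; [lia|apply: eqfac_le t2; lia].
  have := max_i _ (i - t) b''.+1; rewrite (_ : i - (i - t) = t); last lia.
  move=> h2; have : b''.+1 <= b' by apply: h2 => //; try lia.
  by lia.
have [tj|tj] := leqP (t + b''.+1) j.
  have t3 : eqfac W U t m b''.+1 by apply: Weq t2; lia.
  have : b''.+1 <= l2 by apply: (window_maxP w2 _ _ _ t3); lia.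
  by lia.
have [tj'|tj'] := leqP t j.
  have h1 : j - t <= l2.
    apply: (window_maxP (s := t) w2) => //; try lia.
    by apply: Weq; [lia|apply: eqfac_le t2; lia].
  have := max_j _ (j - t) b''.+1; rewrite (_ : j - (j - t) = t); last lia.
  move=> h2; have : b''.+1 <= b'' by apply: h2 => //; lia.
  by lia.
have t3 : eqfac W U t m b''.+1 by apply: Weq t2; lia.
  have : b''.+1 <= l3 by apply: (window_maxP w3 _ _ _ t3); lia.
  by lia.
Qed.

End BlockSize.

(** * Tables of the input word *)

Lemma tupd_eq f k a b c d v : tupd f k a b c d v k a b c d = v.
Proof. by rewrite /tupd eqb_nn !eqxx. Qed.

Lemma tupd_neq f k a b c d v k' a' b' c' d' :
  [|| k != k', a != a', b != b', c != c' | d != d'] ->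
  tupd f k a b c d v k' a' b' c' d' = f k' a' b' c' d'.
Proof.
rewrite /tupd; case E: (Nat.eqb k k') => //.
have -> : k = k' by elim: k k' E => [|k IH] [|k'] //= /IH ->.
rewrite eqxx /= -!negb_and.
by rewrite (eq_sym a) (eq_sym b) (eq_sym c) (eq_sym d) => /negbTE->.
Qed.

Definition mismatch_prog : icmd :=
  IAsg 6 (Cst 1);;
  IFor 6 (Plus (Rg 5) (Cst 1))
   (ISto 1 (Rg 6) (Rg 5) (Cst 0) (Cst 0) (Rg 5);;
    IAsg 7 (Cst 0);;
    IFor 7 (Minus (Rg 5) (Rg 6))
     (IAsg 8 (Minus (Rg 5) (Plus (Rg 7) (Cst 1)));;
      IIf (Equal (Inp (Rg 8)) (Inp (Minus (Rg 8) (Rg 6))))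
        (ISto 1 (Rg 6) (Rg 8) (Cst 0) (Cst 0)
          (Tab 1 (Rg 6) (Plus (Rg 8) (Cst 1)) (Cst 0) (Cst 0)))
        (ISto 1 (Rg 6) (Rg 8) (Cst 0) (Cst 0) (Rg 8)))).

(** Register 8 holds 1 + the last earlier start of the current factor, or 0. If the letter c follows
    there, this is the entry for c; otherwise the entry is that of the earlier start, already
    computed for the same factor. The entry for the letter that really follows becomes register 8
    for the next length. *)
Definition prev_occ_prog (sg : nat) : icmd :=
  IAsg 6 (Cst 0);;
  IFor 6 (Rg 5)
   (IAsg 8 (Rg 6);;
    IAsg 7 (Cst 0);;
    IFor 7 (Minus (Rg 5) (Rg 6))
     (IAsg 9 (Cst 0);;
      IFor 9 (Cst sg)
        (IIf (Equal (Rg 8) (Cst 0))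
          (ISto 0 (Rg 6) (Rg 7) (Rg 9) (Cst 0) (Cst 0))
          (IIf (Equal (Inp (Plus (Minus (Rg 8) (Cst 1)) (Rg 7))) (Rg 9))
             (ISto 0 (Rg 6) (Rg 7) (Rg 9) (Cst 0) (Rg 8))
             (ISto 0 (Rg 6) (Rg 7) (Rg 9) (Cst 0)
               (Tab 0 (Minus (Rg 8) (Cst 1)) (Rg 7) (Rg 9) (Cst 0)))));;
      IAsg 8 (Tab 0 (Rg 6) (Rg 7) (Inp (Plus (Rg 6) (Rg 7))) (Cst 0)))).

Section Tables.
Variables (n sg : nat) (W : nat -> nat) (ratio_le : nat -> nat -> bool).
Hypothesis W_lt : forall x, x < n -> W x < sg.

Local Notation wp := (wp n sg W ratio_le).
Local Notation ev := (ev W ratio_le).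
Local Notation safe := (safe n sg W ratio_le).
Local Notation N := (ndig n sg).
Local Notation V := (vmax n sg).

Lemma mismatch_prog_spec s : rg s 5 = n ->
  wp mismatch_prog s (fun k s' => k <= 2 * (n * n) /\ mismatch_table n W (tb s' 1)).
Proof.
move=> s5; have hV := vmax_ge n sg.
have NE : N = n + sg + 2 by [].
apply: wp_seq; apply: wp_asg => //=; first lia.
set s1 := IState _ _.
pose J i (k : nat) s1 := [/\ rg s1 5 = n, k <= (i - 1) * (n + 1) &
  forall d x, 0 < d < i -> d <= x <= n -> is_next_mismatch n W d x (tb s1 1 d x 0 0)].
apply: (wp_for (J := J) (lo := 1) (H := n.+1)) => //; try lia.
- by split=> //=; lia.
- by move=> i k s2 hi [h5 _ _] _; rewrite /= h5; repeat split; lia.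
- move=> d k s2 hd [h5 hk ht] h6.
  apply: wp_seq; apply: wp_sto => //.
    by rewrite /= h5 h6; repeat split; rewrite ?NE; lia.
  rewrite !evE h5 h6; apply: wp_seq; apply: wp_asg => //=; first lia.
  set s3 := IState _ _.
  pose K y (k : nat) s1 := [/\ rg s1 5 = n, rg s1 6 = d, k <= y,
    (forall x, n - y <= x <= n -> is_next_mismatch n W d x (tb s1 1 d x 0 0)) &
    (forall d' x, d' != d -> tb s1 1 d' x 0 0 = tb s2 1 d' x 0 0)].
  apply: (wp_for (J := K) (lo := 0) (H := n - d)) => //; try lia.
  + split=> //=.
      move=> x hx; have -> : x = n by lia.
      by rewrite tupd_eq; split; lia.
    by move=> d' x d'd; rewrite tupd_neq // (eq_sym d) d'd orbT.
  + by move=> y k2 s4 hy [g5 g6 _ _] _; rewrite /= g5 g6.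
  + move=> y k2 s4 hy [g5 g6 gk gt gt'] g7.
    apply: wp_seq; apply: wp_asg => //; first by rewrite /= g7; repeat split; lia.
    rewrite !evE g5 g7; set z := n - (y + 1).
    have done v : is_next_mismatch n W d z v ->
        rg s4 7 = y /\ K y.+1 (k2 + (0 + 0)).+1
          (IState (iupd (iupd (rg s4) 8 z) 7 y.+1) (tupd (tb s4) 1 d z 0 0 v)).
      move=> hv; split=> //; split; read_regs => //.
      * lia.
      * move=> x hx; have [->|xz] := eqVneq x z; first by rewrite tupd_eq.
        by rewrite tupd_neq; [apply: gt; rewrite /z in xz; lia|rewrite (eq_sym z) xz !orbT].
      * by move=> d' x d'd; rewrite tupd_neq ?gt' // (eq_sym d) d'd orbT.
    have [|t1 t2 t3] := gt (z + 1); first by rewrite /z; lia.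
    apply: wp_if => //.
    * by rewrite /=; read_regs; rewrite NE; repeat split; lia.
    * rewrite ev_Equal !evE; read_regs; rewrite g6 => /eqP hW.
      apply: wp_sto; first by rewrite /=; read_regs; rewrite g6 NE; repeat split; lia.
        by rewrite /=; read_regs; rewrite g6 NE; repeat split; lia.
      rewrite !evE; read_regs; rewrite g6; apply: done; split; first lia.
          move=> x hx; have [->//|xz] := eqVneq x z.
          by apply: t2; lia.
        by move/t3.
    * move/ev_false; rewrite ev_Equal !evE; read_regs; rewrite g6 => /eqP hW.
      apply: wp_sto; first by rewrite /=; read_regs; rewrite g6 NE; repeat split; lia.
        by [].
      rewrite !evE; read_regs; rewrite g6; apply: done.
      by split=> [|x hx|_]; [rewrite /z; lia|lia|].
  + move=> k2 s4 [g5 g6 gk gt gt'] g7; split; first by read_regs.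
    split; read_regs => //; first nia.
    move=> d' x hd' hx; have [E|d'd] := eqVneq d' d.
      by rewrite E in hx *; apply: gt; lia.
    by rewrite gt' //; apply: ht; lia.
- move=> k s2 [h5 hk ht] _; split; first nia.
  by move=> d x d0 hx; apply: ht; lia.
Qed.

(** [is_prev_occ] without the following letter, with the same shift by one: the content of register
    8 in [prev_occ_prog]. *)
Definition is_prev s l p :=
  [/\ p <= s, 0 < p -> eqfac W W p.-1 s l & forall s', p <= s' < s -> ~ eqfac W W s' s l].

Lemma is_prev_of_occ s l p : is_prev_occ W s l (W (s + l)) p -> is_prev s l.+1 p.
Proof.
move=> [h1 h2 h3]; split=> // [p0|s' hs']; first by apply/eqfacS; exact: h2.
by move/eqfacS; apply: h3.
Qed.

Lemma is_prev_occ0 s l c : is_prev s l 0 -> is_prev_occ W s l c 0.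
Proof. by move=> [h1 h2 h3]; split=> // s' hs' [h _]; apply: (h3 s'). Qed.

Lemma is_prev_occ_here s l c p : is_prev s l p -> 0 < p -> W (p - 1 + l) = c ->
  is_prev_occ W s l c p.
Proof.
move=> [h1 h2 h3] p0 hW; split=> // [_|s' hs' [h _]]; last exact: (h3 s').
by split; [exact: h2|rewrite -subn1].
Qed.

(** The factors at s and p - 1 coincide, so they have the same occurrences before p - 1, and none
    starts strictly between p - 1 and s. *)
Lemma is_prev_occ_before s l c p v : is_prev s l p -> 0 < p -> W (p - 1 + l) <> c ->
  is_prev_occ W (p - 1) l c v -> is_prev_occ W s l c v.
Proof.
rewrite subn1 => -[h1 h2 h3] p0 hW [g1 g2 g3]; have hp := h2 p0.
split; first lia.
  by move=> /g2[g4 g5]; split=> //; apply: eqfac_trans hp.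
move=> s' hs' [h4 h5].
have [ps'|s'p] := leqP p s'; first by apply: (h3 s') => //; lia.
have [E|ne] := eqVneq s' p.-1; first by rewrite -E in hW.
apply: (g3 s'); first lia.
by split=> //; apply: eqfac_trans h4 (eqfac_sym hp).
Qed.

Lemma prev_occ_prog_spec s : rg s 5 = n ->
  wp (prev_occ_prog sg) s (fun k s' => k <= (sg + 3) * (n * n) /\
    prev_occ_table n sg W (tb s' 0)).
Proof.
move=> s5; have hV := vmax_ge n sg.
have NE : N = n + sg + 2 by [].
apply: wp_seq; apply: wp_asg => //=; first lia.
set s1 := IState _ _.
pose J i (k : nat) s1 := [/\ rg s1 5 = n, k <= i * (n * (sg + 1) + 1) &
  forall s l c, s < i -> s + l < n -> c < sg -> is_prev_occ W s l c (tb s1 0 s l c 0)].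
apply: (wp_for (J := J) (lo := 0) (H := n)) => //; try lia.
- by move=> i k s2 hi [h5 _ _] _.
- move=> i k s2 hi [h5 hk ht] h6.
  apply: wp_seq; apply: wp_asg => //; rewrite !evE h6.
  apply: wp_seq; apply: wp_asg => //=; first lia.
  set s3 := IState _ _.
  pose K l (k : nat) s1 := [/\ rg s1 5 = n, rg s1 6 = i, k <= l * (sg + 1),
    is_prev i l (rg s1 8) &
    forall s l' c, (s < i) || (s == i) && (l' < l) -> s + l' < n -> c < sg ->
      is_prev_occ W s l' c (tb s1 0 s l' c 0)].
  apply: (wp_for (J := K) (lo := 0) (H := n - i)) => //; try lia.
  + split=> //=; first by split=> //; read_regs => //; lia.
    by move=> s' l' c; rewrite ltn0 andbF orbF; apply: ht.
  + by move=> y k2 s4 hy [g5 g6 _ _ _] _; rewrite /= g5 g6.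
  + move=> l k2 s4 hl [g5 g6 gk gp gt] g7.
    set p := rg s4 8 in gp; have [pi _ _] := gp.
    apply: wp_seq; apply: wp_asg => //=; first lia.
    apply: wp_seq.
    set s5' := IState _ _.
    pose L c (k : nat) s1 := [/\ [/\ rg s1 5 = n, rg s1 6 = i, rg s1 7 = l & rg s1 8 = p], k = c,
      (forall c', c' < c -> is_prev_occ W i l c' (tb s1 0 i l c' 0)) &
      forall s l' c, (s < i) || (s == i) && (l' < l) -> s + l' < n -> c < sg ->
      is_prev_occ W s l' c (tb s1 0 s l' c 0)].
    apply: (wp_for (J := L) (lo := 0) (H := sg)) => //; try lia.
    * by move=> c k3 s6 hc _ _; split=> //=; lia.
    * move=> c k3 s6 hc [[r5 r6 r7 r8] rk rt rt'] r9.
      have done v : is_prev_occ W i l c v ->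
          L c.+1 (k3 + 0).+1
            (IState (iupd (rg s6) 9 c.+1) (tupd (tb s6) 0 i l c 0 v)).
        move=> hv; split; read_regs => //; first lia.
          move=> c' hc'; have [->|ne] := eqVneq c' c; first by rewrite tupd_eq.
          by rewrite tupd_neq ?(eq_sym c) ?ne ?orbT //; apply: rt; lia.
        move=> s' l' c' hs' h1 h2; rewrite tupd_neq; first exact: rt'.
        by move: hs'; lia.
      have safeT : safe s6 (Tab 0 (Rg 6) (Rg 7) (Rg 9) (Cst 0)).
        by rewrite /= r6 r7 r9 NE; repeat split; lia.
      apply: wp_if; first by rewrite /=; repeat split; lia.
        rewrite ev_Equal !evE r8 => /eqP p0.
        apply: wp_sto => //=; first lia.
        by rewrite r6 r7 r9; split=> //; apply: done; apply: is_prev_occ0; rewrite -p0.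
      move/ev_false; rewrite ev_Equal !evE r8 => /eqP/eqP p0.
      apply: wp_if; first by rewrite /= r7 r8 NE; repeat split; lia.
        rewrite ev_Equal !evE r7 r8 r9 => /eqP hW.
        apply: wp_sto => //=; rewrite r6 r7 r8 r9; split=> //; apply: done.
        by apply: is_prev_occ_here gp _ hW; lia.
      move/ev_false; rewrite ev_Equal !evE r7 r8 r9 => /eqP hW.
      apply: wp_sto => //; first by rewrite /= r7 r8 r9 NE; repeat split; lia.
      rewrite !evE r6 r7 r8 r9; split=> //; apply: done.
      apply: (is_prev_occ_before gp _ hW); first lia.
      by apply: rt'; lia.
    * move=> k3 s6 [[r5 r6 r7 r8] rk rt rt'] r9.
      have hc : W (i + l) < sg by apply: W_lt; lia.
      apply: wp_asg => //; first by rewrite /= r6 r7 NE; repeat split; lia.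
      rewrite !evE r6 r7; split; read_regs => //.
      split; read_regs => //; first by rewrite rk; lia.
        by apply: is_prev_of_occ; apply: rt.
      move=> s' l' c hs' h1 h2.
      have [/andP[/eqP-> /eqP->]|ne] := boolP ((s' == i) && (l' == l)); first exact: rt.
      by apply: rt' => //; lia.
  + move=> k2 s4 [g5 g6 gk gp gt] g7; split; first by [].
    split; read_regs => //; first nia.
    by move=> s' l' c h1 h2 h3; apply: gt => //; lia.
- move=> k s2 [h5 hk ht] _; split; first nia.
  by move=> s' l' c h1 h2; apply: ht => //; lia.
Qed.

End Tables.

(** * Blocks and their starts *)

Section Factorization.
Variable T : eqType.
Implicit Types w : seq T.

Definition blk w m := lz77_block_size (take m w) (drop m w).

Lemma blk_bounds w m : m < size w -> 0 < blk w m <= size w - m.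
Proof. by rewrite /blk /lz77_block_size size_drop; lia. Qed.

(** With enough fuel the parser depends on the boundary m alone, so the boundaries are the iterates
    of one function; the second equation says when the iteration stops. *)
Lemma shape_lz77_rec w f m (bs := shape (lz77_rec f (take m w) (drop m w))) :
  m <= size w -> size w - m <= f ->
  forall k, k <= size bs ->
    iter k (fun x => x + blk w x) m = m + sumn (take k bs) /\
    (k < size bs) = (m + sumn (take k bs) < size w).
Proof.
rewrite {}/bs; elim: f m => [|f IH] m mw hf k.
  by rewrite leqn0 => /eqP->; rewrite /= addn0; split=> //; lia.
have [E|ne] := eqVneq m (size w).
  rewrite drop_oversize ?E //= leqn0 => /eqP->.
  by rewrite /= addn0; split=> //; lia.
have mw' : m < size w by lia.
have [x [v dE]] : exists x v, drop m w = x :: v.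
  have : 0 < size (drop m w) by rewrite size_drop; lia.
  by case: (drop m w) => // x v _; exists x, v.
have bb := blk_bounds mw'.
rewrite dE /lz77_rec -/(lz77_rec f) -dE -/(blk w m).
rewrite -takeD drop_drop [blk w m + m]addnC.
have sb : size (take (blk w m) (drop m w)) = blk w m.
  by rewrite size_takel // size_drop; lia.
case: k => [_|k]; first by rewrite /= addn0.
rewrite iterSr /= ltnS => hk.
have [||h1 h2] := IH (m + blk w m) _ _ k hk; [lia|lia|].
rewrite sb addnA -h1; split=> //.
by rewrite ltnS h2 h1.
Qed.

Lemma lz77_start_iter w k : k <= size (lz77 w) ->
  lz77_start w k = iter k (fun x => x + blk w x) 0 /\
  (k < size (lz77 w)) = (lz77_start w k < size w).
Proof.
have := @shape_lz77_rec w (size w) 0 (leq0n _).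
rewrite subn0 take0 drop0 -/(lz77 w) size_map => h hk.
by have [h1 h2] := h (leqnn _) k hk; rewrite /lz77_start h1 h2 !add0n.
Qed.

Lemma lz77_startS w k : k < size (lz77 w) ->
  lz77_start w k.+1 = lz77_start w k + blk w (lz77_start w k).
Proof.
move=> hk; have [-> _] := lz77_start_iter hk.
by have [-> _] := lz77_start_iter (ltnW hk).
Qed.

Lemma lz77_start_ltn w k : k <= size (lz77 w) ->
  (lz77_start w k < size w) = (k < size (lz77 w)).
Proof. by move=> /lz77_start_iter[]. Qed.

Lemma lz77_start0 w : lz77_start w 0 = 0.
Proof. by rewrite /lz77_start take0. Qed.

Lemma lz77_start_le w k : k <= size (lz77 w) -> lz77_start w k <= size w.
Proof.
elim: k => [|k IH] hk; first by rewrite lz77_start0.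
have lt_k : lz77_start w k < size w by rewrite (lz77_start_ltn (ltnW hk)).
by have := blk_bounds lt_k; have := IH (ltnW hk); rewrite (lz77_startS hk); lia.
Qed.

Lemma lz77_start_size w : lz77_start w (size (lz77 w)) = size w.
Proof. by have := lz77_start_ltn (leqnn (size (lz77 w))); have := lz77_start_le (leqnn (size (lz77 w))); lia. Qed.

Lemma lz77_startS_gt w k : k < size (lz77 w) -> lz77_start w k < lz77_start w k.+1.
Proof.
move=> hk; have lt_k : lz77_start w k < size w by rewrite (lz77_start_ltn (ltnW hk)).
by have := blk_bounds lt_k; rewrite (lz77_startS hk); lia.
Qed.

Lemma lz77_start_lt w k k' : k < k' <= size (lz77 w) -> lz77_start w k < lz77_start w k'.
Proof.
move=> /andP[]; elim: k' => [//|k' IH]; rewrite ltnS leq_eqVlt => /predU1P[<-|h] hk.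
  exact: lz77_startS_gt.
by apply: ltn_trans (IH h (ltnW hk)) (lz77_startS_gt hk).
Qed.

End Factorization.

Lemma take_dropP (w : seq nat) s m l : s + l <= size w -> m + l <= size w ->
  reflect (eqfac (nth 0 w) (nth 0 w) s m l) (take l (drop s w) == take l (drop m w)).
Proof.
move=> hs hm; apply: (iffP eqP) => [E x xl|h].
  by rewrite -!nth_drop -[LHS](nth_take _ xl) E nth_take.
apply: (@eq_from_nth _ 0); first by rewrite !size_takel ?size_drop; lia.
move=> x; rewrite size_takel ?size_drop; last lia.
by move=> xl; rewrite !nth_take // !nth_drop h.
Qed.

Lemma infix_occurs (w : seq nat) m l : m + l <= size w ->
  infix (take l (drop m w)) (take m w) <-> occurs (nth 0 w) m l.
Proof.
move=> hm; have sz : size (take l (drop m w)) = l by rewrite size_takel // size_drop; lia.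
split=> [/infixP[p [q E]]|[s hs /take_dropP h]].
  have sm : size (take m w) = m by apply: size_takel; lia.
  have sE := congr1 size E; rewrite !size_cat sz sm in sE.
  exists (size p); first lia.
  apply/take_dropP; [lia|lia|].
  have : take l (drop (size p) (take m w)) = take l (drop m w).
    by rewrite E drop_size_cat // take_size_cat.
  move=> <-; apply/eqP; rewrite take_drop [RHS]take_drop take_takel //; lia.
have {}h := eqP (h _ _); apply/infixP.
exists (take s w), (drop (s + l) (take m w)); rewrite -h; [|lia|lia].
have -> : take s w = take s (take m w) by rewrite take_takel //; lia.
have -> : take l (drop s w) = take l (drop s (take m w)).
  by rewrite take_drop [RHS]take_drop take_takel //; lia.
by rewrite addnC -drop_drop cat_take_drop cat_take_drop.
Qed.

(** A previous occurrence of a prefix gives one of every shorter prefix, so the first length that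
    fails is one more than the longest that succeeds; [find] returns its index, which is smaller by
    one. *)
Lemma blk_is_block_size (w : seq nat) m L : m < size w ->
  is_block_size (size w) (nth 0 w) m L -> blk w m = L.
Proof.
move=> mw [l [-> ml ocl nocl]].
rewrite /blk /lz77_block_size size_drop.
set P := fun _ => _.
rewrite -[LHS]/(minn (size w - m) (find P (iota 1 (size w - m))).+1).
have infx k : 0 < k <= l -> P k = false.
  move=> hk; apply/negbTE; rewrite negbK; apply/infix_occurs; first lia.
  by case: ocl => s hs h; exists s; [lia|apply: eqfac_le h; lia].
have le_find : l <= find P (iota 1 (size w - m)).
  rewrite leqNgt; apply/negP => hlt.
  have hf : has P (iota 1 (size w - m)) by rewrite has_find size_iota; lia.
  have := nth_find 0 hf; rewrite nth_iota; last lia.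
  by rewrite infx //; lia.
have [E|ne] := eqVneq (m + l) (size w).
  by lia.
have Pl : P l.+1.
  have ml1 : m + l.+1 <= size w by lia.
  by rewrite /P; apply/negP => h; apply: nocl; [lia|exact/(infix_occurs ml1)].
suff : find P (iota 1 (size w - m)) <= l by lia.
rewrite leqNgt; apply/negP => hlt.
have := @before_find _ 0 P (iota 1 (size w - m)) l hlt.
by rewrite nth_iota ?add1n ?Pl //; lia.
Qed.

(** * The factorization of a word with two edits *)

Definition lz (body : icmd) : icmd :=
  IAsg 6 (Cst 0);;
  IWhile (Less (Rg 6) (Rg 5)) (block;; body;; IAsg 6 (Plus (Rg 6) (Rg 15))).

Lemma eq_occurs n (U U' : nat -> nat) m l : (forall x, x < n -> U x = U' x) ->
  m + l <= n -> occurs U m l -> occurs U' m l.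
Proof. by move=> h ml [s hs he]; exists s => // x xl; rewrite -!h; [exact: he|lia|lia]. Qed.

Lemma eq_is_block_size n (U U' : nat -> nat) m L : (forall x, x < n -> U x = U' x) ->
  is_block_size n U m L -> is_block_size n U' m L.
Proof.
move=> h [l [h1 h2 h3 h4]]; exists l; split=> //; first exact: (eq_occurs h h2 h3).
move=> h5 h6; apply: (h4 h5).
by apply: (@eq_occurs n U' U) h6; [move=> x /h|lia].
Qed.

Section Factorizer.
Variables (n sg : nat) (W : nat -> nat) (ratio_le : nat -> nat -> bool).
Hypothesis W_lt : forall x, x < n -> W x < sg.

Local Notation wp := (wp n sg W ratio_le).
Local Notation ev := (ev W ratio_le).
Local Notation safe := (safe n sg W ratio_le).
Local Notation N := (ndig n sg).
Local Notation V := (vmax n sg).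
Local Notation edited := (edited W).

(** [J] may speak of the tables and of the registers above 15, which [block] leaves alone. Each
    letter of a block pays 26 ticks for [block], C for the body and one for the round. *)
Lemma lz_spec body (J : nat -> ist -> Prop) C (w' : seq nat) s :
  rg s 5 = n -> edits_ok n sg s -> prev_occ_table n sg W (tb s 0) ->
  mismatch_table n W (tb s 1) ->
  size w' = n -> (forall x, x < n -> edited s x = nth 0 w' x) ->
  (forall r, r < 7 -> ~~ modr body r) -> ~~ modr body 15 ->
  ~~ modt body 0 -> ~~ modt body 1 ->
  (forall k s1 s2, J k s1 -> (forall r, 15 < r -> rg s2 r = rg s1 r) ->
     (forall t, tb s2 t = tb s1 t) -> J k s2) ->
  J 0 s ->
  (forall k s1, k < size (lz77 w') -> J k s1 -> rg s1 5 = n ->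
     rg s1 6 = lz77_start w' k -> rg s1 15 = lz77_start w' k.+1 - lz77_start w' k ->
     wp body s1 (fun t s2 => t <= C * rg s1 15 /\ J k.+1 s2)) ->
  wp (lz body) s (fun t s' => t <= (27 + C) * n /\ J (size (lz77 w')) s').
Proof.
move=> s5 sok pct mmt sz eqU mb mb15 mt0 mt1 stab J0 Jb.
have hV := vmax_ge n sg.
apply: wp_seq; apply: wp_asg => //=; first lia.
pose I t s1 := exists2 k, k <= size (lz77 w') &
  [/\ (forall r, r < 6 -> rg s1 r = rg s r) /\ rg s1 6 = lz77_start w' k,
      tb s1 0 = tb s 0 /\ tb s1 1 = tb s 1, t <= (27 + C) * lz77_start w' k & J k s1].
apply: (wp_while (I := I) (B := (27 + C) * n)).
- exists 0 => //; split=> //; first split=> [r r6|].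
  + by rewrite /= iupd_neq //; lia.
  + by rewrite lz77_start0.
  + by apply: stab J0 _ _ => //= r r15; rewrite iupd_neq //; lia.
- move=> t s1 [k hk [[r1 r6] _ ht _]]; split=> //.
  by have := lz77_start_le hk; rewrite sz; nia.
- move=> t s1 [k hk [[r1 r6] [t0 t1] ht hJ]].
  rewrite ev_Less !evE (r1 5) // s5 r6 -{1}sz (lz77_start_ltn hk) => {}hk.
  have q5 : rg s1 5 = n by rewrite r1.
  have q1 : edits_ok n sg s1 by move: sok; rewrite /edits_ok !r1.
  have mn : rg s1 6 < n by rewrite r6 -sz lz77_start_ltn // ltnW.
  apply: wp_seq; apply: (wp_use (@block_spec n sg W ratio_le W_lt s1 q5 q1 _ _ mn)).
  + by rewrite t0.
  + by rewrite t1.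
  move=> t2 s2 [bs t2l] fr2 ft2.
  have eqU1 x : x < n -> edited s1 x = nth 0 w' x.
    by move=> /eqU <-; rewrite !editedE !r1.
  have {}bs := eq_is_block_size eqU1 bs.
  rewrite -sz r6 in bs; have bE := blk_is_block_size _ bs.
  have lt_k : lz77_start w' k < size w' by rewrite lz77_start_ltn // ltnW.
  have {}bE := bE lt_k.
  have sS := lz77_startS hk; rewrite bE in sS.
  have L0 : 0 < rg s2 15 by have := blk_bounds lt_k; rewrite bE; lia.
  have r2 r : r < 7 -> rg s2 r = rg s1 r.
    by move=> r7; apply: fr2; move: r r7; do 7?case=> //.
  have r2' r : 15 < r -> rg s2 r = rg s1 r.
    by move=> r7; apply: fr2; move: r r7; do 16?case=> //.
  have hJ2 : J k s2 by apply: stab hJ r2' _ => tt; apply: ft2.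
  apply: wp_seq; apply: (wp_use (Jb k s2 hk hJ2 _ _ _)).
  + by rewrite r2.
  + by rewrite r2.
  + by rewrite sS; lia.
  move=> t3 s3 [t3l hJ3] fr3 ft3.
  have e6 : rg s3 6 = lz77_start w' k by rewrite fr3 ?mb // r2.
  have e15 : rg s3 15 = rg s2 15 by rewrite fr3.
  have le_n := lz77_start_le hk; rewrite sz in le_n.
  apply: wp_asg => //; first by rewrite /= e6 e15; repeat split; lia.
  exists k.+1 => //; split.
  + rewrite !evE e6 e15 -sS; split; last by read_regs.
    by move=> r hr; rewrite /= iupd_neq ?fr3 ?mb ?r2 ?r1 //; lia.
  + by rewrite /= !ft3 // !ft2.
  + by rewrite sS; nia.
  + by apply: stab hJ3 _ _ => //= r r15; rewrite iupd_neq //; lia.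
- move=> t s1 [k hk [[r1 r6] _ ht hJ]] /ev_false.
  rewrite ev_Less !evE (r1 5) // s5 r6 -sz (lz77_start_ltn hk) => hk'.
  have E : k = size (lz77 w') by lia.
  by rewrite -E; split=> //; have := lz77_start_le hk; rewrite sz; nia.
Qed.

End Factorizer.

Lemma lz77_start_inj (T : eqType) (w : seq T) k k' :
  k <= size (lz77 w) -> k' <= size (lz77 w) -> lz77_start w k = lz77_start w k' -> k = k'.
Proof.
move=> hk hk' E; have [|h|//] := ltngtP k k'; first move=> h.
  by have := @lz77_start_lt _ w k k'; rewrite h hk' E ltnn => /(_ isT).
by have := @lz77_start_lt _ w k' k; rewrite h hk E ltnn => /(_ isT).
Qed.

Lemma lz77_starts_uniq (T : eqType) (w : seq T) : uniq (lz77_starts w).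
Proof.
rewrite map_inj_in_uniq ?iota_uniq // => k k'; rewrite !mem_iota !add0n => hk hk'.
by apply: lz77_start_inj; lia.
Qed.

Lemma mem_lz77_starts (T : eqType) (w : seq T) x :
  reflect (exists2 k, k < size (lz77 w) & x = lz77_start w k) (x \in lz77_starts w).
Proof.
apply: (iffP mapP) => -[k hk ->]; exists k => //; move: hk; rewrite mem_iota; lia.
Qed.

(** [count_starts] adds the marks of the positions of a block; this sum is the number of starts
    because no start is repeated. *)
Lemma count_sum_mem (S : seq nat) a b : uniq S ->
  count (fun x => a <= x < b) S = \sum_(a <= x < b) (x \in S).
Proof.
move=> uS; transitivity (count [in S] (index_iota a b)).
  rewrite -!size_filter; apply: perm_size; apply: uniq_perm; rewrite ?filter_uniq ?iota_uniq //.
  by move=> x; rewrite !mem_filter mem_index_iota andbC.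
by rewrite -sum1_count big_mkcond.
Qed.

(** Both edits are placed at n, where they change nothing, so the factorizer of edited words parses
    the input itself. *)
Definition base_prog : icmd :=
  IAsg 1 (Rg 5);; IAsg 3 (Rg 5);;
  lz (ISto 2 (Rg 6) (Cst 0) (Cst 0) (Cst 0) (Cst 1);; IAsg 23 (Plus (Rg 23) (Cst 1))).

Definition count_starts : icmd :=
  IAsg 16 (Cst 0);; IAsg 17 (Rg 6);;
  IFor 17 (Plus (Rg 6) (Rg 15))
    (IAsg 16 (Plus (Rg 16) (Tab 2 (Rg 17) (Cst 0) (Cst 0) (Cst 0))));;
  IAsg 19 (Plus (Rg 19) (Cst 1));;
  IIf (Less (Cst 2) (Rg 16)) (IAsg 20 (Plus (Rg 20) (Cst 1))) ISkip.

Definition verify : icmd := IAsg 19 (Cst 0);; IAsg 20 (Cst 0);; lz count_starts.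

Section Verification.
Variables (n sg : nat) (W : nat -> nat) (ratio_le : nat -> nat -> bool).
Hypothesis W_lt : forall x, x < n -> W x < sg.

Local Notation wp := (wp n sg W ratio_le).
Local Notation ev := (ev W ratio_le).
Local Notation safe := (safe n sg W ratio_le).
Local Notation N := (ndig n sg).
Local Notation V := (vmax n sg).
Local Notation edited := (edited W).

Variable w : seq nat.
Hypothesis size_w : size w = n.
Hypothesis nth_w : forall x, x < n -> W x = nth 0 w x.

Definition start_table (f : nat -> nat -> nat -> nat -> nat) :=
  forall x, x < n -> f x 0 0 0 = (x \in lz77_starts w).

Lemma base_prog_spec s :
  rg s 5 = n -> prev_occ_table n sg W (tb s 0) -> mismatch_table n W (tb s 1) ->
  (forall x, tb s 2 x 0 0 0 = 0) -> rg s 23 = 0 ->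
  wp base_prog s (fun k s' => [/\ k <= 27 * n, rg s' 23 = size (lz77 w) &
    start_table (tb s' 2)]).
Proof.
move=> s5 pct mmt t2 z0; have hV := vmax_ge n sg.
have NE : N = n + sg + 2 by [].
apply: wp_seq; apply: wp_asg => //; apply: wp_seq; apply: wp_asg => //.
rewrite !evE; read_regs; rewrite s5.
set s1 := IState _ _.
pose J k s2 := rg s2 23 = k /\
  forall x, x < n -> tb s2 2 x 0 0 0 = (x \in [seq lz77_start w i | i <- iota 0 k]).
have sok : edits_ok n sg s1 by rewrite /s1; split; read_regs; lia.
apply: (wp_use (@lz_spec n sg W ratio_le W_lt _ J 0 w s1 s5 sok pct mmt size_w _ _ _ _ _ _ _ _)) => //.
- move=> x xn; rewrite !editedE /edit; read_regs.
  by rewrite (_ : x == n = false) ?nth_w //; lia.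
- by do 7?case=> //.
- move=> k s2 s3 [j1 j2] r3 t3; split; first by rewrite r3.
  by move=> x xn; rewrite t3 j2.
- by split=> // x _; rewrite t2.
- move=> k s2 hk [j1 j2] r5 r6 r15.
  have lt_k : lz77_start w k < n by rewrite -size_w lz77_start_ltn // ltnW.
  have z_le : k <= n.
    have : k <= lz77_start w k; last by lia.
    elim: k {j1 j2 r6 r15 lt_k} hk => // k IH hk.
    by apply: leq_ltn_trans (IH (ltnW hk)) _; apply: lz77_startS_gt; lia.
  apply: wp_seq; apply: wp_sto => //=; rewrite ?r6.
  + by repeat split; rewrite ?NE; lia.
  + by lia.
  apply: wp_asg => //=; rewrite ?j1; first by repeat split; lia.
  split=> //; split; first by read_regs; rewrite addn1.
  move=> x xn; rewrite -[k.+1]addn1 iotaD map_cat mem_cat /= inE.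
  have [->|ne] := eqVneq x (lz77_start w k); first by rewrite tupd_eq orbT.
  by rewrite tupd_neq ?j2 ?orbF // (eq_sym (lz77_start _ _)) ne !orbT.
- by move=> k s2 [hk [j1 j2]] _ _; split=> //; lia.
Qed.

Lemma verify_spec s (w' : seq nat) :
  rg s 5 = n -> edits_ok n sg s -> prev_occ_table n sg W (tb s 0) ->
  mismatch_table n W (tb s 1) -> start_table (tb s 2) ->
  size w' = n -> (forall x, x < n -> edited s x = nth 0 w' x) ->
  wp verify s (fun k s' => [/\ k <= 28 * n, rg s' 19 = size (lz77 w') &
    rg s' 20 = nb_blocks_3starts w w']).
Proof.
move=> s5 sok pct mmt stt sz' eqU; have hV := vmax_ge n sg.
have NE : N = n + sg + 2 by [].
apply: wp_seq; apply: wp_asg => //=; first lia.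
apply: wp_seq; apply: wp_asg => //=; first lia.
set s1 := IState _ _.
pose J k s2 := [/\ rg s2 19 = k, tb s2 2 = tb s 2 &
  rg s2 20 = count (fun i => 3 <= starts_in_block w w' i) (iota 0 k)].
apply: (wp_use (@lz_spec n sg W ratio_le W_lt _ J 1 w' s1 _ _ pct mmt sz' _ _ _ _ _ _ _ _)) => //.
- by do 7?case=> //.
- move=> k s2 s3 [j1 j2 j3] r3 t3; split; first by rewrite r3.
    by rewrite t3.
  by rewrite r3.
- move=> k s2 hk [j1 j2 j3] r5 r6 r15.
  have lt_k : lz77_start w' k < n by rewrite -sz' lz77_start_ltn // ltnW.
  have le_S := lz77_start_le hk; rewrite sz' in le_S.
  have lt_S := lz77_startS_gt hk.
  have z_le : k <= n.
    have : k <= lz77_start w' k; last by lia.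
    elim: k {j1 j2 j3 r6 r15 lt_k le_S lt_S} hk => // k IH hk.
    by apply: leq_ltn_trans (IH (ltnW hk)) _; apply: lz77_startS_gt; lia.
  have b_le : rg s2 20 <= n.
    by rewrite j3; apply: leq_trans (count_size _ _) _; rewrite size_iota.
  apply: wp_seq; apply: wp_asg => //=; first lia.
  apply: wp_seq; apply: wp_asg => //.
  rewrite !evE; read_regs; rewrite r6.
  apply: wp_seq.
  set a := lz77_start w' k in r6 r15 lt_k lt_S *.
  set b := lz77_start w' k.+1 in r15 le_S lt_S *.
  set s3 := IState _ _.
  pose K y t s4 := [/\ (forall r, r != 16 -> r != 17 -> rg s4 r = rg s2 r) /\ tb s4 = tb s2,
    t = y - a & rg s4 16 = \sum_(a <= x < y) (x \in lz77_starts w)].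
  have sum_le y : a <= y -> \sum_(a <= x < y) (x \in lz77_starts w) <= y - a.
    move=> ay; rewrite -[X in _ <= X]muln1 -sum_nat_const_nat.
    by apply: leq_sum => x _; case: (_ \in _).
  apply: (wp_for (J := K) (lo := a) (H := b)) => //; try lia.
  + split; last by rewrite big_geq.
      by split=> // r r16 r17; rewrite /= !iupd_neq // eq_sym.
    by rewrite subnn.
  + move=> y t s4 hy [[fr ft] _ _] _.
    by rewrite /= !fr // r6 r15; split; [repeat split|]; lia.
  + move=> y t s4 hy [[fr ft] ht h16] h17.
    have := sum_le y; rewrite -h16 => hs.
    have q : tb s2 2 y 0 0 0 = (y \in lz77_starts w) by rewrite j2 stt //; lia.
    have q1 : (y \in lz77_starts w) <= 1 by case: (_ \in _).
    apply: wp_asg => //.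
      by rewrite /= h17 ft q; repeat split; rewrite ?NE; lia.
    rewrite !evE h17 ft q; split; first by read_regs.
    split; read_regs; [split| |] => //.
    * by move=> r r16 r17; rewrite !iupd_neq ?fr // eq_sym.
    * by lia.
    * by rewrite big_nat_recr ?h16 //=; lia.
  + move=> t s4 [[fr ft] ht h16] h17.
    rewrite -count_sum_mem ?lz77_starts_uniq // -/(starts_in_block w w' k) in h16.
    apply: wp_seq; apply: wp_asg => //=; first by rewrite fr // j1; repeat split; lia.
    rewrite fr // j1.
    have J_done (v : nat) s5' : v = (2 < starts_in_block w w' k) -> rg s5' 19 = k + 1 ->
        tb s5' = tb s4 -> rg s5' 20 = rg s2 20 + v -> J k.+1 s5'.
      move=> vE e19 et e20; split; rewrite ?e19 ?et ?ft //; first by rewrite addn1.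
      by rewrite e20 j3 -[k.+1]addn1 iotaD count_cat /= vE addn0.
    apply: wp_if => //=; first by split=> //; lia.
    * rewrite eqb0 negbK; read_regs; rewrite h16 => hs.
      apply: wp_asg => //=; read_regs; rewrite fr //; first by repeat split; lia.
      split; first lia.
      by apply: (J_done 1) => //=; read_regs; rewrite ?hs.
    * read_regs; rewrite h16 => hs.
      apply: wp_skip; split; first lia.
      by apply: (J_done 0) => //=; read_regs; rewrite ?hs ?fr ?addn0.
- by move=> k s2 [hk [j1 j2 j3]] _ _; split=> //; lia.
Qed.

End Verification.

(** * Blocks with three starts determine the edits *)

Lemma blk_occurs (w : seq nat) m : m < size w -> occurs (nth 0 w) m (blk w m).-1.
Proof.
move=> mw; have /= bb := blk_bounds mw.
have [->|b0] := posnP (blk w m).-1; first by exists 0.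
have hb : m + (blk w m).-1 <= size w by lia.
apply/(infix_occurs hb).
have lt_f : (blk w m).-2 < find (fun l => ~~ infix (take l (drop m w)) (take m w))
    (iota 1 (size (drop m w))).
  by move: b0; rewrite /blk /lz77_block_size /=; set f := find _ _; lia.
have := before_find 0 lt_f; rewrite nth_iota; last by rewrite size_drop; lia.
by move/negbFE; rewrite (_ : 1 + _ = (blk w m).-1) //; lia.
Qed.

(** The last block is excluded, for it may well have a previous occurrence. *)
Lemma blk_not_occurs (w : seq nat) m :
  m < size w -> m + blk w m < size w -> ~ occurs (nth 0 w) m (blk w m).
Proof.
move=> mw h; have h' : m + blk w m <= size w by lia.
move/(infix_occurs h'); apply/negP.
set P := fun l => ~~ infix (take l (drop m w)) (take m w).
have bE : blk w m = minn (size w - m) (find P (iota 1 (size w - m))).+1.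
  by rewrite /blk /lz77_block_size size_drop.
have lt_f : find P (iota 1 (size w - m)) < size w - m by lia.
have hf : has P (iota 1 (size w - m)) by rewrite has_find size_iota.
have := nth_find 0 hf; rewrite nth_iota //.
by rewrite bE (_ : minn _ _ = 1 + find P (iota 1 (size w - m))) //; lia.
Qed.

Lemma starts_in_block_consecutive (T : eqType) (w w' : seq T) k m :
  m < starts_in_block w w' k -> exists q,
    [/\ q + m < size (lz77 w), lz77_start w' k <= lz77_start w q &
        lz77_start w (q + m) < lz77_start w' k.+1].
Proof.
rewrite /starts_in_block /lz77_starts count_map.
set l := lz77_start w' k; set r := lz77_start w' k.+1; set S := lz77_start w.
set z := size (lz77 w); set P := preim _ _ => hm.
have S_lt q q' : q < q' -> q' < z -> S q < S q'.
  by move=> h1 h2; apply: lz77_start_lt; rewrite h1 ltnW.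
have hp : has P (iota 0 z) by rewrite has_count; apply: leq_ltn_trans hm.
set q := find P (iota 0 z).
have qz : q < z by rewrite /q -[X in _ < X](size_iota 0 z) -has_find.
have Pq : P q by have := nth_find 0 hp; rewrite nth_iota.
have [hz|hz] := boolP ((q + m < z) && (S (q + m) < r)).
  by exists q; move/andP: hz Pq => [h1 h2] /andP[h3 _].
suff : count P (iota 0 z) <= m by rewrite leqNgt hm.
rewrite -size_filter -[X in _ <= X](size_iota q m).
apply: uniq_leq_size; first by rewrite filter_uniq ?iota_uniq.
move=> x; rewrite mem_filter !mem_iota add0n /= => /andP[/andP[h1 h2] h3].
have qx : q <= x.
  rewrite leqNgt; apply/negP => xq.
  by have := before_find 0 xq; rewrite nth_iota // add0n /P /= h1 h2.
rewrite qx ltnNge; apply/negP => qmx; case/negP: hz.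
have qmz : q + m < z by lia.
rewrite qmz; apply: leq_ltn_trans h2.
have [->|ne] := eqVneq x (q + m); first exact: leqnn.
by apply/ltnW/S_lt; lia.
Qed.

Lemma sum_starts_in_block (T : eqType) (w w' : seq T) m : m <= size (lz77 w') ->
  \sum_(0 <= k < m) starts_in_block w w' k =
  count (fun s => s < lz77_start w' m) (lz77_starts w).
Proof.
elim: m => [|m IH] hm.
  by rewrite big_nil lz77_start0 (eq_count (a2 := pred0)) ?count_pred0.
rewrite big_nat_recr; last exact: leq0n.
rewrite (IH (ltnW hm)) /starts_in_block; set S := lz77_starts w.
rewrite -[LHS]/(count _ S + count _ S)%N -count_predUI.
rewrite [X in _ + X = _](_ : _ = 0) ?addn0; last first.
  by rewrite (eq_count (a2 := pred0)) ?count_pred0 // => x /=; lia.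
by have := lz77_startS_gt hm => h; apply: eq_count => x /=; lia.
Qed.

Section TwoEdits.
Variables (w w' : seq nat) (n i a j b : nat).
Hypotheses (size_w : size w = n) (size_w' : size w' = n) (ij : i < j) (jn : j < n).
Local Notation W := (nth 0 w).
Hypothesis nth_w' : forall x, x < n -> nth 0 w' x = edit W i a j b x.

(* One edit removes the mismatch between the positions x and x - d. *)
Definition repairs d x (e : nat * nat) :=
  e = (x, W (x - d)) \/ e = (x - d, W x).

(* The edits repair a pair of mismatches for the shift d that are consecutive
   around the position u. *)
Definition hit d u := exists x y,
  [/\ [/\ 0 < d, d <= x, x < u, u <= y & y < n],
      W x <> W (x - d) /\ W y <> W (y - d),
      (forall t, x < t < y -> W t = W (t - d)) &
      (repairs d x (i, a) /\ repairs d y (j, b)) \/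
      (repairs d x (j, b) /\ repairs d y (i, a))].

Lemma block_source k : k < size (lz77 w') -> lz77_start w' k.+1 - lz77_start w' k > 1 ->
  exists d, [/\ 0 < d <= lz77_start w' k,
    lz77_start w' k.+1 <= (lz77_start w' k + d).+1 &
    forall x, lz77_start w' k <= x < (lz77_start w' k.+1).-1 ->
      nth 0 w' x = nth 0 w' (x - d)].
Proof.
move=> hk; have lt_k : lz77_start w' k < size w' by rewrite lz77_start_ltn // ltnW.
have := blk_occurs lt_k; have := lz77_startS hk.
set l := lz77_start w' k; set r := lz77_start w' k.+1 => rE [s hs he] lr.
exists (l - s); split; [lia|lia|move=> x hx].
by rewrite -(subnKC (_ : l <= x)) -?he; [congr nth| |]; lia.
Qed.

(** Without a mismatch the block q of [w] would be a copy of the factor d positions before, which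
    ends in time since the block has at most d letters. Block q is not the last one, so it has no
    such copy. *)
Lemma start_mismatch d l r q : 0 < d <= l -> r <= (l + d).+1 ->
  q.+1 < size (lz77 w) -> l <= lz77_start w q -> lz77_start w q.+1 < r ->
  exists2 x, lz77_start w q <= x < lz77_start w q.+1 & W x <> W (x - d).
Proof.
move=> dl rl hq lq qr.
have hq' : q < size (lz77 w) by lia.
have lt_q : lz77_start w q < size w by rewrite lz77_start_ltn // ltnW.
have rE := lz77_startS hq'.
have lt_q1 : lz77_start w q + blk w (lz77_start w q) < size w.
  by rewrite -rE lz77_start_ltn // ltnW.
have no := blk_not_occurs lt_q lt_q1.
set u := lz77_start w q in lq rE lt_q lt_q1 no *; set v := lz77_start w q.+1 in qr rE *.
pose P x := W x != W (x - d).
have [/hasP[x hx /eqP Px]|/hasPn h] := boolP (has P (index_iota u v)).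
  by exists x => //; rewrite -mem_index_iota.
case: no; exists (u - d); first lia.
move=> x hx; have := h (u + x); rewrite mem_index_iota => /(_ _)/negbNE/eqP ->; last lia.
by congr nth; lia.
Qed.

(* The only position at or after l whose comparison with the position d before,
   itself before l, involves the position e. *)
Definition touched l d e := if l <= e then e else e + d.

Lemma mismatch_touched l d x : 0 < d -> x < n -> l <= x -> x - d < l -> d <= x ->
  nth 0 w' x = nth 0 w' (x - d) -> W x <> W (x - d) ->
  x = touched l d i \/ x = touched l d j.
Proof.
move=> d0 xn lx xdl dx E ne; rewrite /touched.
move: E; rewrite !nth_w' /edit; [|lia|lia].
case: (eqVneq x i) => [<- _|xi]; first by rewrite lx; left.
case: (eqVneq x j) => [<- _|xj]; first by rewrite lx; right.
case: (eqVneq (x - d) i) => [<- _|xdi]; first by left; case: ifP; lia.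
case: (eqVneq (x - d) j) => [<- _|xdj]; first by right; case: ifP; lia.
by [].
Qed.

(** One of x and x - d is e; the other one is not edited, since no other edit touches x. Its old
    letter must then be the new letter at e. *)
Lemma touched_repairs l d e x (c := nth 0 w' e) : e = i \/ e = j ->
  0 < d -> x < n -> l <= x -> x - d < l -> d <= x -> x = touched l d e ->
  (forall e', e' = i \/ e' = j -> e' != e -> x != touched l d e') ->
  nth 0 w' x = nth 0 w' (x - d) -> repairs d x (e, c).
Proof.
move=> he d0 xn lx xdl dx xE uniq_e E.
have other y : y < n -> y != e -> touched l d y = x -> nth 0 w' y = W y.
  move=> yn ye yx; rewrite nth_w' // /edit.
  case: eqVneq => [yi|_]; first by have := uniq_e y (or_introl yi) ye; rewrite yx eqxx.
  by case: eqVneq => [yj|_] //; have := uniq_e y (or_intror yj) ye; rewrite yx eqxx.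
move: xE; rewrite /touched; case: leqP => le_e xE.
  left; congr pair; first by [].
  rewrite /c -xE E other //; [lia|rewrite -xE; lia|].
  by rewrite /touched; case: leqP; lia.
right; congr pair; first lia.
rewrite /c (_ : e = x - d); last lia.
rewrite -E other //; first lia.
by rewrite /touched lx.
Qed.

(* The first two of the three blocks of w are new, so each contains a mismatch with
   the source of the block of w'; every edit accounts for one mismatch only. *)
Lemma bad_block_hit k : k < size (lz77 w') -> 2 < starts_in_block w w' k ->
  exists d u, [/\ lz77_start w' k <= u < lz77_start w' k.+1, u \in lz77_starts w & hit d u].
Proof.
move=> hk /starts_in_block_consecutive[q [q2 hl hr]].
rewrite addn2 in q2 hr.
have S1 := lz77_startS_gt (ltnW (ltnW q2) : q < size (lz77 w)).
have S2 := lz77_startS_gt (ltnW q2 : q.+1 < size (lz77 w)).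
have le_r := lz77_start_le hk; rewrite size_w' in le_r.
have [|d [dl rl hU]] := block_source hk; first lia.
set l := lz77_start w' k in hl dl rl hU *; set r := lz77_start w' k.+1 in hr rl hU le_r *.
have [|||x hx x_ne] := @start_mismatch d l r q dl rl; [lia|lia|lia|].
have [|||y hy y_ne] := @start_mismatch d l r q.+1 dl rl; [lia|lia|lia|].
exists d, (lz77_start w q.+1); split; first lia.
  by apply/mem_lz77_starts; exists q.+1 => //; lia.
have tch t : l <= t < r.-1 -> W t <> W (t - d) -> t = touched l d i \/ t = touched l d j.
  by move=> ht ne; apply: mismatch_touched ne => //; try lia; apply: hU.
have xt := tch x _ x_ne; have yt := tch y _ y_ne.
have {}xt : x = touched l d i \/ x = touched l d j by apply: xt; lia.
have {}yt : y = touched l d i \/ y = touched l d j by apply: yt; lia.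
have cE e : e = i \/ e = j -> (e, nth 0 w' e) = (i, a) \/ (e, nth 0 w' e) = (j, b).
  by case=> ->; [left|right]; congr pair; rewrite nth_w' /edit ?eqxx ?[j == i]gtn_eqF //; lia.
exists x, y; split.
- by split; lia.
- by [].
- move=> t ht; apply/eqP; apply/negPn/negP => /eqP /tch h.
  have tt : t = touched l d i \/ t = touched l d j by apply: h; lia.
  by lia.
have ai : nth 0 w' i = a by rewrite nth_w' /edit ?eqxx //; lia.
have bj : nth 0 w' j = b by rewrite nth_w' /edit ?[j == i]gtn_eqF ?eqxx //; lia.
have rep e t : l <= t < r.-1 -> e = i \/ e = j -> t = touched l d e ->
    (forall e', e' = i \/ e' = j -> e' != e -> t != touched l d e') -> repairs d t (e, nth 0 w' e).
  by move=> ht he tE ue; apply: (@touched_repairs l) => //; try lia; apply: hU.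
(* As x < y and an edit touches a single position, x and y are touched by different edits. *)
case: xt => xt; case: yt => yt; [lia|left|right|lia]; rewrite -{1}ai -{1}bj; split; apply: rep => //; try lia; try (by left); try (by right).
all: move=> e' [->|->]; rewrite ?eqxx //= => _; lia.
Qed.

Lemma starts_in_block_le3 k : k < size (lz77 w') -> starts_in_block w w' k <= 3.
Proof.
move=> hk; rewrite leqNgt; apply/negP => /starts_in_block_consecutive[q [q3 hl hr]].
rewrite addn3 in q3 hr.
have S1 := lz77_startS_gt (ltnW (ltnW (ltnW q3)) : q < size (lz77 w)).
have S2 := lz77_startS_gt (ltnW (ltnW q3) : q.+1 < size (lz77 w)).
have S3 := lz77_startS_gt (ltnW q3 : q.+2 < size (lz77 w)).
have le_r := lz77_start_le hk; rewrite size_w' in le_r.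
have [|d [dl rl hU]] := block_source hk; first lia.
set l := lz77_start w' k in hl dl rl hU *; set r := lz77_start w' k.+1 in hr rl hU le_r *.
have [|||x hx x_ne] := @start_mismatch d l r q dl rl; [lia|lia|lia|].
have [|||y hy y_ne] := @start_mismatch d l r q.+1 dl rl; [lia|lia|lia|].
have [|||t ht t_ne] := @start_mismatch d l r q.+2 dl rl; [lia|lia|lia|].
have tch p : l <= p < r.-1 -> W p <> W (p - d) -> p = touched l d i \/ p = touched l d j.
  by move=> hp ne; apply: mismatch_touched ne => //; try lia; apply: hU.
have xt : x = touched l d i \/ x = touched l d j by apply: tch x_ne; lia.
have yt : y = touched l d i \/ y = touched l d j by apply: tch y_ne; lia.
have tt : t = touched l d i \/ t = touched l d j by apply: tch t_ne; lia.
by lia.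
Qed.

Lemma size_lz77_le3 : size (lz77 w) <= 3 * size (lz77 w').
Proof.
have <- : count (fun s => s < n) (lz77_starts w) = size (lz77 w).
  rewrite (eq_in_count (a2 := predT)) ?count_predT ?size_map ?size_iota //.
  by move=> x /mem_lz77_starts[k hk ->]; rewrite -size_w lz77_start_ltn // ltnW.
rewrite -size_w' -(lz77_start_size w') -sum_starts_in_block //.
rewrite -[X in 3 * X]subn0 mulnC -sum_nat_const_nat.
by rewrite big_nat [X in _ <= X]big_nat; apply: leq_sum => k hk; apply: starts_in_block_le3.
Qed.

(** The pairs are distinct because their starts lie in different blocks of [w']. *)
Lemma bad_block_hits : exists P : seq (nat * nat),
  [/\ uniq P, size P = nb_blocks_3starts w w' &
      forall p, p \in P -> p.2 \in lz77_starts w /\ hit p.1 p.2].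
Proof.
rewrite /nb_blocks_3starts.
suff: forall m, m <= size (lz77 w') -> exists P : seq (nat * nat),
    [/\ uniq P, size P = count (fun k => 2 < starts_in_block w w' k) (iota 0 m) &
      forall p, p \in P -> [/\ p.2 < lz77_start w' m, p.2 \in lz77_starts w & hit p.1 p.2]].
  move=> /(_ _ (leqnn _))[P [h1 h2 h3]]; exists P; split=> // p /h3[]//.
elim=> [_|m IH hm]; first by exists [::].
have [P [uP sP hP]] := IH (ltnW hm); have ltS := lz77_startS_gt hm.
rewrite -[m.+1]addn1 iotaD count_cat -sP /= ?add0n ?addn0 [m + 1]addn1.
have hP' p : p \in P -> [/\ p.2 < lz77_start w' m.+1, p.2 \in lz77_starts w & hit p.1 p.2].
  by move=> /hP[h1 h2 h3]; split=> //; lia.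
case: leqP => bad; first by exists P; split=> //; rewrite addn0.
have [d [u [hu us hdu]]] := bad_block_hit hm bad.
exists ((d, u) :: P); split; [|by rewrite addn1|].
  by rewrite /= uP andbT; apply/negP => /hP[/= h1 _ _]; lia.
by move=> p; rewrite inE => /predU1P[->|/hP'//]; split=> //=; lia.
Qed.

End TwoEdits.

(** * The search for the edits *)

Definition counter := Tab 3 (Rg 1) (Rg 2) (Rg 3) (Rg 4).

(* A counter is reset after each verification, so that verifications are paid for
   by attempts. *)
Definition attempt : icmd :=
  ISto 3 (Rg 1) (Rg 2) (Rg 3) (Rg 4) (Plus counter (Cst 1));;
  IIf (Ratio (Rg 23) (Plus counter (Plus counter counter)))
    (ISto 3 (Rg 1) (Rg 2) (Rg 3) (Rg 4) (Cst 0);;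
     verify;;
     IIf (Ratio (Rg 19) (Rg 20)) (IAsg 0 (Cst 1)) ISkip)
    ISkip.

Definition load_edits r1 r2 r3 r4 : icmd :=
  IAsg 1 (Rg r1);; IAsg 2 (Rg r2);; IAsg 3 (Rg r3);; IAsg 4 (Rg r4).

Definition sort_attempt : icmd :=
  IIf (Less (Rg 28) (Rg 30)) (load_edits 28 29 30 31;; attempt)
    (IIf (Less (Rg 30) (Rg 28)) (load_edits 30 31 28 29;; attempt) ISkip).

Definition target1 (t : bool) :=
  if t then Minus (Rg 26) (Cst 1) else Minus (Minus (Rg 26) (Cst 1)) (Rg 24).
Definition target2 (t : bool) := if t then Rg 27 else Minus (Rg 27) (Rg 24).

Definition try_repairs (t1 t2 : bool) : icmd :=
  IIf (Equal (Rg 0) (Cst 0))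
    (IAsg 28 (target1 t1);; IAsg 29 (Inp (target1 (~~ t1)));;
     IAsg 30 (target2 t2);; IAsg 31 (Inp (target2 (~~ t2)));; sort_attempt)
    ISkip.

Definition cell : icmd :=
  IIf (IAnd (Tab 2 (Rg 25) (Cst 0) (Cst 0) (Cst 0))
         (IAnd (Less (Cst 0) (Rg 26)) (Less (Rg 27) (Rg 5))))
    (try_repairs true true;; try_repairs true false;;
     try_repairs false true;; try_repairs false false) ISkip.

(* For each shift (register 24) and each start of a block (register 25), registers
   26 and 27 give the mismatches around the start: 1 + the last one before, and the
   first one after, or n. *)
Definition search : icmd :=
  IAsg 24 (Cst 1);;
  IFor 24 (Plus (Rg 5) (Cst 1))
   (IAsg 26 (Cst 0);; IAsg 25 (Rg 24);;
    IFor 25 (Rg 5)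
     (IAsg 27 (Tab 1 (Rg 24) (Rg 25) (Cst 0) (Cst 0));;
      cell;;
      IIf (Equal (Inp (Rg 25)) (Inp (Minus (Rg 25) (Rg 24)))) ISkip
        (IAsg 26 (Plus (Rg 25) (Cst 1))))).

(** The potential of the amortized analysis: the attempts not yet consumed by a verification. *)
Definition total N (f : nat -> nat -> nat -> nat -> nat) :=
  \sum_(i < N) \sum_(a < N) \sum_(j < N) \sum_(b < N) f i a j b.

Lemma sum_update N (f g : nat -> nat) i : i < N -> (forall x, x != i -> f x = g x) ->
  \sum_(x < N) f x + g i = \sum_(x < N) g x + f i.
Proof.
move=> iN h; rewrite (bigD1 (Ordinal iN)) //= [in RHS](bigD1 (Ordinal iN)) //=.
rewrite (eq_bigr (fun x : 'I_N => g x)); first lia.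
by move=> x hx; apply: h; apply: contraNneq hx => E; apply/eqP/val_inj.
Qed.

Lemma total_update N T i a j b v : i < N -> a < N -> j < N -> b < N ->
  total N (tupd T 3 i a j b v 3) + T 3 i a j b = total N (T 3) + v.
Proof.
move=> iN aN jN bN; rewrite /total.
pose f1 (x : nat) := \sum_(a < N) \sum_(j < N) \sum_(b < N) T 3 x a j b.
pose f2 (x : nat) := \sum_(j < N) \sum_(b < N) T 3 i x j b.
pose f3 (x : nat) := \sum_(b < N) T 3 i a x b.
pose g1 (x : nat) := \sum_(a' < N) \sum_(j' < N) \sum_(b' < N) tupd T 3 i a j b v 3 x a' j' b'.
pose g2 (x : nat) := \sum_(j' < N) \sum_(b' < N) tupd T 3 i a j b v 3 i x j' b'.
pose g3 (x : nat) := \sum_(b' < N) tupd T 3 i a j b v 3 i a x b'.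
have e1 := @sum_update N g1 f1 i iN; have e2 := @sum_update N g2 f2 a aN.
have e3 := @sum_update N g3 f3 j jN.
have e4 := @sum_update N (tupd T 3 i a j b v 3 i a j) (T 3 i a j) b bN.
rewrite tupd_eq in e4.
have {}e1 : \sum_(x < N) g1 x + f1 i = \sum_(x < N) f1 x + g1 i.
  apply: e1 => x xi; do 3!apply: eq_bigr => ? _.
  by rewrite tupd_neq // (eq_sym i) xi !orbT.
have {}e2 : \sum_(x < N) g2 x + f2 a = \sum_(x < N) f2 x + g2 a.
  apply: e2 => x xi; do 2!apply: eq_bigr => ? _.
  by rewrite tupd_neq // (eq_sym a) xi !orbT.
have {}e3 : \sum_(x < N) g3 x + f3 j = \sum_(x < N) f3 x + g3 j.
  apply: e3 => x xi; apply: eq_bigr => ? _.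
  by rewrite tupd_neq // (eq_sym j) xi !orbT.
have {}e4 : \sum_(x < N) tupd T 3 i a j b v 3 i a j x + T 3 i a j b =
    \sum_(x < N) T 3 i a j x + v.
  by apply: e4 => x xi; rewrite tupd_neq // (eq_sym b) xi !orbT.
rewrite -/(f1 i) -/(g1 i) in e1 *; rewrite -/(f2 a) -/(g2 a) -/(f1 i) -/(g1 i) in e2.
rewrite -/(f3 j) -/(g3 j) -/(f2 a) -/(g2 a) in e3; rewrite -/(f3 j) -/(g3 j) in e4.
rewrite -/(\sum_(x < N) f1 x) -/(\sum_(x < N) g1 x); lia.
Qed.

Lemma le_total N f i a j b : i < N -> a < N -> j < N -> b < N -> f i a j b <= total N f.
Proof.
move=> iN aN jN bN; rewrite /total.
rewrite (bigD1 (Ordinal iN)) //= (bigD1 (Ordinal aN)) //= (bigD1 (Ordinal jN)) //=.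
by rewrite (bigD1 (Ordinal bN)) //=; lia.
Qed.

Section Search.
Variables (n sg : nat) (ratio_le : nat -> nat -> bool) (w : seq nat).
Local Notation W := (nth 0 w).
Hypothesis size_w : size w = n.
Hypothesis W_lt : forall x, x < n -> W x < sg.

Local Notation wp := (wp n sg W ratio_le).
Local Notation ev := (ev W ratio_le).
Local Notation safe := (safe n sg W ratio_le).
Local Notation N := (ndig n sg).
Local Notation V := (vmax n sg).
Local Notation z := (size (lz77 w)).

(* Edits are verified when their counter reaches thr. *)
Variable thr : nat.
Hypothesis thr_gt0 : 0 < thr.
Hypothesis ratio_thr : forall c, 0 < c -> ratio_le z (c + (c + c)) = (thr <= c).

Definition valid_edits i a j b :=
  [/\ i < j < n, a < sg, b < sg, a <> W i & b <> W j].

Definition edited_word i a j b : seq nat := mkseq (edit W i a j b) n.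

Definition good_edits i a j b : bool :=
  let w' := edited_word i a j b in
  ratio_le (size (lz77 w')) (nb_blocks_3starts w w').

Definition answer_ok s := valid_edits (rg s 1) (rg s 2) (rg s 3) (rg s 4) /\
  good_edits (rg s 1) (rg s 2) (rg s 3) (rg s 4).

Lemma size_lz77_le (w' : seq nat) : size (lz77 w') <= size w'.
Proof.
have h k : k <= size (lz77 w') -> k <= lz77_start w' k.
  elim: k => // k IH hk; apply: leq_ltn_trans (IH (ltnW hk)) _.
  exact: lz77_startS_gt.
by have := h _ (leqnn _); rewrite lz77_start_size.
Qed.

(* h attempts have been made, v of which have led to a verification; c is a
   lower bound for the counters of the good edits as long as none is found. *)
Record search_inv (s : ist) (h v : nat) (c : nat -> nat -> nat -> nat -> nat) : Prop := SearchInv {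
  inv_n : rg s 5 = n;
  inv_z : rg s 23 = z;
  inv_prev : prev_occ_table n sg W (tb s 0);
  inv_mismatch : mismatch_table n W (tb s 1);
  inv_start : start_table n w (tb s 2);
  inv_total : v * thr + total N (tb s 3) <= h;
  inv_counters : (rg s 0 = 1 /\ answer_ok s) \/
    (rg s 0 = 0 /\ forall i a j b, valid_edits i a j b -> good_edits i a j b ->
       c i a j b <= tb s 3 i a j b < thr) }.

Definition incr_at (c : nat -> nat -> nat -> nat -> nat) i a j b :=
  fun i' a' j' b' => c i' a' j' b' + ((i', a', j', b') == (i, a, j, b)).

(** A good pair whose counter reaches [thr] is verified and answers the search. As long as the
    answer is 0, resets thus hit bad pairs only, and the lower bounds for good pairs survive. A
    verification takes at most 28 n ticks and consumes at least [thr] attempts. *)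
Lemma attempt_spec s h v c (i := rg s 1) (a := rg s 2) (j := rg s 3) (b := rg s 4) :
  search_inv s h v c -> rg s 0 = 0 -> valid_edits i a j b -> h < 4 * (n * n) ->
  wp attempt s (fun k s' => exists v', [/\ v <= v', k <= 28 * n * (v' - v) &
    search_inv s' h.+1 v' (incr_at c i a j b)]).
Proof.
move=> inv r0 val hn; have hV := vmax_ge n sg.
have NE : N = n + sg + 2 by [].
have VE : V = 16 * N * N by [].
have [s5 s23 pct mmt stt htot hcnt] := inv.
have [ijn asg bsg aW bW] := val.
have iN : i < N by lia.
have jN : j < N by lia.
have aN : a < N by lia.
have bN : b < N by lia.
have {}hcnt i' a' j' b' : valid_edits i' a' j' b' -> good_edits i' a' j' b' ->
    c i' a' j' b' <= tb s 3 i' a' j' b' < thr.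
  by case: hcnt => [[]|[_ hc]]; [lia|exact: hc].
set x := tb s 3 i a j b in hcnt *.
have x_le : x <= h by have := @le_total N (tb s 3) i a j b iN aN jN bN; rewrite -/x; lia.
(* The largest number computed: three times a counter, which counts at most 4 n^2 attempts. This
   fits below [vmax], that is, 16 N^2. *)
have x3V : 3 * x.+1 < V by nia.
apply: wp_seq; apply: wp_sto => //.
- by rewrite /= -/i -/a -/j -/b -/x; repeat split; lia.
rewrite !evE -/i -/a -/j -/b -/x.
set s1 := IState _ _.
have s1c : tb s1 3 i a j b = x + 1 by rewrite /s1 /= tupd_eq.
have tot1 : total N (tb s1 3) + x = total N (tb s 3) + (x + 1).
  by rewrite /s1 /= total_update.
have ev3 : ev s1 (Ratio (Rg 23) (Plus counter (Plus counter counter))) = (thr <= x + 1).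
  rewrite -ratio_thr ?addn_gt0 ?orbT //.
  by rewrite /= s23 -/i -/a -/j -/b tupd_eq.
apply: wp_if.
- have sc : safe s1 counter by rewrite /= -/i -/a -/j -/b; repeat split; lia.
  have ec : ev s1 counter = x + 1 by rewrite -s1c.
  have sp : safe s1 (Plus counter counter) by split; [exact: sc|exact: sc|rewrite ec; lia].
  have ecc : ev s1 (Plus counter counter) = x + 1 + (x + 1).
    by rewrite -[LHS]/(ev s1 counter + ev s1 counter) ec.
  by split=> //; split; [exact: sc|exact: sp|rewrite ec ecc; lia].
- rewrite ev3 eqb0 negbK => hthr.
  apply: wp_seq; apply: wp_sto => //; rewrite ?evE.
    by rewrite /= -/i -/a -/j -/b; repeat split; lia.
  set s2 := IState _ _.
  have s2c : tb s2 3 i a j b = 0 by rewrite /s2 /= tupd_eq.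
  have s2n i' a' j' b' : (i', a', j', b') != (i, a, j, b) ->
      tb s2 3 i' a' j' b' = tb s 3 i' a' j' b'.
    rewrite !xpair_eqE !negb_and (eq_sym i') (eq_sym a') (eq_sym j') (eq_sym b') -!orbA => ne.
    by rewrite /s2 /= -/i -/a -/j -/b !tupd_neq // ne orbT.
  have tot2 : total N (tb s2 3) + (x + 1) = total N (tb s1 3).
    by rewrite -s1c -[RHS]addn0 /s2 /= total_update.
  have sok : edits_ok n sg s2 by rewrite /s2; split; rewrite /= -/i -/j -/a -/b; lia.
  set w' := edited_word i a j b.
  have sw' : size w' = n by rewrite size_mkseq.
  apply: wp_seq; apply: (wp_use (@verify_spec n sg W ratio_le W_lt w size_w s2 w' s5 sok pct mmt stt sw' _)) => //.
    by move=> y yn; rewrite nth_mkseq.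
  move=> k s3 [kn e19 e20] fr3 ft3.
  have r3 r : r < 6 -> rg s3 r = rg s r by move=> r6; rewrite fr3 //; move: r r6; do 6?case=> //.
  have h3 t : tb s3 t = tb s2 t by rewrite ft3.
  have evg : ev s3 (Ratio (Rg 19) (Rg 20)) = good_edits i a j b by rewrite /= e19 e20.
  have inv' s4 : (forall r, r != 0 -> rg s4 r = rg s3 r) -> tb s4 = tb s3 ->
      (rg s4 0 = 1 /\ good_edits i a j b) \/ (rg s4 0 = 0 /\ ~~ good_edits i a j b) ->
      exists v', [/\ v <= v', k <= 28 * n * (v' - v) &
        search_inv s4 h.+1 v' (incr_at c i a j b)].
    move=> r4 t4 hg; exists v.+1; split; first lia.
      by rewrite subSn // subnn muln1.
    split; rewrite ?t4 ?h3 //; [by rewrite r4 // r3|by rewrite r4 // fr3| |].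
      by move: tot2 tot1 htot hthr; rewrite mulSn; lia.
    rewrite /answer_ok !(r4 1, r4 2, r4 3, r4 4) // !(r3 1, r3 2, r3 3, r3 4) // -/i -/a -/j -/b.
    case: hg => [[h4 hg]|[h4 hg]]; [by left|right; split=> //].
    move=> i' a' j' b' val' good'.
    have ne : (i', a', j', b') != (i, a, j, b).
      by apply: contraNneq hg => -[<- <- <- <-].
    by rewrite s2n // /incr_at (negbTE ne) addn0; apply: hcnt.
  apply: wp_if => //; rewrite evg.
    case g: good_edits => //= _; apply: wp_asg => //=; first lia.
    rewrite !add0n addn0; apply: inv' => //; last by left.
    by move=> r hr; rewrite /= iupd_neq // eq_sym.
  case g: good_edits => //= _; apply: wp_skip.
  by rewrite !add0n addn0; apply: inv' => //; right; rewrite r3 // g.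
- rewrite ev3 => hthr; have {}hthr : x + 1 < thr by lia.
  apply: wp_skip; exists v; split=> //.
  split=> //; first by lia.
  right; split=> // i' a' j' b' val' good'; rewrite /incr_at.
  have [E|ne] := eqVneq (i', a', j', b') (i, a, j, b).
    case: E val' good' => -> -> -> -> val' good'.
    by have /andP[h1 h2] := hcnt i a j b val' good'; rewrite s1c; move: h1; rewrite -/x /=; lia.
  rewrite addn0 [tb s1 3 _ _ _ _](_ : _ = tb s 3 i' a' j' b'); first exact: hcnt.
  move: ne; rewrite !xpair_eqE !negb_and (eq_sym i') (eq_sym a') (eq_sym j') (eq_sym b') -!orbA => ne.
  by rewrite /s1 /= !tupd_neq // ne orbT.
Qed.

Lemma search_inv_weaken s h v c h' c' : search_inv s h v c -> h <= h' ->
  (forall i a j b, valid_edits i a j b -> c' i a j b <= c i a j b) -> search_inv s h' v c'.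
Proof.
move=> [h1 h2 h3 h4 h5 h6 h7] hh hc; split=> //; first exact: leq_trans h6 hh.
case: h7 => [h7|[h7 h8]]; [by left|right; split=> // i a j b val good].
by have /andP[h9 ->] := h8 i a j b val good; rewrite andbT; apply: leq_trans (hc _ _ _ _ val) h9.
Qed.

Lemma search_inv_frame s s' h v c : search_inv s h v c ->
  rg s' 0 = rg s 0 -> rg s' 5 = rg s 5 -> rg s' 23 = rg s 23 ->
  (rg s 0 = 1 -> forall r, 0 < r < 5 -> rg s' r = rg s r) ->
  (forall t, tb s' t = tb s t) -> search_inv s' h v c.
Proof.
move=> [h1 h2 h3 h4 h5 h6 h7] r0 r5 r23 ra ht.
split; rewrite ?ht ?r0 ?r5 ?r23 //.
case: h7 => [[h7 h8]|[h7 h8]]; last by right; split=> // i a j b; rewrite ht; apply: h8.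
by left; split=> //; rewrite /answer_ok !(ra h7 1, ra h7 2, ra h7 3, ra h7 4).
Qed.

(** After a success the loops run on without attempts; h remains an upper bound and c constrains
    nothing any more. *)
Lemma search_inv_found s h v c h' c' : search_inv s h v c -> rg s 0 != 0 -> h <= h' ->
  search_inv s h' v c'.
Proof.
move=> [h1 h2 h3 h4 h5 h6 h7] r0 hh; split=> //; first exact: leq_trans h6 hh.
by left; case: h7 => // -[e0]; rewrite e0 in r0.
Qed.

(** Both orders are credited: if the second mismatch is repaired at its source, this edit may
    precede the other one. Only the increasing order is valid. *)
Definition incr_pair (c : nat -> nat -> nat -> nat -> nat) x1 a1 x2 a2 :=
  fun i a j b => c i a j b + ((((i, a), (j, b)) == ((x1, a1), (x2, a2))) ||
                              (((i, a), (j, b)) == ((x2, a2), (x1, a1)))).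

Lemma sort_attempt_spec s h v c (x1 := rg s 28) (a1 := rg s 29) (x2 := rg s 30) (a2 := rg s 31) :
  search_inv s h v c -> rg s 0 = 0 -> x1 < n -> x2 < n -> a1 < sg -> a2 < sg ->
  a1 <> W x1 -> a2 <> W x2 -> h < 4 * (n * n) ->
  wp sort_attempt s (fun k s' => exists v', [/\ v <= v', k <= 28 * n * (v' - v) &
    search_inv s' h.+1 v' (incr_pair c x1 a1 x2 a2)]).
Proof.
move=> inv r0 x1n x2n a1s a2s a1W a2W hn.
have inv_load s' : rg s' 0 = rg s 0 -> rg s' 5 = rg s 5 -> rg s' 23 = rg s 23 ->
    tb s' = tb s -> search_inv s' h v c.
  by move=> q0 q5 q23 qt; apply: search_inv_frame inv _ _ _ _ _; rewrite ?qt // r0.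
apply: wp_if => //.
  rewrite ev_Less !evE -/x1 -/x2 => lt12.
  apply: wp_seq; do 3![apply: wp_seq; apply: wp_asg => //]; apply: wp_asg => //.
  rewrite !evE; read_regs; set s1 := IState _ _.
  have val : valid_edits x1 a1 x2 a2 by split=> //; rewrite lt12.
  apply: (wp_use (@attempt_spec s1 h v c _ r0 val hn)); first exact: inv_load.
  move=> k s' [v' [h1 h2 h3]] _ _; exists v'; split=> //.
  apply: search_inv_weaken h3 (leqnn _) _ => i a j b [/andP[ij _] _ _ _ _].
  rewrite /incr_pair /incr_at leq_add2l /s1; read_regs; rewrite -/x1 -/x2 -/a1 -/a2.
  rewrite !xpair_eqE -!andbA; case: (_ && _) => //=.
  by case: eqP => //= ?; case: eqP => //= ?; case: eqP => //= ?; lia.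
move/ev_false; rewrite ev_Less !evE -/x1 -/x2 => ge12.
apply: wp_if => //.
  rewrite ev_Less !evE -/x1 -/x2 => lt21.
  apply: wp_seq; do 3![apply: wp_seq; apply: wp_asg => //]; apply: wp_asg => //.
  rewrite !evE; read_regs; set s1 := IState _ _.
  have val : valid_edits x2 a2 x1 a1 by split=> //; rewrite lt21.
  apply: (wp_use (@attempt_spec s1 h v c _ r0 val hn)); first exact: inv_load.
  move=> k s' [v' [h1 h2 h3]] _ _; exists v'; split=> //.
  apply: search_inv_weaken h3 (leqnn _) _ => i a j b [/andP[ij _] _ _ _ _].
  rewrite /incr_pair /incr_at leq_add2l /s1; read_regs; rewrite -/x1 -/x2 -/a1 -/a2 orbC.
  rewrite !xpair_eqE -!andbA; case: (_ && _) => //=.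
  by case: eqP => //= ?; case: eqP => //= ?; case: eqP => //= ?; lia.
move/ev_false; rewrite ev_Less !evE -/x1 -/x2 => ge21.
apply: wp_skip; exists v; split=> //.
apply: search_inv_weaken inv (leqnSn _) _ => i a j b [/andP[ij _] _ _ _ _].
rewrite /incr_pair !xpair_eqE.
rewrite [X in c i a j b + X](_ : _ = 0) ?addn0 //; apply/eqP; rewrite eqb0; apply/negP.
by case/orP => /andP[/andP[/eqP e1 _] /andP[/eqP e2 _]]; move: ij ge12 ge21; rewrite e1 e2; lia.
Qed.

Lemma try_repairs_spec (t1 t2 : bool) s h v c (d := rg s 24) (x := rg s 26 - 1) (y := rg s 27)
    (p1 := fun t : bool => if t then x else x - d) (p2 := fun t : bool => if t then y else y - d) :
  search_inv s h v c -> 0 < d <= x -> x < n -> d <= y < n ->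
  W x <> W (x - d) -> W y <> W (y - d) -> h < 4 * (n * n) ->
  wp (try_repairs t1 t2) s (fun k s' => exists v', [/\ v <= v', k <= 28 * n * (v' - v) &
    search_inv s' h.+1 v' (incr_pair c (p1 t1) (W (p1 (~~ t1))) (p2 t2) (W (p2 (~~ t2))))]).
Proof.
move=> inv dx xn dy xW yW hn; have hV := vmax_ge n sg.
have NE : N = n + sg + 2 by [].
have p1n t : p1 t < n by rewrite /p1; case: t; lia.
have p2n t : p2 t < n by rewrite /p2; case: t; lia.
have W1 t : W (p1 (~~ t)) <> W (p1 t) by rewrite /p1; case: t => //=; apply: nesym.
have W2 t : W (p2 (~~ t)) <> W (p2 t) by rewrite /p2; case: t => //=; apply: nesym.
have ev1 s' t : rg s' 24 = d -> rg s' 26 = rg s 26 -> ev s' (target1 t) = p1 t.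
  by move=> e1 e2; case: t => /=; rewrite ?e1 e2.
have ev2 s' t : rg s' 24 = d -> rg s' 27 = y -> ev s' (target2 t) = p2 t.
  by move=> e1 e2; case: t => /=; rewrite ?e1 e2.
have evI s' e : ev s' (Inp e) = W (ev s' e) by [].
have sf1 s' t : safe s' (target1 t) by case: t => /=; repeat split; lia.
have sf2 s' t : safe s' (target2 t) by case: t => /=; repeat split; lia.
apply: wp_if; first by split=> //=; lia.
  rewrite ev_Equal !evE => /eqP r0.
  apply: wp_seq; apply: wp_asg => //.
  rewrite ev1 //.
  apply: wp_seq; apply: wp_asg => //.
    by split; [exact: sf1|rewrite ev1 // NE]; have := p1n (~~ t1); lia.
  rewrite evI ev1 //.
  apply: wp_seq; apply: wp_asg => //.
  rewrite ev2 //.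
  apply: wp_seq; apply: wp_asg => //.
    by split; [exact: sf2|rewrite ev2 // NE]; have := p2n (~~ t2); lia.
  rewrite evI ev2 //; set s1 := IState _ _.
  have inv1 : search_inv s1 h v c by apply: search_inv_frame inv _ _ _ _ _ => // e0; rewrite e0 in r0.
  by apply: (wp_use (sort_attempt_spec inv1 _ _ _ _ _ _ _ _)) => //=; read_regs; auto.
move/ev_false; rewrite ev_Equal !evE => r0.
apply: wp_skip; exists v; split=> //.
by apply: search_inv_found inv _ _ => //; rewrite r0.
Qed.

Definition finished d u (p : nat * nat) := (p.1 < d) || (p.1 == d) && (p.2 < u).

Section Target.
(* A pair of edits, and positions of the search at which it is attempted. *)
Variables (i0 a0 j0 b0 : nat) (P : seq (nat * nat)).
Hypothesis P_uniq : uniq P.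
Hypothesis P_hit : forall p, p \in P -> p.2 \in lz77_starts w /\ hit w n i0 a0 j0 b0 p.1 p.2.

(** The lower bound is 0 for all pairs except the target, whose passed hits are counted. *)
Definition target_count d u i a j b :=
  if (i, a, j, b) == (i0, a0, j0, b0) then count (finished d u) P else 0.

Definition last_mismatch d u lm :=
  [/\ lm <= u, 0 < lm -> d <= lm.-1 /\ W lm.-1 <> W (lm.-1 - d) &
      forall t, lm <= t < u -> d <= t -> W t = W (t - d)].

Lemma count_finishedS d u :
  count (finished d u.+1) P = count (finished d u) P + ((d, u) \in P).
Proof.
rewrite -(count_uniq_mem _ P_uniq) -count_predUI.
rewrite [X in _ = _ + X](_ : _ = 0) ?addn0; last first.
  rewrite (eq_count (a2 := pred0)) ?count_pred0 // => -[d' u'] /=.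
  by rewrite /finished xpair_eqE /=; lia.
by apply: eq_count => -[d' u'] /=; rewrite /finished xpair_eqE /=; lia.
Qed.

(** The two mismatches of a hit are consecutive around u, so they are the ones the search holds when
    it reaches (d, u). *)
Lemma mem_P_last_mismatch d u lm nm : 0 < d -> (d, u) \in P -> last_mismatch d u lm ->
  is_next_mismatch n W d u nm ->
  [/\ u \in lz77_starts w, 0 < lm, nm < n &
    (repairs w d lm.-1 (i0, a0) /\ repairs w d nm (j0, b0)) \/
    (repairs w d lm.-1 (j0, b0) /\ repairs w d nm (i0, a0))].
Proof.
move=> d0 /P_hit[/= us [x [y [[_ dx xu uy yn] [xW yW] bt rep]]]] [l1 l2 l3] [m1 m2 m3].
have x_lm : x < lm.
  by rewrite ltnNge; apply/negP => h; apply: xW; apply: l3; lia.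
have [|l4 l5] := l2; first lia.
have xE : x = lm.-1.
  have [//|ne] := eqVneq x lm.-1; case: l5; apply: bt; lia.
have nm_y : nm <= y.
  by rewrite leqNgt; apply/negP => h; apply: yW; apply: m2; lia.
have yE : y = nm.
  have [//|ne] := eqVneq y nm; case: m3; first lia.
  by apply: bt; lia.
by rewrite -xE -yE; split=> //; lia.
Qed.

Lemma repairs_target d x e : repairs w d x e ->
  exists t : bool, e = ((if t then x else x - d), W (if ~~ t then x else x - d)).
Proof. by case=> ->; [exists true|exists false]. Qed.

Lemma cell_spec s h v (d := rg s 24) (u := rg s 25) (lm := rg s 26) (nm := rg s 27) :
  0 < d <= u -> u < n -> last_mismatch d u lm -> is_next_mismatch n W d u nm ->
  search_inv s h v (target_count d u) ->
  (u \in lz77_starts w -> h + 4 <= 4 * (n * n)) ->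
  wp cell s (fun k s' => exists v', [/\ v <= v', k <= 28 * n * (v' - v) &
    search_inv s' (h + 4 * (u \in lz77_starts w)) v' (target_count d u.+1)]).
Proof.
move=> du un hlm hnm inv hn; have hV := vmax_ge n sg.
have NE : N = n + sg + 2 by [].
have [l1 l2 l3] := hlm; have [m1 m2 m3] := hnm.
have ste : tb s 2 u 0 0 0 = (u \in lz77_starts w) by apply: (inv_start inv).
have d0 : 0 < d by lia.
apply: wp_if.
- apply: safe_IAnd; first by rewrite /= -/u NE; repeat split; lia.
  by apply: safe_IAnd => /=; repeat split; lia.
- rewrite !testE !evE -/u ste eqb0 negbK -/lm -/nm (inv_n inv) => /and3P[us lm0 nmn].
  rewrite us muln1; have {}hn := hn us.
  have [//|dlm lmW] := l2.
  set x := lm - 1; have xE : lm.-1 = x by rewrite /x; lia.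
  rewrite xE in dlm lmW; have nmW := m3 nmn.
  have H1 : 0 < d <= x by lia.
  have H2 : x < n by lia.
  have H3 : d <= nm < n by lia.
  pose p1 (t : bool) := if t then x else x - d.
  pose p2 (t : bool) := if t then nm else nm - d.
  have step t1 t2 s' h' v' c : rg s' 24 = d -> rg s' 26 = lm -> rg s' 27 = nm ->
      search_inv s' h' v' c -> h' < 4 * (n * n) ->
      wp (try_repairs t1 t2) s' (fun k s'' => exists v'', [/\ v' <= v'', k <= 28 * n * (v'' - v') &
        search_inv s'' h'.+1 v'' (incr_pair c (p1 t1) (W (p1 (~~ t1))) (p2 t2) (W (p2 (~~ t2))))]).
    by move=> e1 e2 e3 i1 i2; have := @try_repairs_spec t1 t2 s' h' v' c; rewrite e1 e2 e3; apply.
  apply: wp_seq; apply: (wp_use (step true true s h v _ _ _ _ inv _)) => //; first lia.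
  move=> k1 s1 [v1 [v01 k1v inv1]] fr1 _.
  apply: wp_seq; apply: (wp_use (step true false s1 _ v1 _ _ _ _ inv1 _)); rewrite ?fr1 //; first lia.
  move=> k2 s2 [v2 [v12 k2v inv2]] fr2 _.
  apply: wp_seq; apply: (wp_use (step false true s2 _ v2 _ _ _ _ inv2 _)); rewrite ?fr2 ?fr1 //; first lia.
  move=> k3 s3 [v3 [v23 k3v inv3]] fr3 _.
  apply: (wp_use (step false false s3 _ v3 _ _ _ _ inv3 _)); rewrite ?fr3 ?fr2 ?fr1 //; first lia.
  move=> k4 s4 [v4 [v34 k4v inv4]] _ _; exists v4; split; first lia.
    have -> : v4 - v = (v1 - v) + (v2 - v1) + (v3 - v2) + (v4 - v3) by lia.
    by rewrite !mulnDr; lia.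
  apply: search_inv_weaken inv4 _ _; first lia.
  move=> i a j b _.
  pose inc t1 t2 c := incr_pair c (p1 t1) (W (p1 (~~ t1))) (p2 t2) (W (p2 (~~ t2))).
  rewrite -/(inc true true (target_count d u)) -/(inc true false (inc true true (target_count d u))).
  set c2 := inc true false _; rewrite -/(inc false true c2); set c3 := inc false true c2.
  rewrite -/(inc false false c3); set c4 := inc false false c3.
  rewrite {1}/target_count; case: eqP => [[-> -> -> ->]|_] //.
  have inc_ge t1 t2 c : c i0 a0 j0 b0 <= inc t1 t2 c i0 a0 j0 b0 by exact: leq_addr.
  have g1 := inc_ge true true (target_count d u); have g2 := inc_ge true false (inc true true (target_count d u)).
  have g3 := inc_ge false true c2; have g4 := inc_ge false false c3.
  have tE : target_count d u i0 a0 j0 b0 = count (finished d u) P by rewrite /target_count eqxx.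
  rewrite tE in g1; rewrite -/c2 in g2; rewrite -/c3 in g3; rewrite -/c4 in g4.
  rewrite count_finishedS.
  case P_du: ((d, u) \in P); last by rewrite addn0; move: g1 g2 g3 g4; lia.
  have [_ _ _ rep] := mem_P_last_mismatch d0 P_du hlm hnm.
  (* One of the four choices is the target and raises its bound by one; the other three cannot lower
     it. *)
  have [t1 [t2 E]] : exists t1 t2, forall c, inc t1 t2 c i0 a0 j0 b0 = c i0 a0 j0 b0 + 1.
    rewrite xE in rep; case: rep => -[/repairs_target[t1 e1] /repairs_target[t2 e2]];
      exists t1, t2 => c; rewrite /inc /incr_pair e1 e2 eqxx ?orbT //.
  by case: t1 E; case: t2 => E; [have := E (target_count d u); rewrite tE|
    have := E (inc true true (target_count d u)); rewrite -/c2|have := E c2; rewrite -/c3|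
    have := E c3; rewrite -/c4]; move: g1 g2 g3 g4; lia.
- move/ev_false; rewrite !testE !evE -/u ste eqb0 negbK -/lm -/nm (inv_n inv) => hc.
  apply: wp_skip; exists v; split=> //.
  apply: search_inv_weaken inv (leq_addr _ _) _ => i a j b _.
  rewrite /target_count; case: eqP => // _; rewrite count_finishedS.
  case P_du: ((d, u) \in P); last by rewrite addn0.
  have [us lm0 nmn _] := mem_P_last_mismatch d0 P_du hlm hnm.
  by rewrite us lm0 nmn in hc.
Qed.

Lemma P_bounds p : p \in P -> 0 < p.1 < p.2 /\ p.2 < n.
Proof.
by move=> /P_hit[_ [x [y [[h1 h2 h3 h4 h5] _ _ _]]]]; split; lia.
Qed.

(** Row d + 1 may be entered at u = d + 1, because hits satisfy d < u < n. *)
Lemma target_count_next d i a j b :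
  target_count d n i a j b = target_count d.+1 d.+1 i a j b.
Proof.
rewrite /target_count; case: eqP => // _; apply: eq_in_count => -[x y] /P_bounds[/= h1 h2].
by rewrite /finished /=; lia.
Qed.

Lemma last_mismatch_next d u lm : d <= u -> last_mismatch d u lm ->
  last_mismatch d u.+1 (if W u == W (u - d) then lm else u.+1).
Proof.
move=> du [h1 h2 h3]; case: eqP => E; split=> //; first lia.
  by move=> t ht dt; have [->//|ne] := eqVneq t u; apply: h3; lia.
by move=> t ht; lia.
Qed.

Lemma count_starts_next u : count (fun x => x < u.+1) (lz77_starts w) =
  count (fun x => x < u) (lz77_starts w) + (u \in lz77_starts w).
Proof.
rewrite -(count_uniq_mem _ (lz77_starts_uniq w)) -count_predUI.
rewrite [X in _ = _ + X](_ : _ = 0) ?addn0; last first.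
  by rewrite (eq_count (a2 := pred0)) ?count_pred0 // => x /=; lia.
by apply: eq_count => x /=; lia.
Qed.

Lemma count_starts_le u : count (fun x => x < u) (lz77_starts w) <= z.
Proof. by apply: leq_trans (count_size _ _) _; rewrite size_map size_iota. Qed.

(** A shift costs four attempts per block start and, besides verifications, at most n + 1 ticks. If
    the answer is still 0 at the end, the counter of a good target has counted all of [P] and is
    below [thr]. *)
Lemma search_spec s :
  rg s 5 = n -> rg s 23 = z -> prev_occ_table n sg W (tb s 0) ->
  mismatch_table n W (tb s 1) -> start_table n w (tb s 2) ->
  (forall i a j b, tb s 3 i a j b = 0) -> rg s 0 = 0 ->
  wp search s (fun k s' => exists v, [/\ v * thr <= 4 * (n * z),
    k <= 28 * n * v + (n + 1) * (n + 1) &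
    (rg s' 0 = 1 /\ answer_ok s') \/
    (rg s' 0 = 0 /\ (valid_edits i0 a0 j0 b0 -> good_edits i0 a0 j0 b0 -> size P < thr))]).
Proof.
move=> s5 s23 pct mmt stt t3 r0; have hV := vmax_ge n sg.
have NE : N = n + sg + 2 by [].
have zn : z <= n by rewrite -size_w size_lz77_le.
apply: wp_seq; apply: wp_asg => //=; first lia.
pose J d k s1 := exists h v, [/\ search_inv s1 h v (target_count d d),
  h <= 4 * ((d - 1) * z) & k <= 28 * n * v + (d - 1) * (n + 1)].
apply: (wp_for (J := J) (lo := 1) (H := n.+1)) => //; try lia.
- exists 0, 0; split=> //; split=> //.
    rewrite mul0n add0n leqn0 /total; apply/eqP; apply: big1 => i _.
    by apply: big1 => a _; apply: big1 => j _; apply: big1 => b _; apply: t3.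
  right; split=> // i a j b _ _; rewrite /= t3 thr_gt0 andbT leqn0.
  rewrite /target_count; case: ifP => // _; apply/eqP.
  rewrite (eq_in_count (a2 := pred0)) ?count_pred0 // => -[x y] /P_bounds[/= h1 h2].
  by rewrite /finished /=; lia.
- by move=> d k s1 hd [h [v [[e5 _ _ _ _ _ _] _ _]]] _; rewrite /= e5; repeat split; lia.
- move=> d k s1 hd [h [v [inv hh kk]]] e24.
  have e5 := inv_n inv.
  apply: wp_seq; apply: wp_asg => //=; first lia.
  apply: wp_seq; apply: wp_asg => //=; read_regs; rewrite e24.
  set s2 := IState _ _.
  pose K u k s3 := exists h v', [/\ search_inv s3 h v' (target_count d u),
    h <= 4 * ((d - 1) * z + count (fun x => x < u) (lz77_starts w)),
    v <= v' /\ k <= 28 * n * (v' - v) + (u - d),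
    rg s3 24 = d & last_mismatch d u (rg s3 26)].
  apply: (wp_for (J := K) (lo := d) (H := n)) => //; try lia.
  + exists h, v; split=> //.
    * by apply: search_inv_frame inv _ _ _ _ _ => // _ r hr; rewrite /= !iupd_neq //; lia.
    * by lia.
    * by split; read_regs => // t ht dt; lia.
  + by move=> u k3 s3 hu [h3 [v3 [[q5 _ _ _ _ _ _] _ _ _ _]]] _.
  + move=> u k3 s3 hu [h3 [v3 [inv3 hh3 [vv3 kk3] q24 lm3]]] q25.
    have q5 := inv_n inv3.
    apply: wp_seq; apply: wp_asg => //.
      by rewrite /= q24 q25 NE; repeat split; lia.
    rewrite !evE q24 q25.
    have nm := inv_mismatch inv3 (_ : 0 < d) (_ : d <= u <= n).
    have {}nm : is_next_mismatch n W d u (tb s3 1 d u 0 0) by apply: nm; lia.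
    set s4 := IState _ _.
    have inv4 : search_inv s4 h3 v3 (target_count d u).
      by apply: search_inv_frame inv3 _ _ _ _ _ => // _ r hr; rewrite /= !iupd_neq //; lia.
    have cz := count_starts_next u; have cz' := count_starts_le u.+1.
    (* The current start is one of the z starts of row d, and d z <= n^2. *)
    have hn4 : u \in lz77_starts w -> h3 + 4 <= 4 * (n * n).
      move=> us; rewrite us in cz.
      have : (d - 1) * z + z <= n * n by rewrite -mulSnr; apply: leq_mul; lia.
      lia.
    apply: wp_seq.
    have := @cell_spec s4 h3 v3.
    have -> : rg s4 24 = d by [].
    have -> : rg s4 25 = u by [].
    have -> : rg s4 26 = rg s3 26 by [].
    have -> : rg s4 27 = tb s3 1 d u 0 0 by [].
    move=> cs; apply: (wp_use (cs _ _ lm3 nm inv4 hn4)); [lia|lia|].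
    move=> k5 s5' [v5 [v35 k5v inv5]] fr5 _.
    have f24 : rg s5' 24 = d by rewrite fr5.
    have f25 : rg s5' 25 = u by rewrite fr5.
    have f26 : rg s5' 26 = rg s3 26 by rewrite fr5.
    have lm5 := last_mismatch_next (_ : d <= u) lm3.
    have done s6 : rg s6 0 = rg s5' 0 -> rg s6 5 = rg s5' 5 -> rg s6 23 = rg s5' 23 ->
        (forall r, 0 < r < 5 -> rg s6 r = rg s5' r) -> (forall t, tb s6 t = tb s5' t) ->
        rg s6 24 = d -> rg s6 26 = (if W u == W (u - d) then rg s3 26 else u.+1) ->
        K u.+1 (k3 + (0 + (k5 + 0))).+1 s6.
      move=> x0 x5 x23 xr xt x24 x26; exists (h3 + 4 * (u \in lz77_starts w)), v5; split=> //.
      * by apply: search_inv_frame inv5 _ _ _ _ _ => // _; exact: xr.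
      * by rewrite cz; lia.
      * split; first lia.
        have -> : v5 - v = (v3 - v) + (v5 - v3) by lia.
        by rewrite mulnDr; lia.
      * by rewrite x26; apply: lm5; lia.
    apply: wp_if; first by rewrite /= f24 f25 NE; repeat split; lia.
    * rewrite ev_Equal !evE f24 f25 => hW; apply: wp_skip; split=> //.
      apply: done => //=; read_regs; rewrite ?f26 ?hW //.
      by move=> r hr; rewrite ?iupd_neq //; lia.
    * move/ev_false; rewrite ev_Equal !evE f24 f25 => hW.
      apply: wp_asg => //=; first by rewrite f25; repeat split; lia.
      rewrite f25; split=> //.
      apply: done => //=; read_regs; rewrite ?hW ?addn1 //.
      by move=> r hr; rewrite ?iupd_neq //; lia.
  + move=> k3 s3 [h3 [v3 [inv3 hh3 [vv3 kk3] q24 lm3]]] q25; split=> //.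
    exists h3, v3; split.
    * apply: (search_inv_frame (s := s3)) => //=; last by move=> _ r hr; rewrite /= iupd_neq //; lia.
      by apply: search_inv_weaken inv3 _ _ => // i a j b _; rewrite target_count_next.
    * have := count_starts_le n.
      have -> : d.+1 - 1 = (d - 1).+1 by lia.
      by rewrite mulSn; lia.
    * have -> : v3 = v + (v3 - v) by lia.
      have -> : d.+1 - 1 = (d - 1).+1 by lia.
      by rewrite mulnDr mulSn; lia.
- move=> k s1 [h [v [inv hh kk]]] e24; exists v; split.
  + by have := inv_total inv; rewrite subn1 /= in hh; lia.
  + by rewrite subn1 /= in kk; nia.
  + case: (inv_counters inv) => [|[h1 h2]]; [by left|right; split=> //].
    move=> val good; have /andP[h3 h4] := h2 _ _ _ _ val good.
    apply: leq_ltn_trans h4; apply: leq_trans h3.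
    rewrite /target_count eqxx -count_predT; apply: eq_leq; apply: eq_in_count => -[x y] /P_bounds[/= h5 h6].
    by rewrite /finished /=; lia.
Qed.

End Target.

End Search.

(** * Compilation to the word RAM *)

Section Compilation.
Variable sg : nat.

Definition EBase := EBin Add (EReg 5) (EConst (sg + 2)).

Definition EDigit (e d : expr) := EBin Add (EBin Mul e EBase) d.

(* Register 5 holds n, so that EBase is the number of digits.  The leading digit
   k + 1 keeps the tables away from the input. *)
Definition EAddress k a b c d :=
  EDigit (EDigit (EDigit (EDigit (EConst k.+1) a) b) c) d.

Fixpoint compile_expr (e : iexpr) : expr :=
  match e with
  | Cst c => EConst c
  | Rg x => EReg x
  | Inp e => ELoad (compile_expr e)
  | Tab k a b c d =>
      ELoad (EAddress k (compile_expr a) (compile_expr b) (compile_expr c) (compile_expr d))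
  | Plus a b => EBin Add (compile_expr a) (compile_expr b)
  | Minus a b => EBin Defs.Sub (compile_expr a) (compile_expr b)
  | Less a b => EBin Lt (compile_expr a) (compile_expr b)
  | Equal a b => EBin Eq (compile_expr a) (compile_expr b)
  | Sel a b c =>
      EBin Add (EBin Mul (EBin Lt (EConst 0) (compile_expr a)) (compile_expr b))
               (EBin Mul (EBin Eq (compile_expr a) (EConst 0)) (compile_expr c))
  | Ratio a b => ERatio (compile_expr a) (compile_expr b)
  end.

Fixpoint compile (c : icmd) : cmd :=
  match c with
  | ISkip => Skip
  | IAsg x e => Assign x (compile_expr e)
  | ISto k a b c d e =>
      Store (EAddress k (compile_expr a) (compile_expr b) (compile_expr c) (compile_expr d))
            (compile_expr e)
  | ISeq c1 c2 => Seq (compile c1) (compile c2)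
  | IIf e c1 c2 => If (compile_expr e) (compile c1) (compile c2)
  | IWhile e c => While (compile_expr e) (compile c)
  end.

(* An upper bound for the time between two loop iterations. *)
Fixpoint unit_time (c : cmd) : nat :=
  match c with
  | Skip => 1
  | Assign _ e => (cost e).+1
  | Store a e => (cost a + cost e).+1
  | Seq c1 c2 => unit_time c1 + unit_time c2
  | If e c1 c2 => (cost e + unit_time c1 + unit_time c2).+1
  | While e c => (cost e + unit_time c).+1
  end.

Variable n : nat.
Local Notation N := (ndig n sg).
Local Notation V := (vmax n sg).

Definition address k a b c d := (((k.+1 * N + a) * N + b) * N + c) * N + d.

Lemma digit_inj x y a b : a < N -> b < N -> x * N + a = y * N + b -> x = y /\ a = b.
Proof.
move=> aN bN E; have xy : x = y.
  by have := congr1 (divn^~ N) E; rewrite !divnMDl ?(divn_small aN) ?(divn_small bN) ?addn0 //; lia.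
by split=> //; move: E; rewrite xy; lia.
Qed.

Lemma address_inj k a b c d k' a' b' c' d' :
  a < N -> b < N -> c < N -> d < N -> a' < N -> b' < N -> c' < N -> d' < N ->
  address k a b c d = address k' a' b' c' d' -> [/\ k = k', a = a', b = b', c = c' & d = d'].
Proof.
move=> aN bN cN dN a'N b'N c'N d'N.
move=> /(digit_inj dN d'N)[] /(digit_inj cN c'N)[] /(digit_inj bN b'N)[].
by move=> /(digit_inj aN a'N)[] [].
Qed.

Lemma address_ge k a b c d : N <= address k a b c d.
Proof.
have N0 : 0 < N by rewrite /ndig; lia.
have le_mul x y : 0 < x -> N <= x * N + y.
  by move=> x0; apply: leq_trans (leq_addr _ _); rewrite leq_pmull.
have gt0 x y : 0 < x -> 0 < x * N + y by move=> x0; apply: leq_trans N0 (le_mul _ _ x0).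
by apply/le_mul/gt0/gt0/gt0.
Qed.

Variables (ws : nat) (W : nat -> nat) (ratio_le : nat -> nat -> bool).
Hypothesis W_lt : forall x, x < N -> W x < V.
Hypothesis ws_large : 16 * (N * (N * (N * N))) <= 2 ^ ws.

Local Notation ev := (ev W ratio_le).
Local Notation safe := (safe n sg W ratio_le).

Definition simulates (s : ist) (rs : state) : Prop :=
  [/\ forall x, reg rs x = rg s x, forall x, rg s x < V, rg s 5 = n,
      forall x, x < N -> Defs.mem rs x = W x &
      forall k a b c d, k < 8 -> a < N -> b < N -> c < N -> d < N ->
        Defs.mem rs (address k a b c d) = tb s k a b c d /\ tb s k a b c d < V].

Lemma vmax_le : V <= 2 ^ ws.
Proof. by apply: leq_trans ws_large; rewrite /vmax -mulnA leq_pmul2l // leq_mul2l; apply/orP; right; rewrite leq_pmulr // muln_gt0 /ndig; lia. Qed.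

Lemma eval_EAddress rs k ea eb ec ed (a := eval ws ratio_le rs ea) (b := eval ws ratio_le rs eb)
    (c := eval ws ratio_le rs ec) (d := eval ws ratio_le rs ed) :
  reg rs 5 = n -> k < 8 -> a < N -> b < N -> c < N -> d < N ->
  eval ws ratio_le rs (EAddress k ea eb ec ed) = address k a b c d.
Proof.
move=> r5 k8 aN bN cN dN.
have N2 : 2 <= N by rewrite /ndig; lia.
have NE : n + (sg + 2) = N by rewrite /ndig addnA.
have base : eval ws ratio_le rs EBase = N.
  have VN : N < V by rewrite /vmax; nia.
  have := vmax_le; move=> VM.
  by rewrite /= r5 (modn_small (_ : sg + 2 < _)) ?NE ?modn_small //; lia.
have digit e e' B : eval ws ratio_le rs e < B -> eval ws ratio_le rs e' < N -> B * N <= 2 ^ ws ->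
    eval ws ratio_le rs (EDigit e e') = eval ws ratio_le rs e * N + eval ws ratio_le rs e'.
  set x := eval _ _ _ e; set y := eval _ _ _ e' => xB yN BM; have lt : x * N + y < B * N.
    by apply: (@leq_trans (x.+1 * N)); [rewrite mulSn; lia|rewrite leq_mul2r xB orbT].
  rewrite -[LHS]/((x * eval ws ratio_le rs EBase %% 2 ^ ws + y) %% 2 ^ ws) base.
  by rewrite (modn_small (_ : x * N < _)) ?modn_small //; lia.
have digit_lt x B y : x < B -> y < N -> x * N + y < B * N.
  by move=> xB yN; apply: (@leq_trans (x.+1 * N)); [rewrite mulSn; lia|rewrite leq_mul2r xB orbT].
(* The leading digit is at most 8 and is followed by four digits in base N. *)
have M1 : 9 * N * N * N * N <= 2 ^ ws.
  by apply: leq_trans ws_large; rewrite -!mulnA leq_mul2r; apply/orP; right.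
have le_mul B : B <= B * N by rewrite leq_pmulr //; lia.
have kE : eval ws ratio_le rs (EConst k.+1) = k.+1.
  by rewrite /= modn_small //; have := vmax_le; rewrite /vmax; nia.
have k9 : k.+1 < 9 by lia.
rewrite /EAddress.
have M4 : 9 * N * N * N <= 2 ^ ws by apply: leq_trans M1.
have M3 : 9 * N * N <= 2 ^ ws by apply: leq_trans M4.
have M2 : 9 * N <= 2 ^ ws by apply: leq_trans M3.
have d1 := digit (EConst k.+1) ea 9; rewrite kE in d1; have {}d1 := d1 k9 aN M2.
have l1 := digit_lt _ _ _ k9 aN.
have d2 := digit (EDigit (EConst k.+1) ea) eb (9 * N); rewrite d1 in d2; have {}d2 := d2 l1 bN M3.
have l2 := digit_lt _ _ _ l1 bN.
have d3 := digit (EDigit (EDigit (EConst k.+1) ea) eb) ec (9 * N * N).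
rewrite d2 in d3; have {}d3 := d3 l2 cN M4; have l3 := digit_lt _ _ _ l2 cN.
have d4 := digit (EDigit (EDigit (EDigit (EConst k.+1) ea) eb) ec) ed (9 * N * N * N).
by rewrite d3 in d4; apply: d4 l3 dN M1.
Qed.

Lemma eval_compile_expr s rs e : simulates s rs -> safe s e ->
  eval ws ratio_le rs (compile_expr e) = ev s e /\ ev s e < V.
Proof.
move=> [hreg hregV h5 hinp htab].
have r5 : reg rs 5 = n by rewrite hreg.
have VM := vmax_le.
have V2 : 2 < V by rewrite /vmax /ndig; nia.
elim: e => [c|x|e IH|k a IHa b IHb c IHc d IHd|a IHa b IHb|a IHa b IHb|a IHa b IHb|a IHa b IHb|a IHa b IHb c IHc|a IHa b IHb].
- by rewrite /=; move=> cV; rewrite modn_small //; lia.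
- by rewrite /=; move=> _; rewrite hreg.
- by rewrite /=; move=> [/IH[-> _] lt]; rewrite hinp //; split=> //; apply: W_lt.
- move=> [k8 [/IHa[ea _] aN] [/IHb[eb _] bN] [/IHc[ec _] cN] [/IHd[ed _] dN]].
  rewrite -[eval _ _ _ _]/(Defs.mem rs (eval ws ratio_le rs (EAddress k (compile_expr a)
    (compile_expr b) (compile_expr c) (compile_expr d)))).
  rewrite eval_EAddress ?ea ?eb ?ec ?ed //; exact: htab.
- by rewrite /=; move=> [/IHa[-> _] /IHb[-> _] lt]; rewrite modn_small //; lia.
- by rewrite /=; move=> [/IHa[-> aV] /IHb[-> _]]; split=> //; lia.
- by rewrite /=; move=> [/IHa[-> aV] /IHb[-> _]]; split=> //; apply: leq_ltn_trans (leq_b1 _) _; lia.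
- by rewrite /=; move=> [/IHa[-> aV] /IHb[-> _]]; split=> //; apply: leq_ltn_trans (leq_b1 _) _; lia.
- rewrite /=; move=> [/IHa[-> aV] /IHb[-> bV] /IHc[-> cV]]; rewrite mod0n.
  have [->|a0] := eqVneq (ev s a) 0.
    by rewrite /= mul0n mod0n add0n mul1n !modn_small //; lia.
  rewrite lt0n a0 /= mul1n mul0n mod0n addn0 !modn_small //; lia.
- by rewrite /=; move=> [/IHa[-> aV] /IHb[-> _]]; split=> //; apply: leq_ltn_trans (leq_b1 _) _; lia.
Qed.

(** [unit_time] charges every branch and every loop body once. Each tick pays for one more passage
    through the program, so counting iterations suffices. *)
Lemma compile_correct c s k s' rs : iexec n sg W ratio_le c s k s' -> simulates s rs ->
  exists t rs', [/\ exec ws ratio_le (compile c) rs t rs', t <= unit_time (compile c) * k.+1 &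
    simulates s' rs'].
Proof.
move=> H; elim: H rs => {c s k s'}.
- by move=> s rs sim; exists 1, rs; split=> //; constructor.
- move=> x e s x5 he rs sim; have [ee eV] := eval_compile_expr sim he.
  eexists; eexists; split; first exact: ExecAssign; first by rewrite /= muln1.
  have [h1 h2 h3 h4 h5] := sim; split=> //=.
  + move=> y; rewrite /upd ee; case: eqVneq => [->|ne]; first by rewrite /iupd eqb_nn.
    by rewrite iupd_neq ?h1 // eq_sym.
  + move=> y; have [<-|ne] := eqVneq x y; first by rewrite /iupd eqb_nn.
    by rewrite iupd_neq.
  (* Register 5 is never assigned, so the base of the addresses does not change. *)
  + by rewrite iupd_neq.
- move=> k a b c d e s [k8 [sa aN] [sb bN] [sc cN] [sd dN]] he rs sim.
  have [ee eV] := eval_compile_expr sim he.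
  have [ea _] := eval_compile_expr sim sa; have [eb _] := eval_compile_expr sim sb.
  have [ec _] := eval_compile_expr sim sc; have [ed _] := eval_compile_expr sim sd.
  have [h1 h2 h3 h4 h5] := sim.
  eexists; eexists; split; first exact: ExecStore; first by rewrite /= muln1.
  rewrite eval_EAddress ?ea ?eb ?ec ?ed ?h1 // ee.
  split=> //=.
  + move=> x xN; rewrite /upd; case: eqVneq => [E|_]; last exact: h4.
    by have := address_ge k (ev s a) (ev s b) (ev s c) (ev s d); rewrite -E; lia.
  + move=> k' a' b' c' d' k'8 a'N b'N c'N d'N; rewrite /upd; case: eqVneq => [E|ne].
      have [-> -> -> -> ->] := address_inj a'N b'N c'N d'N aN bN cN dN E.
      by rewrite tupd_eq.
    have [g1 g2] := h5 k' a' b' c' d' k'8 a'N b'N c'N d'N.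
    rewrite g1 tupd_neq //; apply: contraNT ne => /norP[/negPn/eqP-> /norP[/negPn/eqP->]].
    by move=> /norP[/negPn/eqP-> /norP[/negPn/eqP-> /negPn/eqP->]].
- move=> c1 c2 s1 k1 s2 k2 s3 _ IH1 _ IH2 rs sim.
  have [t1 [rs2 [x1 l1 sim2]]] := IH1 _ sim; have [t2 [rs3 [x2 l2 sim3]]] := IH2 _ sim2.
  exists (t1 + t2), rs3; split=> //; first exact: ExecSeq x1 x2.
  by rewrite /=; nia.
- move=> e c1 c2 s k s' he h _ IH rs sim.
  have [ee _] := eval_compile_expr sim he; have [t [rs' [x l sim']]] := IH _ sim.
  exists (cost (compile_expr e) + t).+1, rs'; split=> //; first by apply: ExecIfTrue => //; rewrite ee.
  by rewrite /=; nia.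
- move=> e c1 c2 s k s' he h _ IH rs sim.
  have [ee _] := eval_compile_expr sim he; have [t [rs' [x l sim']]] := IH _ sim.
  exists (cost (compile_expr e) + t).+1, rs'; split=> //; first by apply: ExecIfFalse => //; rewrite ee.
  by rewrite /=; nia.
- move=> e c s1 k1 s2 k2 s3 he h _ IH1 _ IH2 rs sim.
  have [ee _] := eval_compile_expr sim he.
  have [t1 [rs2 [x1 l1 sim2]]] := IH1 _ sim; have [t2 [rs3 [x2 l2 sim3]]] := IH2 _ sim2.
  exists (cost (compile_expr e) + t1 + t2).+1, rs3; split=> //.
    by apply: ExecWhileTrue x1 x2 => //; rewrite ee.
  by rewrite /= in l2 *; nia.
- move=> e c s he h rs sim; have [ee _] := eval_compile_expr sim he.
  exists (cost (compile_expr e)).+1, rs; split=> //; first by apply: ExecWhileFalse; rewrite ee.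
  by rewrite /=; lia.
Qed.

End Compilation.

(** * From words over an alphabet to words of codes *)

Section Injection.
Variables (T S : eqType) (f : T -> S).
Hypothesis f_inj : injective f.

Lemma infix_map_inj (s t : seq T) : infix (map f s) (map f t) = infix s t.
Proof.
apply/infixP/infixP => -[p [q E]]; last by exists (map f p), (map f q); rewrite E !map_cat.
exists (take (size p) t), (drop (size s) (drop (size p) t)).
have /(inj_map f_inj) sE : map f (take (size s) (drop (size p) t)) = map f s.
  by rewrite map_take map_drop E drop_size_cat // take_size_cat ?size_map.
by rewrite -[X in _ ++ X ++ _]sE !cat_take_drop.
Qed.

Lemma lz77_block_size_map (u v : seq T) :
  lz77_block_size (map f u) (map f v) = lz77_block_size u v.
Proof.
rewrite /lz77_block_size size_map; congr (minn _ _.+1).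
by apply: eq_find => l; rewrite -map_take infix_map_inj.
Qed.

Lemma lz77_map (w : seq T) : lz77 (map f w) = map (map f) (lz77 w).
Proof.
rewrite /lz77 size_map -[[::] in LHS]/(map f [::]).
move: (size w) [::] => k u; elim: k u w => [//|k IH] u [//|x v].
by rewrite /= -[f x :: map f v]/(map f (x :: v)) lz77_block_size_map -map_take -map_drop -map_cat IH.
Qed.

Lemma lz77_start_map (w : seq T) k : lz77_start (map f w) k = lz77_start w k.
Proof.
rewrite /lz77_start lz77_map; congr (sumn (take k _)).
by rewrite /shape -map_comp; apply: eq_map => s /=; rewrite size_map.
Qed.

Lemma nb_blocks_3starts_map (w w' : seq T) :
  nb_blocks_3starts (map f w) (map f w') = nb_blocks_3starts w w'.
Proof.
rewrite /nb_blocks_3starts lz77_map size_map; apply: eq_count => i.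
rewrite /starts_in_block /lz77_starts lz77_map size_map.
rewrite (eq_map (lz77_start_map w)); congr (3 <= _).
by apply: eq_count => x; rewrite !lz77_start_map.
Qed.

Lemma hamming_map (w w' : seq T) : hamming (map f w) (map f w') = hamming w w'.
Proof.
rewrite /hamming; elim: w w' => [|x w IH] [|y w'] //=.
by rewrite IH (inj_eq f_inj).
Qed.

End Injection.

Lemma hammingE (w w' : seq nat) : size w = size w' ->
  hamming w w' = count (fun x => nth 0 w x != nth 0 w' x) (iota 0 (size w)).
Proof.
rewrite /hamming; elim: w w' => [|x w IH] [|y w'] //= [sz].
rewrite IH // -[iota 1 _]/(iota (1 + 0) _) iotaDl count_map; congr (_ + _).
Qed.

(** The two edits are read off the sorted list of differing positions. *)
Lemma hamming2P (w w' : seq nat) : size w' = size w -> hamming w w' = 2 <->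
  exists i j, [/\ i < j < size w, nth 0 w' i <> nth 0 w i, nth 0 w' j <> nth 0 w j &
    forall x, x < size w -> nth 0 w' x = edit (nth 0 w) i (nth 0 w' i) j (nth 0 w' j) x].
Proof.
move=> sz; rewrite hammingE //; set D := fun x => _.
split=> [h|[i [j [ij iW jW h]]]].
  have sF : size (filter D (iota 0 (size w))) = 2 by rewrite size_filter.
  have oF : sorted ltn (filter D (iota 0 (size w))).
    by apply: sorted_filter (iota_ltn_sorted _ _); exact: ltn_trans.
  have mF x : (x \in filter D (iota 0 (size w))) = D x && (x < size w).
    by rewrite mem_filter mem_iota add0n.
  case: (filter _ _) sF oF mF => [|i [|j [|? ?]]] //= _ /andP[ij _] mF.
  have /esym/andP[Di ilt] : true = D i && (i < size w) by rewrite -mF !inE eqxx.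
  have /esym/andP[Dj jlt] : true = D j && (j < size w) by rewrite -mF !inE eqxx orbT.
  exists i, j; split; [by rewrite ij|by apply/eqP; rewrite eq_sym|by apply/eqP; rewrite eq_sym|].
  move=> x xlt; rewrite /edit; case: eqVneq => [->//|xi]; case: eqVneq => [->//|xj] /=.
  by have := mF x; rewrite !inE (negbTE xi) (negbTE xj) xlt andbT => /esym/negbFE/eqP/esym.
rewrite -size_filter (_ : filter _ _ = [:: i; j]) //.
apply: (irr_sorted_eq ltn_trans ltnn).
- by apply: sorted_filter (iota_ltn_sorted _ _); exact: ltn_trans.
- by rewrite /= andbT; case/andP: ij.
move=> x; rewrite mem_filter mem_iota add0n !inE /= /D.
have [xlt|xge] := ltnP x (size w); last by rewrite andbF; lia.
rewrite andbT (h x xlt) /edit; case: (eqVneq x i) => [->|xi] /=; first by rewrite eq_sym; apply/eqP.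
case: (eqVneq x j) => [->|xj] /=; first by rewrite eq_sym; apply/eqP.
by rewrite eqxx.
Qed.

(** * The complete program and its word size *)

Definition main_prog sg : icmd :=
  prev_occ_prog sg;; mismatch_prog;; base_prog;; search.

Definition start_state n : ist :=
  IState (fun r => if r == 5 then n else 0) (fun _ _ _ _ _ => 0).

Lemma main_prog_spec sg ratio_le (w : seq nat) (n := size w) (W := nth 0 w) thr i0 a0 j0 b0 P :
  (forall x, x < n -> W x < sg) -> 0 < thr ->
  (forall c, 0 < c -> ratio_le (size (lz77 w)) (c + (c + c)) = (thr <= c)) ->
  uniq P -> (forall p, p \in P -> p.2 \in lz77_starts w /\ hit w n i0 a0 j0 b0 p.1 p.2) ->
  wp n sg W ratio_le (main_prog sg) (start_state n) (fun k s => exists v,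
    [/\ v * thr <= 4 * (n * size (lz77 w)),
        k <= (sg + 36) * (n * n) + 1 + 28 * n * v &
    (rg s 0 = 1 /\ answer_ok n sg ratio_le w s) \/
    (rg s 0 = 0 /\ (valid_edits n sg w i0 a0 j0 b0 -> good_edits n ratio_le w i0 a0 j0 b0 ->
       size P < thr))]).
Proof.
move=> W_lt thr0 hthr uP hP.
apply: wp_seq; apply: (wp_use (@prev_occ_prog_spec n sg W ratio_le W_lt (start_state n) erefl)).
move=> k1 s1 [k1l t1] r1 m1.
have s15 : rg s1 5 = n by rewrite r1.
apply: wp_seq; apply: (wp_use (@mismatch_prog_spec n sg W ratio_le s1 s15)).
move=> k2 s2 [k2l t2] r2 m2.
have s25 : rg s2 5 = n by rewrite r2.
have pct : prev_occ_table n sg W (tb s2 0) by rewrite m2.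
apply: wp_seq.
apply: (wp_use (@base_prog_spec n sg W ratio_le W_lt w erefl _ s2 s25 pct t2 _ _)) => //.
- by move=> x; rewrite m2 // m1.
- by rewrite r2 // r1.
move=> k3 s3 [k3l z3 t3] r3 m3.
have s35 : rg s3 5 = n by rewrite r3.
have pct3 : prev_occ_table n sg W (tb s3 0) by rewrite m3.
have mm3 : mismatch_table n W (tb s3 1) by rewrite m3.
have z33 i a j b : tb s3 3 i a j b = 0 by rewrite m3 // m2 // m1.
have s30 : rg s3 0 = 0 by rewrite r3 // r2 // r1.
apply: (wp_use (search_spec _ W_lt thr0 hthr uP hP s35 z3 pct3 mm3 t3 z33 s30)) => //.
move=> k4 s4 [v [h1 h2 h3]] _ _; exists v; split=> //.
have nn : n <= n * n by case: (n) => // m; rewrite leq_pmulr.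
by rewrite mulnDl mulnDr in k1l h2 *; lia.
Qed.

(** N <= (n + 2) (sg + 1) <= (n + 2)^(sg + 1), as sg + 1 <= 2^sg, and 16 <= (n + 2)^4; hence the
    exponent 4 + 4 (sg + 1). *)
Lemma digits_le n sg ws : (n + 2) ^ (8 + 4 * sg) <= 2 ^ ws ->
  16 * (ndig n sg * (ndig n sg * (ndig n sg * ndig n sg))) <= 2 ^ ws.
Proof.
apply: leq_trans; set m := n + 2.
have m2 : 2 <= m by rewrite /m; lia.
have Nle : ndig n sg <= m ^ sg.+1.
  have h : sg.+1 <= m ^ sg by apply: leq_trans (ltn_expl sg (isT : 1 < 2)) _; case: (sg) => // k; rewrite leq_exp2r.
  by rewrite expnS; apply: leq_trans (leq_mul (leqnn m) h); rewrite /ndig /m; nia.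
have -> : 8 + 4 * sg = 4 + (sg.+1 + (sg.+1 + (sg.+1 + sg.+1))) by lia.
rewrite expnD; apply: leq_mul; first by rewrite -[16]/(2 ^ 4) leq_exp2r.
by rewrite !expnD; do !apply: leq_mul.
Qed.

(** * Good modifications as edits of codes *)

Section Transfer.
Variable Sigma : finType.
Local Notation code := (map (@encode_letter Sigma)).
Implicit Types w : seq Sigma.

Lemma encode_letter_inj : injective (@encode_letter Sigma).
Proof. by move=> a b /val_inj/enum_rank_inj. Qed.

Lemma encode_letter_lt a : @encode_letter Sigma a < #|Sigma|.
Proof. exact: ltn_ord. Qed.

Lemma encode_letter_surj x : x < #|Sigma| -> exists a : Sigma, encode_letter a = x.
Proof. by move=> h; exists (enum_val (Ordinal h)); rewrite /encode_letter enum_valK. Qed.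

Lemma code_lt w x : x < size w -> nth 0 (code w) x < #|Sigma|.
Proof.
case: w => [//|c w] h; rewrite (nth_map c) //; exact: encode_letter_lt.
Qed.

Lemma size_substitute2 w i j a b : i < size w -> j < size w ->
  size (substitute (substitute w i a) j b) = size w.
Proof. by move=> iw jw; rewrite /substitute !size_set_nth (maxn_idPr iw) (maxn_idPr jw). Qed.

Lemma code_substitute2 w i j a b : i < j < size w ->
  code (substitute (substitute w i a) j b) =
  edited_word (size w) (code w) i (encode_letter a) j (encode_letter b).
Proof.
move=> ij; have iw : i < size w by lia.
have jw : j < size w by lia.
apply: (@eq_from_nth _ 0); first by rewrite size_map size_mkseq size_substitute2.
move=> x; rewrite size_map size_substitute2 // => xw.
rewrite nth_mkseq // (nth_map b) ?size_substitute2 // /substitute nth_set_nth /=.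
rewrite /edit; have [->|xj] := eqVneq x j; first by rewrite gtn_eqF //; case/andP: ij.
rewrite (set_nth_default a) ?size_set_nth; last by rewrite (maxn_idPr iw).
by rewrite nth_set_nth /=; case: eqVneq => // _; rewrite (nth_map a).
Qed.

Variables (R : realType) (p : R) (w : seq Sigma).
Let ratio x y : bool := (p * x%:R <= y%:R)%R.
Local Notation n := (size w).

Lemma good_modification_code w' : good_modification p w w' <->
  [/\ size w' = n, hamming (code w) (code w') = 2 &
      ratio (size (lz77 (code w'))) (nb_blocks_3starts (code w) (code w'))].
Proof.
rewrite /good_modification hamming_map; last exact: encode_letter_inj.
by rewrite nb_blocks_3starts_map ?lz77_map ?size_map; try exact: encode_letter_inj.
Qed.

Lemma good_modification_edits w' : good_modification p w w' -> exists i a j b,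
  valid_edits n #|Sigma| (code w) i a j b /\ good_edits n ratio (code w) i a j b.
Proof.
case/good_modification_code => sw' /hamming2P; rewrite !size_map => /(_ sw')[i [j [ij iW jW h]]] hr.
exists i, (nth 0 (code w') i), j, (nth 0 (code w') j).
have E : edited_word n (code w) i (nth 0 (code w') i) j (nth 0 (code w') j) = code w'.
  apply: (@eq_from_nth _ 0); first by rewrite size_mkseq size_map.
  by move=> x; rewrite size_mkseq => xn; rewrite nth_mkseq // -h.
split; last by rewrite /good_edits E.
by split=> //; apply: code_lt; lia.
Qed.

Lemma edits_good_modification i a j b :
  valid_edits n #|Sigma| (code w) i (encode_letter a) j (encode_letter b) ->
  good_edits n ratio (code w) i (encode_letter a) j (encode_letter b) ->
  good_modification p w (substitute (substitute w i a) j b).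
Proof.
move=> [ij _ _ aW bW]; rewrite /good_edits -code_substitute2 // => hr.
have iw : i < n by lia.
have jw : j < n by lia.
apply/good_modification_code; split; [exact: size_substitute2| |exact: hr].
have E x : x < n -> nth 0 (code (substitute (substitute w i a) j b)) x =
    edit (nth 0 (code w)) i (encode_letter a) j (encode_letter b) x.
  by move=> xn; rewrite code_substitute2 // nth_mkseq.
have Ei : nth 0 (code (substitute (substitute w i a) j b)) i = encode_letter a.
  by rewrite E // /edit eqxx.
have Ej : nth 0 (code (substitute (substitute w i a) j b)) j = encode_letter b.
  by rewrite E // /edit gtn_eqF ?eqxx //; lia.
apply/hamming2P; first by rewrite !size_map size_substitute2.
by exists i, j; rewrite Ei Ej size_map; split.
Qed.

End Transfer.

(** The length moves to register 5, since register 0 is to hold the answer. *)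
Definition ram_prog sg : cmd :=
  Seq (Assign 5 (EReg 0)) (Seq (Assign 0 (EConst 0)) (compile sg (main_prog sg))).

Lemma ram_prog_exec sg ratio_le ws (w : seq nat) (n := size w) k s :
  (forall x, x < n -> nth 0 w x < sg) -> (n + 2) ^ (8 + 4 * sg) <= 2 ^ ws ->
  iexec n sg (nth 0 w) ratio_le (main_prog sg) (start_state n) k s ->
  exists t rs, [/\ exec ws ratio_le (ram_prog sg) (State (upd (fun=> 0) 0 n) (nth 0 w)) t rs,
    t <= unit_time (compile sg (main_prog sg)) * k.+1 + 4 & forall x, reg rs x = rg s x].
Proof.
move=> w_lt /digits_le hws hx.
have V_gt : n + sg + 2 < vmax n sg by have := vmax_ge n sg; lia.
have w_lt' x : x < ndig n sg -> nth 0 w x < vmax n sg.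
  have [xn _|xn _] := ltnP x n; first by apply: leq_trans (w_lt x xn) _; lia.
  by rewrite nth_default //; lia.
pose rs0 := State (upd (upd (upd (fun=> 0) 0 n) 5 n) 0 (0 %% 2 ^ ws)) (nth 0 w).
have sim : simulates sg n (nth 0 w) (start_state n) rs0.
  split=> //=.
  - by move=> x; rewrite /upd mod0n; do !case: eqP => //; move=> ->.
  - by move=> x; case: eqP; lia.
  - move=> k' a b c d k8 aN bN cN dN; split; last by lia.
    rewrite nth_default //; have := address_ge sg n k' a b c d.
    by rewrite /ndig -/n; lia.
have [t [rs [x l sim']]] := compile_correct w_lt' hws hx sim.
exists (2 + (2 + t)), rs; split; last by case: sim'.
  apply: (ExecSeq (s2 := State (upd (upd (fun=> 0) 0 n) 5 n) (nth 0 w))).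
    exact: (ExecAssign _ _ 5 (EReg 0)).
  apply: (ExecSeq (s2 := rs0)) x.
  exact: (ExecAssign _ _ 0 (EConst 0) (State (upd (upd (fun=> 0) 0 n) 5 n) (nth 0 w))).
by lia.
Qed.

(** * The threshold, the running time and the theorem *)

Local Open Scope ring_scope.

(** The least positive c with p z <= 3 c; the condition is monotone in c, so testing it is comparing
    c with this number. The 3 is the greatest number of starts in a block. *)
Lemma threshold (R : realType) (p : R) (z : nat) : 0 < p -> p <= 1 -> exists thr : nat,
  [/\ (0 < thr)%N, p * z%:R <= (3 * thr)%:R &
    forall c, (0 < c)%N -> (p * z%:R <= (c + (c + c))%:R) = (thr <= c)%N].
Proof.
move=> p0 p1; pose Q c := (0 < c)%N && (p * z%:R <= (3 * c)%:R).
have exQ : exists c, Q c.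
  exists z.+1; rewrite /Q /= natrM mulrS.
  have : 0 <= z%:R :> R by exact: ler0n.
  nra.
exists (ex_minn exQ); case: ex_minnP => thr /andP[t0 tQ] tmin; split=> // c c0.
rewrite (_ : c + (c + c) = 3 * c)%N; last lia.
apply/idP/idP => h; first by apply: tmin; rewrite /Q c0.
by apply: le_trans tQ _; rewrite ler_nat leq_mul2l h orbT.
Qed.

Lemma time_bound (R : realType) (p : R) (n z thr v k t U sg : nat) :
  0 < p -> p <= 1 -> (0 < thr)%N -> (z <= n)%N -> ((0 < n) -> (0 < z))%N ->
  p * z%:R <= (3 * thr)%:R -> (v * thr <= 4 * (n * z))%N ->
  (k <= (sg + 36) * (n * n) + 1 + 28 * n * v)%N -> (t <= U * k.+1 + 4)%N ->
  t%:R <= (U * (sg + 400) + 4)%:R * (1 + n%:R ^+ 2 / p).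
Proof.
move=> p0 p1 thr0 zn nz hthr hv hk ht.
(* p z v <= 3 [thr] v <= 12 n z, where z cancels; for n = 0 there is no verification. *)
have pv : p * v%:R <= 12 * n%:R.
  have [n0|n0] := posnP n.
    move: hv; rewrite n0 muln0 leqn0 muln_eq0 [thr == 0%N]gtn_eqF // orbF => /eqP->.
    by rewrite !mulr0.
  have z0 : 0 < z%:R :> R by rewrite ltr0n nz.
  rewrite -(ler_pM2r z0).
  have h1 : p * z%:R * v%:R <= (3 * thr)%:R * v%:R by rewrite ler_wpM2r ?ler0n.
  have h2 : (3 * thr)%:R * v%:R <= (12 * (n * z))%:R :> R by rewrite -natrM ler_nat; lia.
  by move: (le_trans h1 h2); rewrite !natrM; lra.
set q := n%:R ^+ 2 / p.
have nq : (n * n)%:R <= q by rewrite /q ler_pdivlMr // natrM -expr2 ler_piMr // exprn_ge0.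
have nvq : (n * v)%:R <= 12 * q.
  rewrite /q mulrA ler_pdivlMr // natrM expr2 mulrA [_ * v%:R * p]mulrC mulrCA.
  by rewrite [12 * _]mulrC -mulrA ler_wpM2l ?ler0n // [X in _ <= X]mulrC.
(* The coefficient of q is sg + 36 + 28 * 12, that is sg + 372. *)
have kq : (k.+1)%:R <= (sg + 400)%:R * (1 + q).
  have : (k.+1 <= (sg + 36) * (n * n) + 2 + 28 * (n * v))%N by lia.
  rewrite -(ler_nat R) => /le_trans; apply.
  rewrite !natrD !natrM !natrD; rewrite natrM in nq; rewrite natrM in nvq.
  have s0 : 0 <= sg%:R :> R by exact: ler0n.
  have : sg%:R * (n%:R * n%:R) <= sg%:R * q by rewrite ler_wpM2l.
  have : 0 <= q by apply: le_trans nq; rewrite mulr_ge0 ?ler0n.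
  by move=> q0 h; lra.
have q0 : 0 <= q by apply: le_trans nq; rewrite ler0n.
move: ht; rewrite -(ler_nat R) => /le_trans; apply.
rewrite !natrD natrM.
have : U%:R * k.+1%:R <= U%:R * ((sg + 400)%:R * (1 + q)) by rewrite ler_wpM2l ?ler0n.
rewrite natrM; lra.
Qed.

(* Words of k * log2 (|w| + 2) bits suffice, k being a constant.  The summand 1
   only matters for the empty word, as |w|^2 / p >= 1 otherwise. *)
Theorem theorem4 (R : realType) (Sigma : finType) :
  exists (prog : cmd) (C k : nat),
    forall (p : R) (w : seq Sigma) (ws : nat),
      0 < p -> p <= 1 -> ((size w + 2) ^ k <= 2 ^ ws)%N ->
      halts_correctly ws prog p w (C%:R * (1 + (size w)%:R ^+ 2 / p)).
Proof.
pose sg := #|Sigma|; exists (ram_prog sg).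
have [U UE] : exists U, U = unit_time (compile sg (main_prog sg)) by eexists.
exists (U * (sg + 400) + 4)%N, (8 + 4 * sg)%N => p w ws p0 p1 hws.
pose u := map (@encode_letter Sigma) w.
pose ratio x y : bool := p * x%:R <= y%:R.
have su : size u = size w by rewrite size_map.
have u_lt x : (x < size u)%N -> (nth 0%N u x < sg)%N by rewrite su; apply: code_lt.
have [thr [thr0 thr_le thrE]] := threshold (size (lz77 u)) p0 p1.
pose solvable := exists i a j b, valid_edits (size u) sg u i a j b /\ good_edits (size u) ratio u i a j b.
(* The program does not depend on the target, which may be chosen afterwards for the sake of the
   analysis. *)
have run i a j b P : uniq P ->
    (forall q, q \in P -> q.2 \in lz77_starts u /\ hit u (size u) i a j b q.1 q.2) ->
    exists t rs, [/\ exec ws ratio (ram_prog sg) (input_state w) t rs,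
      t%:R <= (U * (sg + 400) + 4)%:R * (1 + (size w)%:R ^+ 2 / p) :> R &
      (reg rs 0 = 1%N /\ [/\ valid_edits (size u) sg u (reg rs 1) (reg rs 2) (reg rs 3) (reg rs 4) &
         good_edits (size u) ratio u (reg rs 1) (reg rs 2) (reg rs 3) (reg rs 4)]) \/
      (reg rs 0 = 0%N /\ (valid_edits (size u) sg u i a j b -> good_edits (size u) ratio u i a j b ->
         (size P < thr)%N))].
  move=> uP hP; have [k [s [hx [v [hv hk hs]]]]] :=
    @main_prog_spec sg ratio u thr i a j b P u_lt thr0 thrE uP hP.
  have hws' : ((size u + 2) ^ (8 + 4 * sg) <= 2 ^ ws)%N by rewrite su.
  have [t [rs [x ht hr]]] := ram_prog_exec u_lt hws' hx.
  exists t, rs; split; first by move: x; rewrite su.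
    rewrite -su; apply: (time_bound (z := size (lz77 u)) (thr := thr) p0 p1 thr0 _ _ thr_le hv hk).
    - exact: size_lz77_le.
    - by rewrite -{1}(lz77_start0 u) lz77_start_ltn.
    - by rewrite UE.
  by rewrite !hr.
(* p z <= 3 p z' <= 3 nb, where z' is the number of blocks of the edited word and nb the number of
   those with three starts; so good edits have enough hits to reach the threshold. *)
have good_nb i a j b : valid_edits (size u) sg u i a j b -> good_edits (size u) ratio u i a j b ->
    (thr <= nb_blocks_3starts u (edited_word (size u) u i a j b))%N.
  move=> [/andP[ij jn] _ _ _ _]; rewrite /good_edits /ratio; set u' := edited_word _ _ _ _ _ _ => hg.
  have su' : size u' = size u by rewrite size_mkseq.
  have eu' x : (x < size u)%N -> nth 0%N u' x = edit (nth 0%N u) i a j b x.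
    by move=> xn; rewrite nth_mkseq.
  have z3 := size_lz77_le3 (erefl _) su' ij jn eu'.
  have z'0 : (0 < size (lz77 u'))%N.
    by rewrite -lz77_start_ltn // lz77_start0 su'; lia.
  have nb0 : (0 < nb_blocks_3starts u u')%N.
    by rewrite -(ltr_nat R); apply: lt_le_trans hg; rewrite mulr_gt0 // ltr0n.
  rewrite -thrE //; rewrite -(ler_nat R) natrM in z3.
  rewrite !natrD; nra.
(* The target is a pair of good edits if there is one. Otherwise it is arbitrary, without hits, and
   a positive answer would itself exhibit good edits. *)
have [[i [a [j [b [val good]]]]]|none] := classic solvable.
  have [/andP[ij jn] _ _ _ _] := val.
  have [||P [uP sP hP]] := @bad_block_hits u (edited_word (size u) u i a j b) (size u) i a j b
    (erefl _) _ ij jn _; first by rewrite size_mkseq.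
    by move=> x xn; rewrite nth_mkseq.
  have [t [rs [x ht hr]]] := run _ _ _ _ _ uP hP.
  exists t, rs; split=> //.
  have [r0 [val' good']] : reg rs 0 = 1%N /\ [/\ valid_edits (size u) sg u (reg rs 1) (reg rs 2) (reg rs 3) (reg rs 4) &
         good_edits (size u) ratio u (reg rs 1) (reg rs 2) (reg rs 3) (reg rs 4)].
    case: hr => // -[_ /(_ val good)]; rewrite sP ltnNge.
    by rewrite good_nb.
  have [/andP[ij' jn'] a'n b'n _ _] := val'.
  have [a' ea'] := encode_letter_surj a'n; have [b' eb'] := encode_letter_surj b'n.
  have gm : good_modification p w (substitute (substitute w (reg rs 1) a') (reg rs 3) b').
    by apply: edits_good_modification; rewrite ea' eb' -su.
  split; [by right|split=> // _; eexists; exact: gm|move=> _].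
  exists (reg rs 1), (reg rs 3), a', b'; split=> //; rewrite -?su; [lia|lia|lia].
have unsolvable : ~ exists w', good_modification p w w'.
  by move=> [w' /good_modification_edits[i [a [j [b h]]]]]; apply: none; exists i, a, j, b; rewrite su.
have [t [rs [x ht hr]]] := @run 0%N 0%N 0%N 0%N [::] isT (fun q => ltac:(by [])).
exists t, rs; split=> //.
have r0 : reg rs 0 = 0%N.
  case: hr => [[_ [val good]]|[]//]; case: none.
  by exists (reg rs 1), (reg rs 2), (reg rs 3), (reg rs 4).
by split=> //; [left|split=> //; rewrite r0].
Qed.
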